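(* Let $\zeta\equiv\Phi$ or $\zeta\equiv1$. (i) For $s\ge0$: $\mathbb E[X^\zeta_s]=\mu s+\mu\int_0^s\int_0^u\Psi(r)\,dr\,du$ if $\zeta\equiv1$, and $\mathbb E[X^\zeta_s]=\mu\int_0^s\Psi(u)\,du$ if $\zeta\equiv\Phi$. (ii) For $0\le s\le t$: $$\mathbb E[X^\Phi_sX^\zeta_t]=\mathbb E[X^\Phi_s]\mathbb E[X^\zeta_t]+\mu\int_0^s\zeta(t-v)\Psi(s-v)\Big(1+\int_0^v\Psi(w)dw\Big)dv+\mu\int_0^t\int_0^{s\wedge u}\zeta(t-u)\Psi(u-v)\Psi(s-v)\Big(1+\int_0^v\Psi(v-w)dw\Big)dv\,du,$$ and $$\mathbb E[X^1_sX^\zeta_t]=\mathbb E[X^1_s]\mathbb E[X^\zeta_t]+\mu\int_0^s\zeta(t-u)\Big(1+\int_u^s\Psi(y-u)dy\Big)\Big(1+\int_0^u\Psi(w)dw\Big)du+\mu\int_0^t\int_0^{s\wedge u}\zeta(t-u)\Psi(u-v)\Big(1+\int_0^v\Psi(w)dw\Big)\Big(1+\int_v^s\Psi(y-v)dy\Big)dv\,du.$$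
   Context: Let $\mu>0$ and $\Phi:\mathbb{R}_+\to\mathbb{R}_+$ integrable with $\int_0^\infty\Phi<1$. Let $\Phi_1:=\Phi$, $\Phi_n(t):=\int_0^t\Phi(t-s)\Phi_{n-1}(s)ds$, and $\Psi:=\sum_{n\ge1}\Phi_n$ (convergent in $L^1(\mathbb{R}_+)$). Let $N$ be a Poisson random measure on $\mathbb{R}_+\times\mathbb{R}_+$ with intensity $dt\,d\theta$ (canonical process on the Poisson space). Let $\lambda$ be the unique solution of $\lambda_t=\mu+\int_{(0,t)\times\mathbb{R}_+}\Phi(t-s)\mathbf 1_{\{\theta\le\lambda_s\}}N(ds,d\theta)$, and for $\zeta\in\{\Phi,1\}$ ($1$ the constant function) set $X^\zeta_t:=\int_{(0,t)\times\mathbb{R}_+}\zeta(t-s)\mathbf 1_{\{\theta\le\lambda_s\}}N(ds,d\theta)$; thus $X^\Phi_t=\lambda_t-\mu$ and $X^1_t=H_t$, the Hawkes process with intensity $\lambda$. *)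

(* Defs.v *)
From HB Require Import structures.
From mathcomp Require Import all_boot all_order all_algebra.
From mathcomp Require Import all_classical all_reals all_analysis.
From mathcomp Require Import measurable_realfun lebesgue_measure lebesgue_integral probability.
Set Implicit Arguments. Unset Strict Implicit. Unset Printing Implicit Defensive.
Import Order.TTheory GRing.Theory Num.Theory.
Import numFieldNormedType.Exports.
Local Open Scope classical_set_scope.
Local Open Scope ring_scope.

Section Defs.
Context {R : realType}.

Definition leb := (@lebesgue_measure R).
Definition leb2 := (leb \x leb)%E.

Definition quadrant : set (R * R) := `[0%R, +oo[%classic `*` `[0%R, +oo[%classic.

Definition prm_intensity (A : set (R * R)) : \bar R := leb2 (A `&` quadrant).

(* Poisson pmf with mean m >= 0 (with the convention that mean 0 is the Dirac
   mass at 0, since 0 ^+ 0 = 1 and 0 ^+ k.+1 = 0). *)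
Definition pois (m : R) (k : nat) : R := m ^+ k / (k`!)%:R * expR (- m).

Definition is_PRM d (Omega : measurableType d) (P : probability Omega R)
  (N : Omega -> {measure set (R * R)%type -> \bar R}) : Prop :=
  (forall A : set (R * R), measurable A ->
     measurable_fun [set: Omega] ((fun w => N w A) : Omega -> \bar R)) /\
  (forall (n : nat) (A : 'I_n -> set (R * R)) (k : 'I_n -> nat),
     (forall i, measurable (A i)) ->
     (forall i, (prm_intensity (A i) < +oo)%E) ->
     (forall i j, i != j -> A i `&` A j = set0) ->
     P (\bigcap_(i in [set: 'I_n]) [set w | N w (A i) = ((k i)%:R)%:E]) =
       (\prod_(i < n) pois (fine (prm_intensity (A i))) (k i))%:E).

Definition Xz d (Omega : measurableType d)
  (N : Omega -> {measure set (R * R)%type -> \bar R})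
  (lam : Omega -> R -> R) (zeta : R -> R) (t : R) (w : Omega) : \bar R :=
  (\int[N w]_(p in [set p : R * R | (0 < p.1 < t)%R /\ (0 <= p.2)%R])
     ((zeta (t - p.1) * (if (p.2 <= lam w p.1)%R then 1 else 0))%R)%:E)%E.

(* Convolution powers Phi_n (n >= 1), with values in [0, +oo]:
   Phi_1 = Phi, Phi_{n+1}(t) = int_0^t Phi(t-s) Phi_n(s) ds.
   convpow Phi n = Phi_{n+1}. *)
Fixpoint convpow (Phi : R -> R) (n : nat) : R -> \bar R :=
  match n with
  | 0 => fun t => (Phi t)%:E
  | m.+1 => fun t =>
      (\int[leb]_(s in (`[0%R, t]%classic : set R)) ((Phi (t - s))%:E * convpow Phi m s))%E
  end.

(* Psi = sum_{n >= 1} Phi_n (pointwise sum of nonnegative terms; it coincides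
   a.e. with the L^1 sum). *)
Definition Psi (Phi : R -> R) (t : R) : \bar R :=
  (\sum_(0 <= n <oo) convpow Phi n t)%E.

Definition Exp d (Omega : measurableType d) (P : probability Omega R)
  (f : Omega -> \bar R) : \bar R := (\int[P]_w f w)%E.

Definition I (a b : R) (f : R -> \bar R) : \bar R :=
  (\int[leb]_(x in (`[a, b]%classic : set R)) f x)%E.

End Defs.

(* Main.v *)
(** The random measure is replaced, off a null set, by one with at most one point on
    each line of constant time.  Writing [nu] for the intensity, compensation
    [E N(h) = E nu(h)] for predictable [h] and the splitting of a product of two
    integrals by the order of the times give the isometry
    [E((N - nu)(h) (N - nu)(k)) = E nu(h k)].

    A Picard iteration with truncated intensities increases to a predictable
    solution [lamoo] whose number of points in bounded time is square integrable, and any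
    solution agrees with [lamoo] up to points that [N] a.s. does not charge.  Let
    [H f] be the sum of [f(s)] over the accepted points.  The equation for the intensity
    reads [nu(f) = mu int f + H (P f)] with [(P f)(s) = int Phi(t - s) f(t) dt], and
    [R f = f + int Psi(t - s) f(t) dt] solves [R f = f + P (R f)].  Applying compensation
    and the isometry to [R f] and [R g], the terms with [P] cancel, whence
    [E (H f) = mu int R f] and
    [E (H f * H g) = E (H f) * E (H g) + E (H (R f * R g))].
    The theorem is the case [f = Phi(s - _)], for which [R f = Psi(s - _)], or
    [f = 1] on [(0, s)], and likewise for [g]. *)

Require Import Defs.
From HB Require Import structures.
From mathcomp Require Import all_boot all_order all_algebra.
From mathcomp Require Import finmap lra ring all_classical all_reals all_analysis.
From mathcomp Require Import measurable_realfun lebesgue_measure lebesgue_integral probability.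
Import Order.TTheory GRing.Theory Num.Theory.
Import numFieldNormedType.Exports.
Local Open Scope classical_set_scope.
Local Open Scope ring_scope.
Set Implicit Arguments. Unset Strict Implicit. Unset Printing Implicit Defensive.

(** * Nonnegative integrals *)

Section general.
Local Open Scope ereal_scope.
Import HBNNSimple.

(** Three obstacles shape the proof. No filtration is given: [is_PRM] prescribes the joint law of
    the counts on disjoint sets only. The past is therefore built from events that depend on counts
    over finitely many bounded sets; they suffice to generate the predictable sigma-algebra. The
    given [lam] is jointly measurable but not known to be predictable, so compensation is applied to
    the minimal solution alone and [lam] is compared with it path by path; the weak inequality
    [theta <= lam] against the strict one used for thinning makes the graph of the intensity matter.
    Finally, cancelling terms needs finite expectations, while [Phi] is merely integrable and
    [Phi (s - _)] may be unbounded. Cancellation is thus done for bounded test functions that vanish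
    after a time [T], whose moments are dominated by those of the number of points up to [T]; these
    are bounded uniformly along the Picard iteration because the integral of [Phi] is less than 1.
    Truncation and monotone convergence then give the formulas in the extended reals, where both
    sides may be infinite. *)

Lemma ge0_measurable_ind d (T : measurableType d) (R : realType)
    (C : (T -> \bar R) -> Prop) :
  (forall A, measurable A -> C (fun x => (\1_A x)%:E)) ->
  (forall r f, (0 <= r)%R -> measurable_fun setT f -> (forall x, 0 <= f x) ->
     C f -> C (fun x => r%:E * f x)) ->
  (forall f g, measurable_fun setT f -> (forall x, 0 <= f x) ->
     measurable_fun setT g -> (forall x, 0 <= g x) ->
     C f -> C g -> C (fun x => f x + g x)) ->
  (forall f_ f, (forall n, measurable_fun setT (f_ n)) ->
     (forall n x, 0 <= f_ n x) ->
     (forall x, nondecreasing_seq (f_ ^~ x)) ->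
     (forall x, f_ n x @[n --> \oo] --> f x) ->
     (forall n, C (f_ n)) -> C f) ->
  forall f, measurable_fun setT f -> (forall x, 0 <= f x) -> C f.
Proof.
move=> C1 CZ CD Clim f mf f0.
pose f_ := nnsfun_approx measurableT mf.
apply: (Clim (fun n x => (f_ n x)%:E)).
- by move=> n; exact/measurable_EFinP.
- by move=> n x; rewrite lee_fin.
- by move=> x a b ab; rewrite lee_fin; exact/lefP/nd_nnsfun_approx.
- by move=> x; exact: cvg_nnsfun_approx.
move=> n; rewrite (_ : (fun x => _) = (fun x => \sum_(r <- fset_set (range (f_ n)))
    (r * \1_(f_ n @^-1` [set r]) x)%:E)); last first.
  by apply/funext => x; rewrite fimfunE -fsumEFin// fsbig_finite.
elim: (fset_set _ : seq R) => [|r s ih].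
  rewrite (_ : (fun x => _) = (fun x => (0%R : R)%:E * (\1_(@setT T) x)%:E)).
    by apply: CZ => //; [exact/measurable_EFinP|exact: C1].
  by apply/funext => x; rewrite big_nil mul0e.
have -> : (fun x => \sum_(r0 <- r :: s) (r0 * \1_(f_ n @^-1` [set r0]) x)%:E) =
    (fun x => (r * \1_(f_ n @^-1` [set r]) x)%:E +
      \sum_(r0 <- s) (r0 * \1_(f_ n @^-1` [set r0]) x)%:E).
  by apply/funext => x; rewrite big_cons.
have mr t : measurable_fun setT (fun x => (t * \1_(f_ n @^-1` [set t]) x)%:E).
  exact/measurable_EFinP/measurable_funM.
apply: CD => //.
- by move=> x; rewrite nnfun_muleindic_ge0.
- by apply: emeasurable_sum => t _; exact: mr.
- by move=> x; apply: sume_ge0 => t _; rewrite nnfun_muleindic_ge0.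
have [r0|r0] := leP 0%R r.
  rewrite (_ : (fun x => _) = (fun x => r%:E * (\1_(f_ n @^-1` [set r]) x)%:E)).
    by apply: CZ => //; [exact/measurable_EFinP|exact: C1].
  by apply/funext => x; rewrite EFinM.
(* A negative [r] is not a value of the approximation, so its preimage is empty; the zero function
   is written as [0] times an indicator to fit the closure hypotheses. *)
rewrite (_ : (fun x => _) = (fun x => (0%R : R)%:E * (\1_(@setT T) x)%:E)).
  by apply: CZ => //; [exact/measurable_EFinP|exact: C1].
by apply/funext => x; rewrite preimage_nnfun0// indic0 mulr0 mul0e.
Qed.

(* No measurability of [f] is required: a nonnegative simple function below [f]
   can be cut down to the good set, where it is below [g]. *)
Lemma ge0_ae_integral_measurable_eq d (T : measurableType d) (R : realType)
    (P : {measure set T -> \bar R}) (f g : T -> \bar R) :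
  (forall x, 0 <= f x) -> (forall x, 0 <= g x) -> measurable_fun setT g ->
  {ae P, forall x, f x = g x} -> \int[P]_x f x = \int[P]_x g x.
Proof.
move=> f0 g0 mg [Z [mZ PZ fgZ]].
have gE : \int[P]_x g x = \int[P]_(x in ~` Z) g x.
  rewrite (ge0_negligible_integral mZ)//.
  by rewrite setTD.
have fE x : ~ Z x -> f x = g x.
  by move=> nZx; apply: contrapT => fgx; apply: nZx; exact: fgZ.
apply/eqP; rewrite eq_le; apply/andP; split.
  rewrite [leLHS]ge0_integralTE//; apply: ge_ereal_sup => _ [h /= hf <-].
  rewrite -integralT_nnsfun (ge0_negligible_integral mZ)//; last 2 first.
  - exact/measurable_EFinP.
  - by move=> x _; rewrite lee_fin.
  rewrite setTD gE; apply: ge0_le_integral => //.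
  - exact: measurableC.
  - by move=> x _; rewrite lee_fin.
  - exact/measurable_EFinP/measurable_funTS.
  - exact: measurable_funTS.
  - by move=> x nZx; rewrite -fE.
rewrite gE (eq_integral f); last first.
  by move=> x; rewrite inE => nZx; rewrite fE.
rewrite integral_mkcond [leLHS]ge0_integralTE; last first.
  by move=> x; rewrite patchE; case: ifPn.
rewrite [leRHS]ge0_integralTE//.
apply: le_ereal_sup => _ [h /= hf <-]; exists h => //= x.
by rewrite (le_trans (hf x))// patchE; case: ifPn.
Qed.

(** The indeterminate form [0 * +oo] is harmless here: monotonicity keeps every term below its
    limit, so if the product of the limits is zero all the products vanish. *)
Lemma ge0_cvge_nondecreasing_mul (R : realType) (a b : (\bar R)^nat) (l m : \bar R) :
  nondecreasing_seq a -> nondecreasing_seq b ->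
  (forall n, 0 <= a n) -> (forall n, 0 <= b n) ->
  a @ \oo --> l -> b @ \oo --> m ->
  (fun n => a n * b n) @ \oo --> l * m.
Proof.
move=> nda ndb a0 b0 al bm.
have ge (c : (\bar R)^nat) k n : nondecreasing_seq c -> c @ \oo --> k -> c n <= k.
  move=> ndc ck; rewrite -(cvg_lim _ ck)//; apply: lime_ge; first by apply/cvg_ex; exists k.
  by exists n => // j; exact: ndc.
have [lm0|lm0] := eqVneq (l * m) 0; last exact: cvgeM (neq0_mule_def lm0) al bm.
have ab0 n : a n * b n = 0.
  apply/eqP; rewrite eq_le mule_ge0// andbT -lm0.
  by apply: lee_pmul => //; exact: ge.
rewrite lm0; under eq_fun do rewrite ab0; exact: cvg_cst.
Qed.

Lemma lebesgue_measure_reflect (R : realType) (a : R) (A : set R) : measurable A ->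
  pushforward (@lebesgue_measure R) (fun x : measurableTypeR R => (a - x)%R : measurableTypeR R) A =
  @lebesgue_measure R A.
Proof.
have ma : measurable_fun setT (fun x : measurableTypeR R => (a - x)%R : measurableTypeR R).
  exact: measurable_funB.
move=> mA; apply/esym.
have := @lebesgue_measure_unique R (pushforward (@lebesgue_measure R) (fun x : measurableTypeR R => (a - x)%R : measurableTypeR R)).
apply => // _ [[x y]] _ <-.
rewrite [RHS](_ : _ = lebesgue_measure (`[(a - y)%R, (a - x)%R[%classic : set R)); last first.
  rewrite /pushforward; congr (lebesgue_measure _).
  by apply/seteqP; split => z /=; rewrite !in_itv/= => /andP[? ?]; apply/andP; split; lra.
rewrite !lebesgue_measure_itv/= !lte_fin.
rewrite (_ : (a - y < a - x)%R = (x < y)%R); last by apply/idP/idP; lra.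
by case: ifPn => // _; congr _%:E; lra.
Qed.

Lemma ge0_integral_reflect (R : realType) (a : R) (f : R -> \bar R) :
  measurable_fun setT f -> (forall x, 0 <= f x) ->
  \int[@lebesgue_measure R]_x f (a - x)%R = \int[@lebesgue_measure R]_x f x.
Proof.
move=> mf f0.
have ma : measurable_fun setT (fun x : measurableTypeR R => (a - x)%R : measurableTypeR R).
  exact: measurable_funB.
rewrite -[LHS](ge0_integral_pushforward ma (@lebesgue_measure R) measurableT mf)//.
by apply: eq_measure_integral => A mA _; exact: lebesgue_measure_reflect.
Qed.
End general.

Section tonelli.
Local Open Scope ereal_scope.
Context d1 d2 (T1 : measurableType d1) (T2 : measurableType d2) (R : realType).

(** Meant for the measures [N w], which are sigma-finite by a hypothesis on each path; the
    corresponding structure is packed inside the proof. *)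
Lemma measurable_ge0_tonelli (m2 : {measure set T2 -> \bar R}) (f : T1 * T2 -> \bar R) :
  sigma_finite setT m2 -> measurable_fun setT f -> (forall x, 0 <= f x) ->
  measurable_fun setT (fun x => \int[m2]_y f (x, y)).
Proof.
move=> s2 mf f0.
pose H2 := isSFinite.Build _ _ _ _ (sfinite_measure_sigma_finite s2).
pose H2' := isSigmaFinite.Build _ _ _ _ s2.
pose m2' := HB.pack_for (SigmaFiniteMeasure.type T2 R) (Measure.sort m2) H2 H2'.
exact: (@measurable_fun_fubini_tonelli_F _ _ T1 T2 R m2' f).
Qed.

Lemma ge0_tonelli (m1 : {measure set T1 -> \bar R}) (m2 : {measure set T2 -> \bar R})
    (f : T1 * T2 -> \bar R) :
  sigma_finite setT m1 -> sigma_finite setT m2 ->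
  measurable_fun setT f -> (forall x, 0 <= f x) ->
  \int[m1]_x \int[m2]_y f (x, y) = \int[m2]_y \int[m1]_x f (x, y).
Proof.
move=> s1 s2 mf f0.
pose H1 := isSFinite.Build _ _ _ _ (sfinite_measure_sigma_finite s1).
pose H1' := isSigmaFinite.Build _ _ _ _ s1.
pose m1' := HB.pack_for (SigmaFiniteMeasure.type T1 R) (Measure.sort m1) H1 H1'.
pose H2 := isSFinite.Build _ _ _ _ (sfinite_measure_sigma_finite s2).
pose H2' := isSigmaFinite.Build _ _ _ _ s2.
pose m2' := HB.pack_for (SigmaFiniteMeasure.type T2 R) (Measure.sort m2) H2 H2'.
exact: (@fubini_tonelli _ _ T1 T2 R m1' m2' f).
Qed.
End tonelli.

(** * Locally finite measures on the plane *)

Section box.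
Context {R : realType}.
Notation R2 := (R * R)%type.

Definition box (n : nat) : set R2 := `[- n%:R, n%:R]%classic `*` `[- n%:R, n%:R]%classic.

Lemma measurable_box n : measurable (box n).
Proof. by apply: measurableX => //; exact: measurable_itv. Qed.

Lemma subset_box m n : (m <= n)%N -> box m `<=` box n.
Proof.
move=> mn [x y]; rewrite /box /= !in_itv/= => -[/andP[? ?] /andP[? ?]].
have : m%:R <= n%:R :> R by rewrite ler_nat.
by split; apply/andP; split; lra.
Qed.

Lemma in_box (p : R2) n : `|p.1| <= n%:R -> `|p.2| <= n%:R -> box n p.
Proof. by rewrite !ler_norml /box/= !in_itv. Qed.

Lemma bigcup_box : \bigcup_n box n = setT.
Proof.
apply/seteqP; split => // p _.
exists (maxn (Num.truncn `|p.1|).+1 (Num.truncn `|p.2|).+1) => //.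
by apply: in_box; apply: (le_trans (ltW (truncnS_gt _))); rewrite ler_nat ?leq_maxl ?leq_maxr.
Qed.

Definition locfin (m : set R2 -> \bar R) := forall n, (m (box n) < +oo)%E.

Lemma locfin_sigma_finite (m : {measure set R2 -> \bar R}) :
  locfin m -> sigma_finite setT m.
Proof.
move=> fm; exists box; first by rewrite bigcup_box.
by move=> n; split; [exact: measurable_box|exact: fm].
Qed.

Lemma cvg_measure_box (m : {measure set R2 -> \bar R}) (A : set R2) : measurable A ->
  m (A `&` box n) @[n --> \oo] --> m A.
Proof.
move=> mA; rewrite -{2}(setIT A) -bigcup_box setI_bigcupr.
apply: nondecreasing_cvg_mu.
- by move=> n; apply: measurableI => //; exact: measurable_box.
- by apply: bigcup_measurable => n _; apply: measurableI => //; exact: measurable_box.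
- by move=> i j ij; apply/subsetPset; apply: setIS; exact: subset_box.
Qed.

Section kernels.
Import HBNNSimple.
Context d (X : measurableType d).
Variable l : X -> {measure set R2 -> \bar R}.
Hypothesis ml : forall U, measurable U -> measurable_fun setT (l ^~ U).
Hypothesis fl : forall x, locfin (l x).

(** Restricted to a box each measure [l x] is finite, and for finite measures the mass of a section
    is measurable in [x]. The boxes then exhaust the plane. *)
Lemma measurable_xsection_locfin (A : set (X * R2)) : measurable A ->
  measurable_fun setT (fun x => l x (xsection A x)).
Proof.
move=> mA.
have cv x : l x (xsection A x `&` box n) @[n --> \oo] --> l x (xsection A x).
  exact/cvg_measure_box/measurable_xsection.
apply: (emeasurable_fun_cvg (fun n x => l x (xsection A x `&` box n))) => // n.
pose mk := isKernel.Build _ _ X R2 R l ml.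
pose k : R.-ker X ~> R2 := HB.pack l mk.
have := @measurable_prod_subset_xsection_kernel _ _ X R2 R k (box n) (measurable_box n) _ A mA.
case=> [x|_]; last by [].
have [M lM] : exists M : R, (l x (box n) < M%:E)%E.
  have := fl x n; have := measure_ge0 (l x) (box n).
  case: (l x (box n)) => [r _ _|//|_ _]; [exists (r + 1); rewrite lte_fin; lra|exists 0; exact: ltNyr].
exists M => B mB; apply: le_lt_trans lM.
have mb := @measurable_box n.
by rewrite /mrestr le_measure ?inE//; exact: measurableI.
Qed.

Lemma measurable_integral_locfin (f : X * R2 -> \bar R) :
  measurable_fun setT f -> (forall z, 0 <= f z)%E ->
  measurable_fun setT (fun x => \int[l x]_y f (x, y))%E.
Proof.
move=> mf f0; pose k_ := nnsfun_approx measurableT mf.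
apply: (measurable_fun_xsection_integral f l k_).
- by move=> a b ab; exact/nd_nnsfun_approx.
- by move=> z; exact/cvg_nnsfun_approx.
- by move=> n r; apply: measurable_xsection_locfin; exact: measurable_sfunP.
Qed.

End kernels.
End box.

(** * Poisson random measures *)

Section poisson.
Context {R : realType}.
Implicit Type m : R.

Lemma pois_ge0 m k : 0 <= m -> 0 <= pois m k.
Proof. by move=> m0; rewrite /pois mulr_ge0 ?expR_ge0// mulr_ge0 ?exprn_ge0. Qed.

Lemma nneseries_pois m : 0 <= m -> (\sum_(0 <= k <oo) (pois m k)%:E = 1)%E.
Proof.
move=> m0; rewrite [RHS](_ : _ = (expR (- m))%:E * (expR m)%:E)%E; last first.
  by rewrite -EFinM expRN mulVf ?gt_eqF ?expR_gt0.
under eq_eseriesr do rewrite /pois EFinM muleC.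
rewrite nneseriesZl/=; last first.
  by move=> n _; rewrite lee_fin divr_ge0// exprn_ge0// ltW.
congr *%E; rewrite expRE -EFin_lim; last first.
  rewrite /pseries/=; under eq_fun do rewrite mulrC.
  exact: is_cvg_series_exp_coeff.
apply/congr_lim/funext => n/=; rewrite /pseries/= /series/= -sumEFin//.
by under eq_bigr do rewrite mulrC.
Qed.

Lemma nneseries_pois_mean m : 0 <= m ->
  (\sum_(0 <= k <oo) k%:R%:E * (pois m k)%:E = m%:E)%E.
Proof.
move=> m0; have p0 k : (0 <= k%:R%:E * (pois m k)%:E)%E by rewrite -EFinM lee_fin mulr_ge0// pois_ge0.
rewrite nneseries_recl// mul0e add0e -(nneseries_addn 1%N p0).
under eq_eseriesr => k _.
  rewrite addn1 (_ : _ * _ = m%:E * (pois m k)%:E)%E; last first.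
    rewrite -!EFinM; congr _%:E; rewrite /pois factS exprS natrM invfM.
    by rewrite -!mulrA mulrCA; congr (_ * _); rewrite mulrCA mulVKf// pnatr_eq0.
  over.
by rewrite nneseriesZl ?nneseries_pois ?mule1// => k _; rewrite lee_fin pois_ge0.
Qed.

(** From [expR (- m) >= 1 - m]. The bound is quadratic in [m], so the probability that one of many
    thin strips contains two points tends to zero with their width. *)
Lemma pois_tail2 m : 0 <= m -> 1 - pois m 0 - pois m 1 <= m ^+ 2.
Proof.
move=> m0; rewrite /pois !fact0 expr0 expr1 factS fact0 muln1 !divr1 mul1r.
have := expR_ge1Dx (- m); have := expR_ge0 (- m).
set e := expR _ => e0 e1.
have : (1 - m) * (1 + m) <= e * (1 + m) by apply: ler_wpM2r => //; lra.
rewrite expr2; lra.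
Qed.
End poisson.

(** * The intensity measure and its iterated integrals *)

Section intensity.
Context {R : realType}.
Notation R2 := (R * R)%type.

Lemma measurable_quadrant : measurable (@quadrant R).
Proof. by apply: measurableX => //; exact: measurable_itv. Qed.

(** The values are those of [leb]; only the type of the space changes, to the measurable space [R]
    from which the product [R * R] is formed. *)
Definition mes1 : set R -> \bar R := @leb R.
HB.instance Definition _ := isMeasure.Build _ R R mes1
  (measure0 (@leb R)) (measure_ge0 (@leb R)) (@measure_semi_sigma_additive _ _ _ (@leb R)).

Lemma sigma_finite_mes1 : sigma_finite setT mes1.
Proof. exact: sigma_finiteT (@lebesgue_measure R). Qed.
HB.instance Definition _ := Measure_isSigmaFinite.Build _ R R mes1 sigma_finite_mes1.

Lemma integral_mes1 (D : set R) (f : R -> \bar R) : measurable D ->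
  measurable_fun D f -> (forall x, D x -> 0 <= f x)%E ->
  (\int[leb]_(x in D) f x = \int[mes1]_(x in D) f x)%E.
Proof.
move=> mD mf f0.
have mid : measurable_fun [set: R] (@id R : R -> measurableTypeR R) by exact: measurable_id.
have := @ge0_integral_pushforward _ _ _ _ R _ mid mes1 D f mD mf.
rewrite /= preimage_id => <-; last by move=> x; rewrite inE; exact: f0.
exact: eq_measure_integral.
Qed.

Let nu' := mrestr (@leb2 R) (measurable_quadrant : @measurable _ (measurableTypeR R * measurableTypeR R)%type _).

HB.instance Definition _ := isMeasure.Build _ R2 R (@prm_intensity R)
  (measure0 nu') (measure_ge0 nu') (@measure_semi_sigma_additive _ _ _ nu').

Definition nu : {measure set R2 -> \bar R} := @prm_intensity R.

Lemma leb2X (A B : set R) : measurable A -> measurable B ->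
  leb2 (A `*` B) = (leb A * leb B)%E.
Proof. by move=> mA mB; rewrite /leb2 product_measure1E. Qed.

Lemma nu_le (A : set R2) : measurable A -> (nu A <= leb2 A)%E.
Proof.
move=> mA; apply: (@le_measure _ _ _ leb2); rewrite ?inE//.
exact: measurableI mA measurable_quadrant.
Qed.

Lemma locfin_nu : locfin nu.
Proof.
move=> n; apply: le_lt_trans (nu_le (measurable_box n)) _.
rewrite /box leb2X// /leb !lebesgue_measure_itv/=.
by case: ifPn => _; rewrite ?mule0 ?ltry// -!EFinB -EFinM ltry.
Qed.

End intensity.
Arguments nu {R}.
Arguments mes1 {R}.

Lemma integral_mrestr d (T : measurableType d) (R : realType)
   (m m' : {measure set T -> \bar R}) (D : set T) (f : T -> \bar R) : measurable D ->
  (forall A, measurable A -> m' A = m (A `&` D)) ->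
  measurable_fun setT f -> (forall p, 0 <= f p)%E ->
  (\int[m']_x f x = \int[m]_(x in D) f x)%E.
Proof.
move=> mD mm' mf f0.
have mC : measurable (~` D) by exact: measurableC.
have -> : (\int[m']_x f x = \int[m']_(x in D `|` ~` D) f x)%E by rewrite setUv.
rewrite ge0_integral_setU//; last 2 first.
- by rewrite setUv.
- by apply/disj_setPS; rewrite setICr.
rewrite [X in (_ + X)%E](_ : _ = 0)%E ?adde0; last first.
  rewrite (eq_measure_integral mzero) ?integral_measure_zero// => A mA AD.
  by rewrite mm'// (_ : A `&` D = set0) ?measure0//; apply/disjoints_subset.
apply: eq_measure_integral => A mA AD; rewrite mm'//.
by congr (m _); apply/setIidPl.
Qed.

Section integral_nu.
Context {R : realType}.
Notation R2 := (R * R)%type.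

Lemma nuE (A : set R2) : measurable A -> nu A = (mes1 \x mes1)%E (A `&` quadrant).
Proof.
move=> mA; have mAq := measurableI _ _ mA (@measurable_quadrant R).
transitivity (\int[leb]_x (mes1 \o xsection (A `&` quadrant)) x)%E; first by [].
rewrite integral_mes1//.
exact: (@measurable_fun_xsection _ _ R R R mes1).
Qed.

Lemma integral_nu (f : R2 -> \bar R) : measurable_fun setT f -> (forall p, 0 <= f p)%E ->
  (\int[nu]_p f p =
   \int[mes1]_(s in `[0%R, +oo[) \int[mes1]_(x in `[0%R, +oo[) f (s, x))%E.
Proof.
move=> mf f0.
have mq := @measurable_quadrant R.
rewrite (integral_mrestr mq nuE)//.
rewrite integral_mkcond fubini_tonelli1//; last 2 first.
- by apply/(measurable_restrictT f mq); exact: measurable_funTS.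
- by move=> x; rewrite patchE; case: ifPn.
rewrite [RHS]integral_mkcond; apply: eq_integral => s _; rewrite patchE.
rewrite /fubini_F; case: ifPn => s0; rewrite ?inE in s0.
  rewrite [RHS]integral_mkcond; apply: eq_integral => x _; rewrite !patchE.
  by congr (if _ then _ else _); apply/idP/idP; rewrite !inE /quadrant/=; tauto.
apply: integral0_eq => x _; rewrite patchE ifF//; apply/negP; rewrite inE => -[/=].
by move: s0; rewrite notin_setE.
Qed.
End integral_nu.

Section prm.
Context {R : realType} d (Omega : measurableType d) (P : probability Omega R).
Notation R2 := (R * R)%type.
Variable N : Omega -> {measure set R2 -> \bar R}.
Hypothesis PN : is_PRM P N.

Lemma prm_measurable A : measurable A -> measurable_fun setT (fun w => N w A).
Proof. by move=> mA; exact: PN.1. Qed.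

Lemma measurable_count A (x : \bar R) : measurable A -> measurable [set w | N w A = x].
Proof.
move=> mA; rewrite -[X in measurable X]setTI.
exact: (prm_measurable mA measurableT (emeasurable_set1 x)).
Qed.

Lemma prm_pois A k : measurable A -> (nu A < +oo)%E ->
  P [set w | N w A = k%:R%:E] = (pois (fine (nu A)) k)%:E.
Proof.
move=> mA Afin.
have := PN.2 1%N (fun=> A) (fun=> k) (fun=> mA) (fun=> Afin).
rewrite big_ord_recl big_ord0 mulr1 => <-; last by move=> i j; rewrite !ord1.
by congr (P _); apply/seteqP; split => [w /= h i _|w /= /(_ ord0)]; [exact: h|exact].
Qed.

Lemma prm_natural A : measurable A -> (nu A < +oo)%E ->
  P (~` \bigcup_k [set w | N w A = k%:R%:E]) = 0%E.
Proof.
move=> mA Afin.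
have mk k : measurable [set w | N w A = k%:R%:E] by exact: measurable_count.
rewrite probability_setC; last exact: bigcup_measurable.
rewrite measure_bigcup//=; last first.
  move=> i j _ _ [w /= [-> []]] /eqP; rewrite eqr_nat => /eqP//.
under eq_eseriesr do rewrite prm_pois//.
rewrite -[X in (1 - X)%E](_ : 1 = _)%E ?subee//.
by rewrite -[LHS](nneseries_pois (fine_ge0 (measure_ge0 nu A))); apply: eq_eseriesl => k; rewrite in_setT.
Qed.

Definition cell (n : nat) (i j : int) : set R2 :=
  `[i%:~R / n.+1%:R, (i + 1)%:~R / n.+1%:R[%classic `*` `[j%:~R / n.+1%:R, (j + 1)%:~R / n.+1%:R[%classic.

Lemma measurable_cell n i j : measurable (cell n i j).
Proof. by apply: measurableX => //; exact: measurable_itv. Qed.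

Lemma cell_lty n i j : (nu (cell n i j) < +oo)%E.
Proof.
apply: le_lt_trans (nu_le (measurable_cell n i j)) _.
rewrite /cell leb2X// /leb !lebesgue_measure_itv/=.
by case: ifPn => _; case: ifPn => _; rewrite ?mule0 ?mul0e ?ltry// -?EFinB -?EFinM ltry.
Qed.

Lemma in_cell n (p : R2) : cell n (Num.floor (p.1 * n.+1%:R)) (Num.floor (p.2 * n.+1%:R)) p.
Proof.
have h (x : R) : (Num.floor (x * n.+1%:R))%:~R / n.+1%:R <= x <
    (Num.floor (x * n.+1%:R) + 1)%:~R / n.+1%:R.
  rewrite ler_pdivrMr// ltr_pdivlMr// floor_le_tmp.
  exact: floorD1_gt.
by split; rewrite /= in_itv /=; exact: h.
Qed.

(** A Poisson count is almost surely a natural number, one set at a time. Boxes and cells are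
    countable in number, so one null set serves for all of them. *)
Lemma prm_good : exists G : set Omega, [/\ measurable G, P (~` G) = 0%E &
  forall w, G w -> locfin (N w) /\
    forall n i j, N w (cell n i j) = 0%E \/ (1 <= N w (cell n i j))%E].
Proof.
pose F (m : nat) : set R2 := if @choice.unpickle (nat + nat * int * int)%type m is Some x then
  match x with inl n => box n | inr y => cell y.1.1 y.1.2 y.2 end else set0.
have mF m : measurable (F m).
  rewrite /F; case: choice.unpickle => [[n|y]|]; last exact: measurable0.
    exact: measurable_box.
  exact: measurable_cell.
have finF m : (nu (F m) < +oo)%E.
  rewrite /F; case: choice.unpickle => [[n|y]|]; last by rewrite measure0.
    exact: locfin_nu.
  exact: cell_lty.
pose B m := ~` \bigcup_k [set w | N w (F m) = k%:R%:E].
have mB m : measurable (B m).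
  by apply: measurableC; apply: bigcup_measurable => k _; exact: measurable_count.
exists (~` \bigcup_m B m); split.
- by apply: measurableC; exact: bigcup_measurable.
- rewrite setCK; apply/eqP; rewrite eq_le measure_ge0 andbT.
  apply: le_trans (measure_sigma_subadditive P mB (bigcup_measurable (fun k _ => mB k)) (@subset_refl _ _)) _.
  by rewrite eseries0// => k _ _; exact: prm_natural.
move=> w Gw.
have Fnat m : exists k : nat, N w (F m) = k%:R%:E.
  apply: contrapT => h; apply: Gw; exists m => // -[k _ /= hk]; apply: h; by exists k.
split=> [n|n i j].
  have := Fnat (choice.pickle (inl n : nat + nat * int * int)%type).
  by rewrite /F choice.pickleK => -[k ->]; rewrite ltry.
have := Fnat (choice.pickle (inr (n, i, j) : nat + nat * int * int)%type).
rewrite /F choice.pickleK/= => -[[|k] ->]; [by left|right].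
by rewrite lee_fin ler1n.
Qed.

End prm.
Arguments cell {R}.

(** * A version with good paths everywhere *)

Section good_version.
Context {R : realType} d (Omega : measurableType d) (P : probability Omega R).
Notation R2 := (R * R)%type.

(* The condition on the cells leaves atoms of mass at least 1 only; it involves
   countably many events, so it can be imposed on the whole of [Omega]. *)
Definition simple_prm (N : Omega -> {measure set R2 -> \bar R}) :=
  [/\ is_PRM P N, forall w, locfin (N w) &
    forall w n i j, N w (cell n i j) = 0%E \/ (1 <= N w (cell n i j))%E].

Lemma measure_setI_full (G A B : set Omega) : measurable G -> P (~` G) = 0%E ->
  measurable A -> measurable B -> A `&` G = B `&` G -> P A = P B.
Proof.
move=> mG PG mA mB AB.
have h C : measurable C -> P C = P (C `&` G).
  move=> mC; rewrite {1}(_ : C = (C `&` G) `|` (C `&` ~` G)); last by rewrite -setIUr setUv setIT.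
  rewrite measureU0//; [exact: measurableI|exact: measurableI (measurableC mG)|].
  apply: (@subset_measure0 _ _ _ P _ (~` G)) => //; [exact: measurableI (measurableC mG)|exact: measurableC].
by rewrite (h A)// AB -h.
Qed.

(** Off the good set the zero measure is used, which satisfies the conditions on boxes and cells;
    the laws in [is_PRM] do not see a null set. *)
Lemma exists_simple_prm (N : Omega -> {measure set R2 -> \bar R}) : is_PRM P N ->
  exists2 N' : Omega -> {measure set R2 -> \bar R}, simple_prm N' &
    {ae P, forall w, N' w = N w}.
Proof.
move=> PN; have [G [mG PG hG]] := prm_good PN.
pose N' w : {measure set R2 -> \bar R} := if w \in G then N w else mzero.
have mN' A : measurable A -> measurable_fun setT (fun w => N' w A).
  move=> mA; rewrite (_ : (fun w => _) = (fun w => N w A) \_ G).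
    by apply/(measurable_restrictT _ mG)/measurable_funTS; exact: (prm_measurable PN).
  by apply/funext => w; rewrite /N' patchE; case: ifP.
exists N'; last first.
  exists (~` G); split => //; first exact: measurableC.
  by move=> w /= Nw Gw; apply: Nw; rewrite /N' mem_set.
split.
- split => // n A k mA finA trivA; rewrite -(PN.2 n A k mA finA trivA).
  apply: (measure_setI_full mG PG).
  + apply: fin_bigcap_measurable => // i _.
    rewrite -[X in measurable X]setTI.
    exact: (mN' _ (mA i) measurableT _ (emeasurable_set1 _)).
  + apply: fin_bigcap_measurable => // i _; exact: (measurable_count PN).
  + apply/seteqP; split=> w [/= h Gw]; split => // i _; have := h i Logic.I; rewrite /= /N' mem_set//.
- by move=> w; rewrite /N'; case: ifPn => [/set_mem/hG[]//|_ n]; exact: ltry.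
- move=> w n i j; rewrite /N'; case: ifPn => [|_]; last by left.
  by rewrite inE => /hG[].
Qed.
End good_version.

(** * Independence of the past *)

Section past.
Context {R : realType} d (Omega : measurableType d) (P : probability Omega R).
Notation R2 := (R * R)%type.
Variable N : Omega -> {measure set R2 -> \bar R}.
Hypothesis SN : simple_prm P N.
Let PN : is_PRM P N. Proof. by case: SN. Qed.

Definition past_set (a : R) (A : set R2) :=
  [/\ measurable A, exists n, A `<=` box n & A `<=` [set p | p.1 <= a]].

Lemma past_setI a A B : past_set a A -> measurable B -> past_set a (A `&` B).
Proof.
move=> [mA [n An] Aa] mB; split; first exact: measurableI.
  by exists n => x [/An].
by move=> x [/Aa].
Qed.

Lemma past_setD a A B : past_set a A -> measurable B -> past_set a (A `\` B).
Proof. by move=> pA mB; rewrite setDE; apply: past_setI => //; exact: measurableC. Qed.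

Lemma past_set_lty a A : past_set a A -> (nu A < +oo)%E.
Proof.
move=> [mA [n An] _]; apply: le_lt_trans (locfin_nu n).
by apply: le_measure; rewrite ?inE//; exact: measurable_box.
Qed.

Fixpoint past_seq a (s : seq (set R2)) :=
  if s is A :: s' then past_set a A /\ past_seq a s' else True.

Fixpoint cover_seq (s : seq (set R2)) : set R2 :=
  if s is A :: s' then A `|` cover_seq s' else set0.

Fixpoint disjoint_seq (s : seq (set R2)) :=
  if s is A :: s' then A `&` cover_seq s' = set0 /\ disjoint_seq s' else True.

Lemma past_cover_seq a s : past_seq a s -> past_set a (cover_seq s).
Proof.
elim: s => [_|A s ih [[mA [n An] Aa] /ih[ms [m sm] sa]]] /=.
  by split; [exact: measurable0|exists 0%N|].
split; first exact: measurableU.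
  exists (maxn n m) => x [/An|/sm]; apply: subset_box; [exact: leq_maxl|exact: leq_maxr].
by move=> x [/Aa|/sa].
Qed.

Definition vals w (s : seq (set R2)) : seq (\bar R) := [seq N w A | A <- s].

(* [split_seq A] cuts every member of the list along [A]; [merge_vals] recovers
   the values of a measure on the original list. *)
Fixpoint split_seq (A : set R2) (s : seq (set R2)) : seq (set R2) :=
  if s is B :: s' then B `&` A :: B `\` A :: split_seq A s' else [::].

Fixpoint merge_vals (n : nat) (l : seq (\bar R)) : seq (\bar R) :=
  if n is n'.+1 then if l is x :: y :: l' then (x + y)%E :: merge_vals n' l' else [::] else [::].

Fixpoint sum_even (n : nat) (l : seq (\bar R)) : \bar R :=
  (if n is n'.+1 then if l is x :: y :: l' then x + sum_even n' l' else 0 else 0)%E.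

Lemma past_split_seq a A s : measurable A -> past_seq a s -> past_seq a (split_seq A s).
Proof.
move=> mA; elim: s => //= B s ih [pB ps].
by split; [exact: past_setI|split; [exact: past_setD|exact: ih]].
Qed.

Lemma cover_split_seq A s : cover_seq (split_seq A s) = cover_seq s.
Proof. by elim: s => //= B s ->; rewrite setUA setUIDK. Qed.

Lemma disjoint_split_seq A s : disjoint_seq s -> disjoint_seq (split_seq A s).
Proof.
elim: s => //= B s ih [Bs ds]; rewrite cover_split_seq; split; last split; last exact: ih.
  rewrite setIUr (_ : _ `&` (B `\` A) = set0) ?set0U.
    by rewrite setIAC Bs set0I.
  by rewrite setDE setIACA setICr setI0.
by rewrite setDE setIAC Bs set0I.
Qed.

Lemma merge_vals_split w a A s : past_seq a s -> measurable A ->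
  merge_vals (size s) (vals w (split_seq A s)) = vals w s.
Proof.
move=> + mA; elim: s => //= B s ih [[mB _ _] ps]; rewrite ih// -measureU ?setUIDK//.
- exact: measurableI.
- exact: measurableD.
- by rewrite setDE setIACA setICr setI0.
Qed.

Lemma sum_even_split w a A s : past_seq a s -> disjoint_seq s -> measurable A ->
  N w (cover_seq s `&` A) = sum_even (size s) (vals w (split_seq A s)).
Proof.
move=> + + mA; elim: s => [|B s ih] /=; first by rewrite set0I measure0.
move=> [[mB _ _] ps] [Bs ds]; rewrite -ih// setIUl measureU//.
- exact: measurableI.
- by apply: measurableI => //; have [] := past_cover_seq ps.
- by rewrite setIACA Bs set0I.
Qed.

(** Joint laws are available for disjoint sets only. A new set [A] adds the piece of it outside the
    previous cover and cuts the previous pieces in two; additivity recovers the original counts. *)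
Lemma disjoint_refinement a s : past_seq a s ->
  exists s' g, [/\ past_seq a s', disjoint_seq s' & forall w, vals w s = g (vals w s')].
Proof.
elim: s => [_|A s ih [pA /ih[s' [g [ps' ds' gs']]]]]; first by exists [::], id.
have mA : measurable A by case: pA.
have ms' : measurable (cover_seq s') by case: (past_cover_seq ps').
exists (A `\` cover_seq s' :: split_seq A s').
exists (fun l => if l is x :: l' then (x + sum_even (size s') l')%E :: g (merge_vals (size s') l') else [::]).
split => [||w] /=.
- by split; [exact: past_setD|exact: past_split_seq].
- by rewrite cover_split_seq setDE -setIA setICl setI0; split => //; exact: disjoint_split_seq.
- rewrite (merge_vals_split _ ps' mA) -gs' -(sum_even_split _ ps' ds' mA) -measureU ?[_ `&` A]setIC 1?setUC ?setUIDK//.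
  + exact: measurableD.
  + exact: measurableI.
  + by rewrite setDE setIACA setICl setI0.
Qed.

Fixpoint natr_seq (l : seq nat) : seq (\bar R) := if l is k :: l' then k%:R%:E :: natr_seq l' else [::].

Lemma natr_seq_inj : injective natr_seq.
Proof.
elim=> [|x l ih] [|y l']//= [] /eqP; rewrite eqr_nat => /eqP -> h; congr cons; exact: ih.
Qed.

Lemma disjoint_seq_nth s i j : disjoint_seq s -> (i < j)%N ->
  nth set0 s i `&` nth set0 s j = set0.
Proof.
elim: s i j => [|A s ih] [|i] [|j]//=; rewrite ?nth_nil ?set0I//; last by move=> [_ ds] ij; exact: ih.
move=> [As _] _; apply: subsetI_eq0 As => //.
elim: s j {ih} => [|B s ih] [|j] //=.
exact: subset_trans (ih j) (@subsetUr _ _ _).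
Qed.

Definition fin_seq (s : seq (set R2)) :=
  forall i, (i < size s)%N -> measurable (nth set0 s i) /\ (nu (nth set0 s i) < +oo)%E.

Lemma past_fin_seq a s : past_seq a s -> fin_seq s.
Proof.
elim: s => //= A s ih [pA ps] [|i]//= si; last exact: ih.
by split; [case: pA|exact: past_set_lty pA].
Qed.

Lemma vals_natr w s l : size l = size s ->
  vals w s = natr_seq l <-> forall i, (i < size s)%N -> N w (nth set0 s i) = (nth 0%N l i)%:R%:E.
Proof.
elim: s l => [|A s ih] [|k l]//= [sl]; split.
  by case=> h1 h [|i]//= si; apply: (ih l sl).1.
by move=> h; rewrite (h 0%N isT : N w A = _); congr cons; apply/(ih l sl) => i si; exact: (h i.+1).
Qed.

Lemma measurable_vals s l : fin_seq s -> measurable [set w | vals w s = natr_seq l].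
Proof.
elim: s l => [|A s ih] [|k l] fs.
- by rewrite (_ : [set _ | _] = setT)//; apply/seteqP; split.
- by rewrite (_ : [set _ | _] = set0)//; apply/seteqP; split.
- by rewrite (_ : [set _ | _] = set0)//; apply/seteqP; split.
rewrite (_ : [set _ | _] = [set w | N w A = k%:R%:E] `&` [set w | vals w s = natr_seq l]).
  apply: measurableI; last by apply: ih => i; exact: (fs i.+1).
  by apply: (measurable_count PN); have [] := fs 0%N isT.
by apply/seteqP; split => w /= [-> ->].
Qed.

Lemma prm_vals s l : size l = size s -> fin_seq s -> disjoint_seq s ->
  P [set w | vals w s = natr_seq l] = (\prod_(i < size s) pois (fine (nu (nth set0 s i))) (nth 0%N l i))%:E.
Proof.
move=> sl fs ds.
rewrite -(PN.2 (size s) (fun i => nth set0 s i) (fun i => nth 0%N l i)).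
- congr (P _); apply/seteqP; split => w /=.
    by move=> /(vals_natr _ sl) h i _; exact: h.
  by move=> h; apply/(vals_natr _ sl) => i si; exact: (h (Ordinal si) Logic.I).
- by move=> i; have [] := fs i (ltn_ord i).
- by move=> i; have [] := fs i (ltn_ord i).
- move=> i j; rewrite neq_ltn => /orP[]; first exact: disjoint_seq_nth.
  by move=> ?; rewrite setIC; exact: disjoint_seq_nth.
Qed.

Lemma natural_vals s : fin_seq s -> P.-negligible [set w | ~ exists l, vals w s = natr_seq l].
Proof.
elim: s => [|A s ih] fs.
  apply: (negligibleS (A := set0)); last exact: negligible_set0.
  by move=> w /= []; exists [::].
have [mA fA] := fs 0%N isT.
apply: (negligibleS (A := (~` \bigcup_k [set w | N w A = k%:R%:E]) `|` [set w | ~ exists l, vals w s = natr_seq l])).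
  move=> w /= h; apply: contrapT => /not_orP[/contrapT[k _ /= hk] /contrapT[l hl]].
  by apply: h; exists (k :: l); rewrite /= hk hl.
apply: negligibleU; last by apply: ih => i; exact: (fs i.+1).
apply/negligibleP; last exact: (prm_natural PN).
by apply: measurableC; apply: bigcup_measurable => k _; exact: (measurable_count PN).
Qed.

(* [S] is an arbitrary set of values: measurability is required of [B] itself. *)
Definition past_event (a : R) (B : set Omega) := measurable B /\
  exists s S, past_seq a s /\ B = [set w | S (vals w s)].

(** After refinement to disjoint pieces, the counts are natural numbers off a null set, so [B] is
    there a countable disjoint union of events that prescribe all of them. For each of these the
    product law of the list [D :: s] factorises. *)
Lemma past_event_indep a B D k : past_event a B -> measurable D -> (nu D < +oo)%E ->
  D `<=` [set p | a < p.1] ->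
  P (B `&` [set w | N w D = k%:R%:E]) = (P B * P [set w | N w D = k%:R%:E])%E.
Proof.
move=> [mB [s0 [S0 [ps0 BE]]]] mD fD Da.
have [s [g [ps ds gs]]] := disjoint_refinement ps0.
pose S := [set l | S0 (g l)].
have {}BE : B = [set w | S (vals w s)].
  by rewrite BE; apply/seteqP; split => w /=; rewrite /S /= gs.
have fs := past_fin_seq ps.
have [ms _ sa] := past_cover_seq ps.
set C := [set w | N w D = _].
have mC : measurable C by exact: (measurable_count PN).
(* With [pickle_inv] each list of naturals has a single code, which makes the events [E m]
   disjoint. *)
pose E m := if @pickle_inv (seq nat) m is Some l then
  (if `[< size l = size s /\ S (natr_seq l) >] then [set w | vals w s = natr_seq l] else set0) else set0.
have mE m : measurable (E m).
  rewrite /E; case: pickle_inv => [l|]; last exact: measurable0.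
  by case: ifPn => _; [exact: measurable_vals|exact: measurable0].
have tE : trivIset setT E.
  move=> i j _ _ [w []]; rewrite /E.
  have := @pickle_invK (seq nat) i; case: pickle_inv => [l /= <-|//]; case: ifPn => // _ /= wl.
  have := @pickle_invK (seq nat) j; case: pickle_inv => [l' /= <-|//]; case: ifPn => // _ /=.
  by rewrite wl => /natr_seq_inj ->.
have PE m : P (E m `&` C) = (P (E m) * P C)%E.
  rewrite /E; case: pickle_inv => [l|]; last by rewrite set0I measure0 mul0e.
  case: ifPn => [/asboolP[sl _]|_]; last by rewrite set0I measure0 mul0e.
  have fDs : fin_seq (D :: s) by move=> [|i]//= si; exact: fs.
  have dDs : disjoint_seq (D :: s).
    by split => //; apply/seteqP; split => // p [/Da /= + /sa /=]; rewrite ltNge => /negP.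
  have := @prm_vals (D :: s) (k :: l) (congr1 succn sl) fDs dDs.
  rewrite big_ord_recl/= EFinM -(prm_vals sl fs ds) -(prm_pois PN k mD fD) muleC => <-.
  by congr (P _); apply/seteqP; split => w /=; [case=> -> hC; congr cons; exact: hC|case=> ? ?; split].
have [Z [mZ PZ hZ]] := natural_vals fs.
have BZ : B `&` ~` Z = \bigcup_m E m `&` ~` Z.
  apply/seteqP; split => [w [Bw Zw]|w [[m _ Ew] Zw]]; split => //.
    have [l hl] : exists l, vals w s = natr_seq l by apply: contrapT => /hZ.
    exists (choice.pickle l) => //; rewrite /E pickleK_inv ifT//.
    apply/asboolP; split; last by move: Bw; rewrite BE /= hl.
    by have := congr1 size hl; rewrite size_map => ->; elim: (l) => //= ? ? ->.
  move: Ew; rewrite /E; case: pickle_inv => [l|//]; case: ifPn => // /asboolP[_ Sl] /= wl.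
  by rewrite BE /= wl.
have PZ' : P (~` ~` Z) = 0%E by rewrite setCK.
have mEC m : measurable (E m `&` C) by exact: measurableI.
have mUE : measurable (\bigcup_m E m) by exact: bigcup_measurable.
rewrite (@measure_setI_full _ _ _ P (~` Z) _ (\bigcup_m E m `&` C))//; last 4 first.
- exact: measurableC.
- exact: measurableI.
- exact: measurableI.
- by rewrite setIAC BZ setIAC.
rewrite (@measure_setI_full _ _ _ P (~` Z) B (\bigcup_m E m))//; last exact: measurableC.
rewrite setI_bigcupl !measure_bigcup//; last first.
  by move=> i j _ _ [w [[wi _] [wj _]]]; apply: tE => //; exists w.
transitivity (\sum_(0 <= m <oo | m \in [set: nat]) (P C * P (E m)))%E.
  by apply: eq_eseriesr => m _; exact: etrans (PE m) (muleC _ _).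
by rewrite muleC -(fineK (fin_num_measure P _ mC)) nneseriesZl.
Qed.

Lemma past_event_mean a B D : past_event a B -> measurable D -> (nu D < +oo)%E ->
  D `<=` [set p | a < p.1] ->
  (\int[P]_(w in B) N w D = P B * nu D)%E.
Proof.
move=> pB mD fD Da; have [mB _] := pB.
have mk k : measurable [set w | N w D = k%:R%:E] by exact: (measurable_count PN).
have mND := prm_measurable PN mD.
pose U := \bigcup_k [set w | N w D = k%:R%:E].
have mU : measurable U by exact: bigcup_measurable.
rewrite (ge0_negligible_integral (measurableC mU))//; last 2 first.
- exact: measurable_funTS.
- exact: (prm_natural PN).
rewrite setDE setCK /U setI_bigcupr ge0_integral_bigcup//; last 3 first.
- by move=> k; exact: measurableI.
- exact: measurable_funTS.
- by move=> i j _ _ [w [[_ /= ->] [_ /= [/eqP]]]]; rewrite eqr_nat => /eqP.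
have PI k : (\int[P]_(w in B `&` [set w | N w D = k%:R%:E]) N w D =
    P B * (k%:R%:E * (pois (fine (nu D)) k)%:E))%E.
  rewrite (eq_integral (cst k%:R%:E)) => [|w /set_mem[_ /= ->//]].
  rewrite integral_cst; last exact: measurableI.
  transitivity (k%:R%:E * (P B * P [set w | N w D = k%:R%:E]))%E.
    by congr (_ * _)%E; exact: past_event_indep pB mD fD Da.
  by rewrite (prm_pois PN)// muleCA.
under eq_eseriesr do rewrite PI.
rewrite -(fineK (fin_num_measure P _ mB)) nneseriesZl; last first.
  by move=> k _; rewrite -EFinM lee_fin mulr_ge0// pois_ge0// fine_ge0.
congr (_ * _)%E; rewrite nneseries_pois_mean ?fine_ge0//.
by rewrite fineK// ge0_fin_numE.
Qed.
End past.

(** * Predictable processes and compensation *)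

Section predictable.
Context {R : realType} d (Omega : measurableType d) (P : probability Omega R).
Notation R2 := (R * R)%type.
Variable N : Omega -> {measure set R2 -> \bar R}.
Hypothesis SN : simple_prm P N.
Let PN : is_PRM P N. Proof. by case: SN. Qed.
Let fN w : locfin (N w). Proof. by case: SN. Qed.

(** The strict inequality makes the count on [D] independent of [B], and the box keeps its mean
    finite. These rectangles are stable under intersection. *)
Definition predictable_rect : set (set (Omega * R2)) :=
  [set X | exists a B D, [/\ past_event N a B, measurable D, exists n, D `<=` box n,
     D `<=` [set p | a < p.1] & X = B `*` D]].

Definition PT := g_sigma_algebraType predictable_rect.

Lemma past_event_le a b B : a <= b -> past_event N a B -> past_event N b B.
Proof.
move=> ab [mB [s [S [ps BE]]]]; split => //; exists s, S; split => // {BE}.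
elim: s ps => //= A s ih [[mA nA Aa] ps]; split; last exact: ih.
by split => // p /Aa /= h; exact: le_trans ab.
Qed.

Lemma past_eventI a B C : past_event N a B -> past_event N a C -> past_event N a (B `&` C).
Proof.
move=> [mB [s [S [ps BE]]]] [mC [s' [S' [ps' CE]]]]; split; first exact: measurableI.
exists (s ++ s'), [set l | S (take (size s) l) /\ S' (drop (size s) l)]; split.
  by elim: s ps {BE} => //= A s ih [pA /ih].
rewrite BE CE; apply/seteqP; split => w /=; rewrite /vals map_cat.
  by rewrite take_size_cat ?drop_size_cat ?size_map.
by rewrite take_size_cat ?drop_size_cat ?size_map.
Qed.

Lemma past_eventT a : past_event N a setT.
Proof. by split; [exact: measurableT|exists [::], setT; split => //; apply/seteqP]. Qed.

Lemma past_event_count a A V : past_set a A -> measurable V -> past_event N a [set w | V (N w A)].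
Proof.
move=> pA mV; have [mA _ _] := pA; split.
  by rewrite -[X in measurable X]setTI; exact: (prm_measurable PN mA measurableT mV).
by exists [:: A], [set l | V (head 0%E l)]; split.
Qed.

Lemma setI_closed_predictable_rect : setI_closed predictable_rect.
Proof.
move=> _ _ [a [B [D [pB mD [n Dn] Da ->]]]] [a' [B' [D' [pB' mD' _ Da' ->]]]].
exists (Num.max a a'), (B `&` B'), (D `&` D'); split.
- by apply: past_eventI; [apply: past_event_le pB|apply: past_event_le pB']; rewrite le_max lexx ?orbT.
- exact: measurableI.
- by exists n => x [/Dn].
- by move=> p [/Da /= ? /Da' /= ?]; rewrite /= gt_max; apply/andP.
- by rewrite setXI.
Qed.

Definition PT_box (n : nat) : set (Omega * R2) := setT `*` box n.

Lemma predictable_rect_box n : predictable_rect (PT_box n).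
Proof.
(* Any time before the box would do, the whole space being a past event of every time. *)
exists (- n%:R - 1), setT, (box n); split => //; first exact: past_eventT.
- exact: measurable_box.
- by exists n.
- by move=> [x y]; rewrite /box/= !in_itv/= => -[/andP[? _] _]; lra.
Qed.

Lemma bigcup_PT_box : \bigcup_n PT_box n = setT.
Proof.
apply/seteqP; split => // -[w p] _.
by have : setT p by []; rewrite -bigcup_box => -[n _ pn]; exists n.
Qed.

Lemma measurable_PT_rect (a : R) B (D : set R2) : past_event N a B -> measurable D ->
  D `<=` [set p | a < p.1] -> measurable (B `*` D : set PT).
Proof.
move=> pB mD Da.
rewrite (_ : B `*` D = \bigcup_n (B `*` (D `&` box n))).
  apply: bigcup_measurable => n _; apply: sub_sigma_algebra.
  exists a, B, (D `&` box n); split => //.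
  - by apply: measurableI => //; exact: measurable_box.
  - by exists n => p [].
  - by move=> p [/Da].
by rewrite -setX_bigcupr -setI_bigcupr bigcup_box setIT.
Qed.

Lemma measurable_PT_snd : measurable_fun setT (snd : PT -> R2).
Proof.
move=> _ D mD; rewrite setTI (_ : snd @^-1` D = \bigcup_n (setT `*` (D `&` box n))).
  apply: bigcup_measurable => n _; apply: (@measurable_PT_rect (- n%:R - 1)) => //.
  - exact: past_eventT.
  - by apply: measurableI => //; exact: measurable_box.
  - by move=> [x y] [_]; rewrite /box/= !in_itv/= => -[/andP[? _] _]; lra.
rewrite -setX_bigcupr -setI_bigcupr bigcup_box setIT.
by apply/seteqP; split => [[w p]|[w p] []].
Qed.

Lemma sub_PT_measurable (A : set (Omega * R2)) : (measurable : set (set PT)) A -> measurable A.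
Proof.
move: A; apply: smallest_sub; first exact: sigma_algebra_measurable.
move=> _ [a [B [D [[mB _] mD _ _ ->]]]]; exact: measurableX.
Qed.

Lemma measurable_PT_fun d' (Y : measurableType d') (f : Omega * R2 -> Y) :
  measurable_fun setT (f : PT -> Y) -> measurable_fun setT f.
Proof. by move=> mf _ A mA; apply: sub_PT_measurable; exact: mf. Qed.

Lemma measurable_PT_section d' (Y : measurableType d') (f : Omega * R2 -> Y) w :
  measurable_fun setT (f : PT -> Y) -> measurable_fun setT (fun p => f (w, p)).
Proof. by move=> /measurable_PT_fun mf; exact: measurableT_comp. Qed.

Section mixture.
Variable l : Omega -> {measure set R2 -> \bar R}.
Hypothesis ml : forall U, measurable U -> measurable_fun setT (l ^~ U).
Hypothesis fl : forall x, locfin (l x).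

(** For [l = N] this is the Campbell measure of the random measure, restricted to the predictable
    sigma-algebra. *)
Definition mixture (A : set PT) : \bar R := (\int[P]_w l w (xsection A w))%E.

Let mixture0 : mixture set0 = 0%E.
Proof. by apply: integral0_eq => w _; rewrite xsection0 measure0. Qed.

Let mixture_ge0 A : (0 <= mixture A)%E.
Proof. exact: integral_ge0. Qed.

Let mixture_sigma_additive : semi_sigma_additive mixture.
Proof.
move=> F mF tF mUF.
have mF' n := sub_PT_measurable (mF n).
rewrite [X in _ --> X](_ : _ = \int[P]_w (\sum_(0 <= n <oo) l w (xsection (F n) w)))%E; last first.
  apply: eq_integral => w _; rewrite xsection_bigcup; apply/esym/cvg_lim => //.
  apply: measure_semi_sigma_additive.
  - by move=> n; exact: measurable_xsection.
  - exact: trivIset_xsection.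
  - by apply: bigcup_measurable => n _; exact: measurable_xsection.
apply/cvg_closeP; split.
  by apply: is_cvg_nneseries => n _ _; exact: integral_ge0.
rewrite closeE// integral_nneseries// => n.
exact: measurable_xsection_locfin.
Qed.

HB.instance Definition _ := isMeasure.Build _ PT R mixture mixture0 mixture_ge0 mixture_sigma_additive.

Definition mmixture : {measure set PT -> \bar R} := mixture.

End mixture.

(** Two measures on [PT] are compared: they agree on the rectangles by independence of the past, and
    they are finite on the boxes, so they coincide. *)
Lemma compensation_rect (A : set PT) : measurable A ->
  (\int[P]_w N w (xsection A w) = \int[P]_w nu (xsection A w))%E.
Proof.
move=> mA.
pose mN := mmixture (prm_measurable PN) fN.
pose mnu := mmixture (l := fun=> nu) (fun U mU => measurable_cst (nu U)) (fun=> @locfin_nu R).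
have h B D w : xsection (B `*` D : set (Omega * R2)) w = if w \in B then D else set0.
  by case: ifPn => wB; [rewrite in_xsectionX|rewrite notin_xsectionX].
suff: mN A = mnu A by [].
apply: (@measure_unique _ R PT predictable_rect PT_box _ _ _ _ mN mnu _ _ A mA).
- by [].
- exact: setI_closed_predictable_rect.
- exact: predictable_rect_box.
- exact: bigcup_PT_box.
- move=> _ [a [B [D [pB mD [n Dn] Da ->]]]].
  have [mB _] := pB.
  have fD : (nu D < +oo)%E.
    apply: le_lt_trans (locfin_nu n); apply: le_measure; rewrite ?inE//; exact: measurable_box.
  rewrite /mN /mnu /mmixture/= /mixture.
  transitivity (\int[P]_(w in B) N w D)%E.
    rewrite [RHS]integral_mkcond; apply: eq_integral => w _; rewrite h patchE.
    by case: ifPn => //; rewrite measure0.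
  rewrite (past_event_mean SN pB mD fD Da).
  transitivity (\int[P]_(w in B) nu D)%E; first by rewrite integral_cst// muleC.
  rewrite [LHS]integral_mkcond; apply: eq_integral => w _; rewrite h patchE.
  by case: ifPn => //; rewrite measure0.
- move=> n; rewrite /mN /mmixture/= /mixture.
  have -> : (\int[P]_w N w (xsection (PT_box n) w) = \int[P]_(w in setT) N w (box n))%E.
    by apply: eq_integral => w _; rewrite h in_setT.
  rewrite (past_event_mean SN (past_eventT (- n%:R - 1)))//.
  + by rewrite probability_setT mul1e; exact: locfin_nu.
  + exact: measurable_box.
  + exact: locfin_nu.
  + by move=> [x y]; rewrite /box/= !in_itv/= => -[/andP[? _] _]; lra.
Qed.

Lemma measurable_integral_N (f : Omega * R2 -> \bar R) : measurable_fun setT f ->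
  (forall x, 0 <= f x)%E -> measurable_fun setT (fun w => \int[N w]_p f (w, p))%E.
Proof. by move=> mf f0; apply: measurable_integral_locfin => //; exact: (prm_measurable PN). Qed.

Lemma measurable_integral_nu (f : Omega * R2 -> \bar R) : measurable_fun setT f ->
  (forall x, 0 <= f x)%E -> measurable_fun setT (fun w => \int[nu]_p f (w, p))%E.
Proof.
move=> mf f0; apply: (@measurable_integral_locfin _ _ _ (fun=> nu)) => // _.
exact: locfin_nu.
Qed.

Lemma compensation (h : PT -> \bar R) : measurable_fun setT h -> (forall x, 0 <= h x)%E ->
  (\int[P]_w \int[N w]_p h (w, p) = \int[P]_w \int[nu]_p h (w, p))%E.
Proof.
move: h; apply: ge0_measurable_ind.
- move=> A mA; have mA' := sub_PT_measurable mA.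
  have E (m : {measure set R2 -> \bar R}) w : (\int[m]_p (\1_A (w, p))%:E = m (xsection A w))%E.
    rewrite (_ : (fun p => _) = (fun p => (\1_(xsection A w) p)%:E)).
      by rewrite integral_indic ?setIT//; exact: measurable_xsection.
    by apply/funext => p; rewrite !indicE mem_xsection.
  under eq_integral do rewrite E; rewrite compensation_rect//.
  by apply: eq_integral => w _; rewrite E.
- move=> r f r0 mf f0 ih; have mf' := measurable_PT_fun mf.
  under eq_integral.
    move=> w _; rewrite ge0_integralZl//; last first.
      exact: measurableT_comp mf' _.
    over.
  under [RHS]eq_integral.
    move=> w _; rewrite ge0_integralZl//; last first.
      exact: measurableT_comp mf' _.
    over.
  rewrite !ge0_integralZl ?ih//.
  + by apply: (measurable_integral_nu mf').
  + by move=> *; exact: integral_ge0.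
  + by apply: (measurable_integral_N mf').
  + by move=> *; exact: integral_ge0.
- move=> f g mf f0 mg g0 ihf ihg.
  have mf' := measurable_PT_fun mf; have mg' := measurable_PT_fun mg.
  under eq_integral.
    move=> w _; rewrite ge0_integralD//; [|exact: measurableT_comp mf' _|exact: measurableT_comp mg' _].
    over.
  under [RHS]eq_integral.
    move=> w _; rewrite ge0_integralD//; [|exact: measurableT_comp mf' _|exact: measurableT_comp mg' _].
    over.
  transitivity (\int[P]_w \int[N w]_p f (w, p) + \int[P]_w \int[N w]_p g (w, p))%E.
    apply: ge0_integralD => //; [by move=> *; exact: integral_ge0| |by move=> *; exact: integral_ge0|].
      exact: (measurable_integral_N mf').
    exact: (measurable_integral_N mg').
  rewrite ihf ihg; apply/esym.
  apply: ge0_integralD => //; [by move=> *; exact: integral_ge0| |by move=> *; exact: integral_ge0|].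
    exact: (measurable_integral_nu mf').
  exact: (measurable_integral_nu mg').
- move=> f_ f mf_ f_0 ndf cvf ih.
  have mf' n := measurable_PT_fun (mf_ n).
  have fE x : f x = limn (f_ ^~ x) by apply/esym/cvg_lim => //; exact: cvf.
  have c (m : {measure set R2 -> \bar R}) w :
      (\int[m]_p f (w, p) = limn (fun n => \int[m]_p f_ n (w, p)))%E.
    under eq_integral do rewrite fE.
    by rewrite monotone_convergence// => n; exact: measurableT_comp (mf' n) _.
  have nd (m : {measure set R2 -> \bar R}) w : nondecreasing_seq (fun n => \int[m]_p f_ n (w, p))%E.
    move=> i j ij; apply: ge0_le_integral => //.
    + exact: measurableT_comp (mf' i) _.
    + exact: measurableT_comp (mf' j) _.
    + by move=> p _; exact: ndf.
  under eq_integral do rewrite c; under [RHS]eq_integral do rewrite c.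
  transitivity (limn (fun n => \int[P]_w \int[N w]_p f_ n (w, p)))%E.
    apply: monotone_convergence => //.
      by move=> n; apply: (measurable_integral_N (mf' n)).
    by move=> n w _; exact: integral_ge0.
  under eq_fun do rewrite ih.
  apply/esym/monotone_convergence => //.
    by move=> n; apply: (measurable_integral_nu (mf' n)).
  by move=> n w _; exact: integral_ge0.
Qed.

End predictable.

(** * Predictability of integrals over the past *)

Section past_integral.
Context {R : realType} d (Omega : measurableType d) (P : probability Omega R).
Notation R2 := (R * R)%type.
Variable N : Omega -> {measure set R2 -> \bar R}.
Hypothesis SN : simple_prm P N.
Let fN w : locfin (N w). Proof. by case: SN. Qed.
Notation PT := (PT N).

(** Satisfied by [N] and by the constant [nu], so that one argument covers inner integrals against
    either of them. *)
Definition adapted (k : Omega -> {measure set R2 -> \bar R}) :=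
  (forall w, locfin (k w)) /\
  forall r A V, past_set r A -> measurable V -> past_event N r [set w | V (k w A)].

Lemma adapted_N : adapted N.
Proof. by split => // r A V pA mV; exact: past_event_count SN _ _ _ pA mV. Qed.

Lemma adapted_nu : adapted (fun=> nu).
Proof.
split => [_|r A V pA mV]; first exact: locfin_nu.
have [h|h] := pselect (V (nu A)).
  rewrite (_ : [set _ | _] = setT); first exact: past_eventT.
  by apply/seteqP; split.
rewrite (_ : [set _ | _] = set0); last by apply/seteqP; split.
by split; [exact: measurable0|exists [::], set0].
Qed.

Definition before (p : R2) : set R2 := [set q | q.1 < p.1].

Lemma measurable_before p : measurable (before p).
Proof.
rewrite (_ : before p = `]-oo, p.1[%classic `*` setT); first by apply: measurableX.
by apply/seteqP; split => [[x y]|[x y] []] /=; rewrite /before /= in_itv.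
Qed.

Variable k : Omega -> {measure set R2 -> \bar R}.
Hypothesis ak : adapted k.
Let fk w : locfin (k w). Proof. by case: ak. Qed.

(** The mass strictly before a time is the supremum, over the rationals [r] before it and over the
    boxes, of the mass up to [r] in the box. Each of these is known at time [r], and there are
    countably many. *)
Lemma measurable_past_measure U : measurable U ->
  measurable_fun setT (fun x : PT => k x.1 (U `&` before x.2)).
Proof.
move=> mU.
have mq (r : R) : measurable [set q : R2 | q.1 <= r].
  rewrite (_ : [set q | _] = `]-oo, r]%classic `*` setT); first by apply: measurableX.
  by apply/seteqP; split => [[x y]|[x y] []] /=; rewrite in_itv.
pose A (y : rat * nat) := U `&` box y.2 `&` [set q | q.1 <= ratr y.1].
have mA y : measurable (A y).
  by apply: measurableI => //; apply: measurableI => //; exact: measurable_box.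
(* A pair of a rational [r] and a box contributes after time [r] only, when its mass is known; the
   value 0 elsewhere does not affect a supremum of nonnegative terms. *)
pose F i (x : PT) : \bar R := if @choice.unpickle (rat * nat)%type i is Some y then
  (fun x : PT => k x.1 (A y)) \_ [set x : PT | ratr y.1 < x.2.1] x else 0%E.
have mF i : measurable_fun setT (F i).
  rewrite /F; case: choice.unpickle => [y|]; last exact: measurable_cst.
  have mr : measurable [set x : PT | ratr y.1 < x.2.1].
    rewrite (_ : [set _ | _] = setT `*` [set q : R2 | ratr y.1 < q.1]).
      apply: (measurable_PT_rect (a := ratr y.1)) => //; first exact: past_eventT.
      by rewrite (_ : [set _ | _] = ~` [set q | q.1 <= ratr y.1]) ?setCset//; [exact: measurableC|apply/seteqP; split => q /=; rewrite ltNge => /negP].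
    by apply/seteqP; split => [[w q]|[w q] []].
  apply/(measurable_restrictT _ mr) => _ V mV.
  rewrite (_ : _ `&` _ = [set w | V (k w (A y))] `*` [set q : R2 | ratr y.1 < q.1]).
    apply: (measurable_PT_rect (a := ratr y.1)) => //.
      apply: ak.2 => //; split => //; first by exists y.2 => q [[]].
      by move=> q [].
    by rewrite (_ : [set _ | _] = ~` [set q | q.1 <= ratr y.1]) ?setCset//; [exact: measurableC|apply/seteqP; split => q /=; rewrite ltNge => /negP].
  by apply/seteqP; split => [[w q] [/= ? ?]|[w q] [/= ? ?]].
rewrite (_ : (fun x => _) = (fun x => esups (F ^~ x) 0)).
  exact: measurable_fun_esups.
apply/funext => -[w p]; apply/eqP; rewrite eq_le; apply/andP; split; last first.
  apply: ge_ereal_sup => _ [i _ <-]; rewrite /F.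
  case: choice.unpickle => [y|]; last exact: measure_ge0.
  rewrite patchE; case: ifPn => [|_]; last exact: measure_ge0.
  rewrite inE/= => yp; apply: le_measure; rewrite ?inE//.
    by apply: measurableI => //; exact: measurable_before.
  by move=> q [[Uq _] /= qy]; split => //; rewrite /before/=; exact: le_lt_trans yp.
pose E n := U `&` box n `&` [set q : R2 | q.1 <= p.1 - n.+1%:R^-1].
have mE n : measurable (E n).
  by apply: measurableI => //; apply: measurableI => //; exact: measurable_box.
have UE : U `&` before p = \bigcup_n E n.
  apply/seteqP; split => [q [Uq]|q [n _ [[Uq _] /= qp]]]; last first.
    split => //; rewrite /before/= (le_lt_trans qp)// ltrBlDr ltrDl invr_gt0//.
  rewrite /before/= => qp.
  have [n _ qn] : (\bigcup_n box n) q by rewrite bigcup_box.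
  have [m hm] : exists m : nat, q.1 <= p.1 - m.+1%:R^-1.
    exists (Num.truncn (p.1 - q.1)^-1).
    rewrite lerBrDr addrC -lerBrDr.
    have h : 0 < p.1 - q.1 by rewrite subr_gt0.
    by rewrite -[leRHS]invrK lef_pV2 ?posrE ?invr_gt0// ltW// truncnS_gt.
  exists (maxn n m) => //; split; first by split => //; apply: subset_box qn; exact: leq_maxl.
  rewrite /= (le_trans hm)// lerB// lef_pV2 ?posrE// ler_nat ltnS; exact: leq_maxr.
have cE : k w (E n) @[n --> \oo] --> k w (U `&` before p).
  rewrite UE; apply: nondecreasing_cvg_mu => //; first exact: bigcup_measurable.
  move=> m n mn; apply/subsetPset => q [[Uq bq] /= qp]; split.
    by split => //; exact: subset_box bq.
  rewrite /= (le_trans qp)// lerB// lef_pV2 ?posrE// ler_nat ltnS//.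
rewrite -(cvg_lim _ cE)//; apply: lime_le; first by apply/cvg_ex; exists (k w (U `&` before p)).
apply: nearW => n.
have [r] : exists r : rat, ratr r \in `](p.1 - n.+1%:R^-1), p.1[.
  by apply: rat_in_itvoo; rewrite ltrBlDr ltrDl invr_gt0.
rewrite in_itv/= => /andP[r1 r2].
apply: (@le_trans _ _ (F (choice.pickle (r, n)) (w, p))).
  rewrite /F choice.pickleK patchE ifT ?inE//.
  apply: le_measure; rewrite ?inE//.
  by move=> q [Uq /= qp]; split => //=; rewrite (le_trans qp)// ltW.
by apply: ereal_sup_ubound; exists (choice.pickle (r, n)).
Qed.

(** For a rectangle [B * D] with [D] after time [a], a point [q] of [D] before [p] forces [a < p.1];
    so [B] is already known when [p] occurs, and the preimage is built from a rectangle in [p]. *)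
Lemma measurable_past_pair (h : PT -> \bar R) : measurable_fun setT h ->
  measurable_fun setT ((fun y : PT * R2 => h (y.1.1, y.2)) \_ [set y : PT * R2 | y.2.1 < y.1.2.1]).
Proof.
move=> mh.
have m1 : measurable_fun setT (fun y : PT * R2 => y.1.2.1).
  apply: measurableT_comp; first exact: measurable_fst.
  by apply: measurableT_comp; [exact: measurable_PT_snd|exact: measurable_fst].
have m2 : measurable_fun setT (fun y : PT * R2 => y.2.1).
  by apply: measurableT_comp; [exact: measurable_fst|exact: measurable_snd].
have mE : measurable [set y : PT * R2 | y.2.1 < y.1.2.1].
  by rewrite -[X in measurable X]setTI; exact: measurable_fun_ltr m2 m1 measurableT [set true] _.
apply/(measurable_restrictT _ mE).
apply: (@measurable_comp _ _ _ _ _ _ setT) mh _ => //.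
apply: (@measurability _ _ _ PT _ _ (predictable_rect N)) => //.
move=> _ [_ [a [B [D [pB mD [n Dn] Da ->]]]] <-].
rewrite (_ : _ `&` _ = [set y : PT * R2 | y.2.1 < y.1.2.1] `&`
   ((B `*` [set q : R2 | a < q.1] : set PT) `*` D)); last first.
  apply/seteqP; split => -[[w p] q] /= [qp]; last by move=> [[? ?] ?].
  by move=> [Bw Dq]; split => //; split => //; split => //; exact: lt_trans (Da _ Dq) qp.
apply: measurableI => //; apply: measurableX => //.
apply: (measurable_PT_rect (a := a)) => //.
rewrite (_ : [set _ | _] = `]a, +oo[%classic `*` setT); first by apply: measurableX.
by apply/seteqP; split => [[x y]|[x y] []] /=; rewrite in_itv/= andbT.
Qed.

(** Two uses: [g = 1] gives the inner integrals when a product of integrals is split, and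
    [g t s = phi (t - s)] gives the self-exciting part of the intensity. *)
Definition past_integral (g : R -> R -> \bar R) (h : Omega * R2 -> \bar R) (x : Omega * R2) : \bar R :=
  (\int[k x.1]_(q in before x.2) (g x.2.1 q.1 * h (x.1, q)))%E.

(** The measure cut to the past is a kernel from [PT], and the integrand is jointly measurable
    because [h] is evaluated at earlier points only. *)
Lemma measurable_past_integral (g : R -> R -> \bar R) (h : PT -> \bar R) :
  measurable_fun setT (fun z : R2 => g z.1 z.2) -> (forall s t, 0 <= g s t)%E ->
  measurable_fun setT h -> (forall x, 0 <= h x)%E ->
  measurable_fun setT (past_integral g h : PT -> \bar R).
Proof.
move=> mg g0 mh h0.
pose l (x : PT) : {measure set R2 -> \bar R} := mrestr (k x.1) (measurable_before x.2).
pose f (y : PT * R2) : \bar R := (g y.1.2.1 y.2.1 *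
  ((fun y : PT * R2 => h (y.1.1, y.2)) \_ [set y : PT * R2 | (y.2.1 < y.1.2.1)%R]) y)%E.
have f0 y : (0 <= f y)%E by apply: mule_ge0 => //; rewrite patchE; case: ifPn.
have mf : measurable_fun setT f.
  apply: emeasurable_funM; last exact: measurable_past_pair.
  apply: (@measurableT_comp _ _ _ _ _ _ (fun z : R2 => g z.1 z.2) setT (fun y : PT * R2 => (y.1.2.1, y.2.1)) mg).
  apply: measurable_fun_pair.
    apply: measurableT_comp; first exact: measurable_fst.
    by apply: measurableT_comp; [exact: measurable_PT_snd|exact: measurable_fst].
  by apply: measurableT_comp; [exact: measurable_fst|exact: measurable_snd].
have := @measurable_integral_locfin R _ PT l measurable_past_measure _ f mf f0.
rewrite (_ : (fun x => _) = past_integral g h :> (PT -> \bar R)).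
  apply => x n; apply: le_lt_trans (fk x.1 n).
  have mb := @measurable_box R n; have mx := measurable_before x.2.
  by rewrite /l /mrestr/=; apply: le_measure; rewrite ?inE//; exact: measurableI.
apply/funext => -[w p]; rewrite /past_integral /=.
have mb := measurable_before p.
rewrite (integral_mrestr (m := k w) mb)//; last first.
  exact: measurableT_comp mf _.
apply: eq_integral => q; rewrite inE => qp.
by rewrite /f patchE/= ifT// inE.
Qed.

End past_integral.

(** * The isometry *)

Section product_of_integrals.
Context {R : realType}.
Notation R2 := (R * R)%type.
Local Open Scope ereal_scope.

Definition line (p : R2) : set R2 := [set q | q.1 = p.1].

Lemma measurable_line p : measurable (line p).
Proof.
rewrite (_ : line p = [set p.1]%classic `*` setT); first by apply: measurableX.
by apply/seteqP; split => [[x y]|[x y] []].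
Qed.

Let mR2fst : measurable_fun setT (fun z : R2 * R2 => z.1.1).
Proof. by apply: measurableT_comp; [exact: measurable_fst|exact: measurable_fst]. Qed.
Let mR2snd : measurable_fun setT (fun z : R2 * R2 => z.2.1).
Proof. by apply: measurableT_comp; [exact: measurable_fst|exact: measurable_snd]. Qed.

Let mlt : measurable [set z : R2 * R2 | (z.2.1 < z.1.1)%R].
Proof. by rewrite -[X in measurable X]setTI; exact: measurable_fun_ltr mR2snd mR2fst measurableT [set true] _. Qed.
Let mgt : measurable [set z : R2 * R2 | (z.1.1 < z.2.1)%R].
Proof. by rewrite -[X in measurable X]setTI; exact: measurable_fun_ltr mR2fst mR2snd measurableT [set true] _. Qed.
Let meq : measurable [set z : R2 * R2 | z.2.1 = z.1.1].
Proof.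
rewrite (_ : [set _ | _] = ~` ([set z : R2 * R2 | (z.2.1 < z.1.1)%R] `|` [set z : R2 * R2 | (z.1.1 < z.2.1)%R])).
  by apply: measurableC; apply: measurableU.
apply/seteqP; split => -[[a b] [c e]] /=; first by move=> ->; rewrite ltxx => -[].
by move=> /not_orP[/negP + /negP]; rewrite -!leNgt => ? ?; apply/eqP; rewrite eq_le; apply/andP.
Qed.

Lemma ge0_mul_integrals (m1 m2 : {measure set R2 -> \bar R}) (f g : R2 -> \bar R) :
  locfin m1 -> locfin m2 -> measurable_fun setT f -> measurable_fun setT g ->
  (forall p, 0 <= f p) -> (forall p, 0 <= g p) ->
  \int[m1]_p f p * \int[m2]_q g q =
  \int[m1]_p (f p * \int[m2]_(q in before p) g q) +
  \int[m2]_q (g q * \int[m1]_(p in before q) f p) +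
  \int[m1]_p (f p * \int[m2]_(q in line p) g q).
Proof.
move=> /locfin_sigma_finite s1 /locfin_sigma_finite s2 mf mg f0 g0.
pose K (z : R2 * R2) := f z.1 * g z.2.
have mK : measurable_fun setT K.
  by apply: emeasurable_funM; [exact: measurableT_comp mf _|exact: measurableT_comp mg _].
have K0 z : 0 <= K z by exact: mule_ge0.
pose D1 := [set z : R2 * R2 | (z.2.1 < z.1.1)%R].
pose D2 := [set z : R2 * R2 | (z.1.1 < z.2.1)%R].
pose D3 := [set z : R2 * R2 | z.2.1 = z.1.1].
have mP D : measurable D -> measurable_fun setT (K \_ D).
  by move=> mD; apply/(measurable_restrictT _ mD); exact: measurable_funTS.
have P0 D z : 0 <= (K \_ D) z by rewrite patchE; case: ifP.
have mI D : measurable D -> measurable_fun setT (fun p => \int[m2]_q (K \_ D) (p, q)).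
  by move=> mD; apply: measurable_ge0_tonelli => //; exact: mP.
have I0 D p : 0 <= \int[m2]_q (K \_ D) (p, q) by exact: integral_ge0.
have mPp D p : measurable D -> measurable_fun setT (fun q => (K \_ D) (p, q)).
  by move=> mD; exact: measurableT_comp (mP D mD) _.
have KE z : K z = (K \_ D1) z + ((K \_ D2) z + (K \_ D3) z).
  have E1 : (z \in D1) = (z.2.1 < z.1.1)%R by apply/idP/idP; rewrite inE.
  have E2 : (z \in D2) = (z.1.1 < z.2.1)%R by apply/idP/idP; rewrite inE.
  have E3 : (z \in D3) = (z.2.1 == z.1.1) by apply/idP/eqP; rewrite inE.
  by rewrite !patchE E1 E2 E3; case: ltgtP => _; rewrite ?add0e ?adde0.
transitivity (\int[m1]_p \int[m2]_q K (p, q)).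
  rewrite -ge0_integralZr//; last exact: integral_ge0.
  by apply: eq_integral => p _; rewrite /K/= ge0_integralZl.
transitivity (\int[m1]_p (\int[m2]_q (K \_ D1) (p, q) +
   (\int[m2]_q (K \_ D2) (p, q) + \int[m2]_q (K \_ D3) (p, q)))).
  apply: eq_integral => p _; under eq_integral do rewrite KE.
  rewrite ge0_integralD//; [|exact: mPp|by move=> q _; exact: adde_ge0|by apply: emeasurable_funD; exact: mPp].
  by congr (_ + _); apply: ge0_integralD => //; exact: mPp.
transitivity (\int[m1]_p \int[m2]_q (K \_ D1) (p, q) +
   (\int[m1]_p \int[m2]_q (K \_ D2) (p, q) + \int[m1]_p \int[m2]_q (K \_ D3) (p, q))).
  rewrite ge0_integralD//; [|exact: mI|by move=> q _; exact: adde_ge0|by apply: emeasurable_funD; exact: mI].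
  by congr (_ + _); apply: ge0_integralD => //; exact: mI.
rewrite addeA; congr (_ + _ + _).
- apply: eq_integral => p _; rewrite -ge0_integralZl//; last exact: measurable_funTS.
    rewrite [RHS]integral_mkcond; apply: eq_integral => q _; rewrite !patchE.
    by congr (if _ then _ else _); apply/idP/idP; rewrite !inE.
  exact: measurable_before.
- rewrite ge0_tonelli//; last exact: mP.
  apply: eq_integral => q _; rewrite -ge0_integralZl//; last exact: measurable_funTS.
    rewrite [RHS]integral_mkcond; apply: eq_integral => p _; rewrite !patchE /K/= muleC.
    by congr (if _ then _ else _); apply/idP/idP; rewrite !inE.
  exact: measurable_before.
- apply: eq_integral => p _; rewrite -ge0_integralZl//; last exact: measurable_funTS.
    rewrite [RHS]integral_mkcond; apply: eq_integral => q _; rewrite !patchE.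
    by congr (if _ then _ else _); apply/idP/idP; rewrite !inE.
  exact: measurable_line.
Qed.

Lemma nu_line p : nu (line p) = 0.
Proof.
apply/eqP; rewrite eq_le measure_ge0 andbT.
apply: le_trans (nu_le (measurable_line p)) _.
rewrite (_ : line p = [set p.1]%classic `*` setT); last by apply/seteqP; split => [[x y]|[x y] []].
by rewrite leb2X// /leb lebesgue_measure_set1 mul0e.
Qed.

Lemma ge0_integral_null d (T : measurableType d) (m : {measure set T -> \bar R}) (D : set T) (f : T -> \bar R) :
  measurable D -> m D = 0 -> \int[m]_(x in D) f x = 0.
Proof.
move=> mD mD0; rewrite (eq_measure_integral mzero) ?integral_measure_zero// => A mA AD.
by apply: (subset_measure0 mA mD AD mD0).
Qed.

Lemma ge0_mul_integrals_nu (m1 : {measure set R2 -> \bar R}) (f g : R2 -> \bar R) :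
  locfin m1 -> measurable_fun setT f -> measurable_fun setT g ->
  (forall p, 0 <= f p) -> (forall p, 0 <= g p) ->
  \int[m1]_p f p * \int[nu]_q g q =
  \int[m1]_p (f p * \int[nu]_(q in before p) g q) +
  \int[nu]_q (g q * \int[m1]_(p in before q) f p).
Proof.
move=> fm1 mf mg f0 g0; rewrite ge0_mul_integrals//; last exact: locfin_nu.
rewrite [X in _ + X](_ : _ = 0) ?adde0//.
by apply: integral0_eq => p _; rewrite ge0_integral_null ?mule0//; [exact: measurable_line|exact: nu_line].
Qed.

End product_of_integrals.

(** * Atoms, and points on a line of constant time *)

Section simple.
Context {R : realType} d (Omega : measurableType d) (P : probability Omega R).
Notation R2 := (R * R)%type.
Variable N : Omega -> {measure set R2 -> \bar R}.
Hypothesis SN : simple_prm P N.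
Let PN : is_PRM P N. Proof. by case: SN. Qed.
Let fN w : locfin (N w). Proof. by case: SN. Qed.
Local Open Scope ereal_scope.

(** Off the countably many cells of mass zero, every cell around [p] has mass at least 1, and this
    passes to the limit of sets shrinking to [p]. *)
Lemma prm_atoms w : {ae N w, forall p, 1 <= N w [set p]}.
Proof.
have key1 (u z a b : R) : (a <= b -> u - a <= z <= u + a -> u - b <= z <= u + b)%R.
  by move=> ? /andP[? ?]; apply/andP; split; lra.
have key2 (u a : R) : (0 <= a -> u - a <= u <= u + a)%R.
  by move=> ?; apply/andP; split; lra.
have key3 (u z B : R) : (`|u| + 1 <= B -> u - 1 <= z <= u + 1 -> - B <= z <= B)%R.
  by have := ler_norm u; have := ler_norm (- u)%R; rewrite normrN => ? ? ? /andP[? ?]; apply/andP; split; lra.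
pose C i : set R2 := if @choice.unpickle (nat * int * int)%type i is Some y then
  (if N w (cell y.1.1 y.1.2 y.2) == 0 then cell y.1.1 y.1.2 y.2 else set0) else set0.
have C0 i : (N w).-negligible (C i).
  rewrite /C; case: choice.unpickle => [y|]; last exact: negligible_set0.
  case: ifPn => [/eqP h|_]; last exact: negligible_set0.
  by apply/negligibleP => //; exact: measurable_cell.
have := negligible_bigcup C0; apply: negligibleS => p /= Np.
apply: contrapT => h; apply: Np.
have cp n : 1 <= N w (cell n (Num.floor (p.1 * n.+1%:R)) (Num.floor (p.2 * n.+1%:R))).
  have [_ _ /(_ w n (Num.floor (p.1 * n.+1%:R)%R) (Num.floor (p.2 * n.+1%:R)%R))] := SN.
  case=> // c0; exfalso; apply: h.
  exists (choice.pickle (n, Num.floor (p.1 * n.+1%:R)%R, Num.floor (p.2 * n.+1%:R)%R)) => //.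
  by rewrite /C choice.pickleK/= c0 eqxx; exact: in_cell.
(* The cells around [p] for the meshes [1 / (n + 1)] are not nested; these closed squares contain
   them, decrease and have intersection [p]. *)
pose S n : set R2 := `[(p.1 - n.+1%:R^-1)%R, (p.1 + n.+1%:R^-1)%R]%classic `*`
  `[(p.2 - n.+1%:R^-1)%R, (p.2 + n.+1%:R^-1)%R]%classic.
have mS n : measurable (S n) by apply: measurableX; exact: measurable_itv.
have S1 n : 1 <= N w (S n).
  apply: le_trans (cp n) _; apply: le_measure; rewrite ?inE//; first exact: measurable_cell.
  have n0 : (0 < n.+1%:R :> R)%R by [].
  have hh (x y : R) : ((Num.floor (x * n.+1%:R))%:~R / n.+1%:R <= y < (Num.floor (x * n.+1%:R) + 1)%:~R / n.+1%:R ->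
     x - n.+1%:R^-1 <= y <= x + n.+1%:R^-1)%R.
    rewrite ler_pdivrMr// ltr_pdivlMr// intrD => /andP[h1 h2].
    have := floor_le_tmp (x * n.+1%:R)%R; have := floorD1_gt (x * n.+1%:R)%R; rewrite intrD => h3 h4.
    have e : (n.+1%:R^-1 * n.+1%:R = 1 :> R)%R by rewrite mulVf.
    by apply/andP; split; rewrite -(ler_pM2r n0) ?mulrBl ?mulrDl e; lra.
  by move=> [x y] []; rewrite /= !in_itv/= => /hh ? /hh ?.
have cS : N w (S n) @[n --> \oo] --> N w (\bigcap_n S n).
  apply: nonincreasing_cvg_mu => //.
  - have [k _ kS] : exists2 k : nat, True & S 0%N `<=` box k.
      exists (Num.truncn (`|p.1| + `|p.2| + 1)%R).+1 => // q [].
      rewrite /= !in_itv/= invr1 => h1 h2; have := truncnS_gt (`|p.1| + `|p.2| + 1)%R => h3.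
      split; rewrite /= in_itv/=; [apply: key3 h1|apply: key3 h2]; apply: le_trans (ltW h3).
        by rewrite lerD2r lerDl.
      by rewrite lerD2r lerDr.
    by apply: le_lt_trans (fN w k); apply: le_measure; rewrite ?inE//; exact: measurable_box.
  - exact: bigcap_measurableType.
  - move=> m n mn; apply/subsetPset => -[x y] /=; rewrite /S /= !in_itv/=.
    have : (n.+1%:R^-1 <= m.+1%:R^-1 :> R)%R by rewrite lef_pV2 ?posrE// ler_nat.
    by move=> hn [/(key1 _ _ _ _ hn) ? /(key1 _ _ _ _ hn) ?].
rewrite (_ : [set p] = \bigcap_n S n).
  rewrite -(cvg_lim _ cS)//; apply: lime_ge; first by apply/cvg_ex; exists (N w (\bigcap_n S n)).
  exact: nearW.
apply/seteqP; split => [_ -> n _|q Sq].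
  have : (0 <= n.+1%:R^-1 :> R)%R by [].
  by rewrite /S/= !in_itv/= => ?; split; exact: key2.
have eq0 (x y : R) : (forall n, (x - n.+1%:R^-1 <= y <= x + n.+1%:R^-1)%R) -> y = x.
  move=> hn; apply/eqP; rewrite -subr_eq0 -normr_le0; apply/ler_addgt0Pl => e e0.
  have := hn (Num.truncn e^-1); have := truncnS_gt e^-1 => he.
  have : ((Num.truncn e^-1).+1%:R^-1 <= e)%R.
    by rewrite -[leRHS]invrK lef_pV2 ?posrE ?invr_gt0// ltW.
  rewrite addr0 => h1 /andP[h2 h3]; apply: le_trans h1; rewrite ler_norml.
  by apply/andP; split; [rewrite lerBrDr addrC|rewrite lerBlDr addrC].
have /(_ _)/= := Sq; rewrite /S/= => {}Sq.
rewrite [q]surjective_pairing [p in RHS]surjective_pairing; congr pair; apply: eq0 => n.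
  by have [] := Sq n Logic.I; rewrite /= in_itv.
by have [] := Sq n Logic.I; rewrite /= in_itv.
Qed.

Lemma prm_ge2 A (b : R) : measurable A -> nu A <= b%:E ->
  P (~` ([set w | N w A = 0%R%:E] `|` [set w | N w A = 1%R%:E])) <= (b ^+ 2)%:E.
Proof.
move=> mA Ab.
have fA : nu A < +oo by exact: le_lt_trans Ab (ltry _).
have m0 := measurable_count PN (0%:E) mA; have m1 := measurable_count PN (1%:E) mA.
rewrite probability_setC; last exact: measurableU.
rewrite measureU//; last first.
  by apply/seteqP; split => // w [/= ->] [] /eqP; rewrite eq_sym oner_eq0.
rewrite [X in 1 - (X + _)](prm_pois PN 0%N mA fA) [X in 1 - (_ + X)](prm_pois PN 1%N mA fA).
have nu0 : (0 <= fine (nu A))%R by exact: fine_ge0.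
have E (x y : R) : 1 - (x%:E + y%:E) = (1 - x - y)%:E by rewrite -addrA -opprD.
rewrite [leLHS]E lee_fin; apply: le_trans (pois_tail2 nu0) _.
apply: lerXn2r; rewrite ?nnegrE//.
  by rewrite -lee_fin (le_trans _ Ab).
by rewrite -lee_fin fineK// ge0_fin_numE.
Qed.

(** The strips share their edges, which a union bound tolerates; being closed, they cover every line
    of constant time in the box. *)
Definition strip (M K i : nat) : set R2 :=
  `[(- M%:R + i%:R / K.+1%:R)%R, (- M%:R + i.+1%:R / K.+1%:R)%R]%classic `*` `[(- M%:R)%R, M%:R%R]%classic.

Lemma measurable_strip M K i : measurable (strip M K i).
Proof. by apply: measurableX; exact: measurable_itv. Qed.

Lemma nu_strip M K i : nu (strip M K i) <= (2 * M%:R / K.+1%:R)%:E.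
Proof.
apply: le_trans (nu_le (measurable_strip M K i)) _.
rewrite /strip leb2X// /leb !lebesgue_measure_itv/= !lte_fin.
have K0 : (0 < K.+1%:R :> R)%R by [].
rewrite ifT; last by rewrite ltrD2l ltr_pM2r ?invr_gt0// ltr_nat.
case: ifPn => _; last by rewrite mule0 lee_fin mulr_ge0// mulr_ge0.
rewrite -!EFinB -EFinM lee_fin -[i.+1%:R]natr1.
by rewrite [leLHS](_ : _ = 2 * M%:R / K.+1%:R)%R//; field; rewrite addrC natr1 pnatr_eq0.
Qed.

(** Excess mass on a line would be seen by a strip around it. There are about [2 M (K + 1)] strips
    of intensity at most [2 M / (K + 1)], so by the quadratic tail bound some strip has a count
    other than 0 and 1 with probability of order [1 / K]. *)
Lemma prm_lines_box (M : nat) : {ae P, forall w, forall s : R, N w ([set q : R2 | q.1 = s] `&` box M) <= 1}.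
Proof.
pose B K i := ~` ([set w | N w (strip M K i) = 0%R%:E] `|` [set w | N w (strip M K i) = 1%R%:E]).
have mB K i : measurable (B K i).
  apply: measurableC; apply: measurableU; exact: (measurable_count PN _ (measurable_strip M K i)).
(* The additional strip takes care of the right end [s = M], whose index is [2 * M * K.+1]. *)
pose n K := (2 * M * K.+1).+1.
pose Bad K := \big[setU/set0]_(i < n K) B K i.
have mBad K : measurable (Bad K) by exact: bigsetU_measurable.
(* There are at most [(2 M + 1) (K + 1)] strips, each contributing at most [(2 M / (K + 1)) ^ 2]. *)
pose c : R := ((2 * M%:R + 1) * (2 * M%:R) ^+ 2)%R.
have PBad K : P (Bad K) <= (c / K.+1%:R)%:E.
  apply: le_trans (Boole_inequality P (fun i _ => mB K i)) _.
  apply: (@le_trans _ _ (\sum_(i < n K) ((2 * M%:R / K.+1%:R) ^+ 2)%:E)).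
    apply: lee_sum => i _; apply: prm_ge2; [exact: measurable_strip|exact: nu_strip].
  rewrite sumEFin lee_fin sumr_const card_ord /c /n -[leLHS]mulr_natr -[((2 * M * K.+1).+1)%:R%R]natr1 !natrM.
  have K0 : (0 < K.+1%:R :> R)%R by [].
  have K1 : (1 <= K.+1%:R :> R)%R by rewrite ler1n.
  have M0 : (0 <= M%:R :> R)%R by [].
  move: K0 K1 M0; move: (K.+1%:R : R) (M%:R : R) => k m k0 k1 m0.
  rewrite ler_pdivlMr// [leLHS](_ : _ = (2 * m) ^+ 2 * ((2 * m * k + 1) / k))%R; last by field; rewrite gt_eqF.
  rewrite mulrC ler_wpM2r ?sqr_ge0// ler_pdivrMr//.
  by rewrite [leRHS]mulrDl mul1r lerD2l.
exists (\bigcap_K Bad K); split.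
- exact: bigcap_measurableType.
- apply/eqP; rewrite eq_le measure_ge0 andbT; apply/lee_addgt0Pr => e e0.
  rewrite add0e.
  pose K := Num.truncn (c / e).
  apply: (@le_trans _ _ (P (Bad K))).
    apply: le_measure; rewrite ?inE//; first exact: bigcap_measurableType.
    exact: bigcap_inf.
  apply: le_trans (PBad K) _; rewrite lee_fin ler_pdivrMr// mulrC -ler_pdivrMr//.
  exact/ltW/truncnS_gt.
move=> w /= Nw; apply: contrapT => /existsNP[K]/not_implyP[_ nB].
apply: Nw => s.
have [sM|sM] := pselect (- M%:R <= s <= M%:R)%R; last first.
  rewrite (_ : _ `&` _ = set0) ?measure0//; apply/seteqP; split => // q [/= qs] [/= + _].
  by rewrite qs in_itv.
pose i := Num.truncn ((s + M%:R) * K.+1%:R)%R.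
have K0 : (0 < K.+1%:R :> R)%R by [].
have sM0 : (0 <= (s + M%:R) * K.+1%:R)%R by rewrite mulr_ge0//; lra.
have iK : (i < n K)%N.
  have := truncn_itv sM0; rewrite -/i => /andP[hi _].
  rewrite ltnS -(ler_nat R) (le_trans hi)// natrM ler_pM2r//.
  by rewrite natrM; lra.
have NS : N w (strip M K i) <= 1.
  apply: contrapT => h; apply: nB; rewrite /Bad -bigcup_mkord; exists i => // -[/= h'|/= h'].
    by apply: h; rewrite h' lee_fin.
  by apply: h; rewrite h'.
apply: le_trans NS; apply: le_measure; rewrite ?inE//.
- by apply: measurableI; [exact: (measurable_line (s, 0%R))|exact: measurable_box].
- exact: measurable_strip.
move=> q [/= qs [_ q2]]; split => //=; rewrite qs in_itv/=.
have := truncn_itv sM0; rewrite -/i => /andP[i1 i2].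
apply/andP; split.
  by rewrite addrC lerBlDr ler_pdivrMr//; move: i1; lra.
by rewrite addrC -lerBlDr ler_pdivlMr//; move: i2; lra.
Qed.

Lemma prm_lines : {ae P, forall w, forall s : R, N w [set q : R2 | q.1 = s] <= 1}.
Proof.
have := ae_foralln prm_lines_box; apply: filterS => w h s.
have mL := measurable_line (s, 0%R).
rewrite -(cvg_lim _ (cvg_measure_box (m := N w) mL))//.
apply: lime_le; first by apply/cvg_ex; exists (N w (line (s, 0%R))); exact: cvg_measure_box.
by apply: nearW => M; exact: h.
Qed.

(** An atom has mass at least 1 and its line has mass at most 1, so the line carries that atom, of
    mass exactly 1, and nothing else. The exceptional set of paths does not depend on [f] and [g],
    which may thus be sections of random functions. *)
Lemma prm_diag : {ae P, forall w, forall f g : R2 -> \bar R,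
  measurable_fun setT f -> measurable_fun setT g ->
  (forall p, 0 <= f p) -> (forall p, 0 <= g p) ->
  \int[N w]_p (f p * \int[N w]_(q in line p) g q) = \int[N w]_p (f p * g p)}.
Proof.
apply: filterS prm_lines => w h f g mf mg f0 g0.
have mp (p : R2) : measurable [set p].
  rewrite (_ : [set p] = [set p.1] `*` [set p.2]); first by apply: measurableX.
  by apply/seteqP; split => [_ ->|[x y] [/= -> ->]] //; case: p.
have mL : measurable_fun setT (fun p => \int[N w]_(q in line p) g q).
  pose K (z : R2 * R2) := g z.2.
  have mE : measurable [set z : R2 * R2 | z.2.1 = z.1.1].
    rewrite (_ : [set _ | _] = (fun z : R2 * R2 => z.2.1 - z.1.1)%R @^-1` [set 0%R]).
      rewrite -[X in measurable X]setTI; apply: measurable_funB => //.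
        by apply: measurableT_comp; [exact: measurable_fst|exact: measurable_snd].
      by apply: measurableT_comp; [exact: measurable_fst|exact: measurable_fst].
    by apply/seteqP; split => z /=; [move=> ->; rewrite subrr|move/eqP; rewrite subr_eq0 => /eqP].
  have mK : measurable_fun setT (K \_ [set z : R2 * R2 | z.2.1 = z.1.1]).
    by apply/(measurable_restrictT _ mE)/measurable_funTS; exact: measurableT_comp mg _.
  have := measurable_ge0_tonelli (locfin_sigma_finite (fN w)) mK.
  rewrite (_ : (fun p => _) = (fun p => \int[N w]_(q in line p) g q)).
    by apply => z; rewrite patchE; case: ifP => // _; exact: g0.
  apply/funext => p; rewrite [RHS]integral_mkcond; apply: eq_integral => q _; rewrite !patchE.
  by congr (if _ then _ else _); apply/idP/idP; rewrite !inE.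
apply: ge0_ae_eq_integral => //.
- exact: emeasurable_funM.
- exact: emeasurable_funM.
- by move=> p _; apply: mule_ge0 => //; exact: integral_ge0.
- by move=> p _; exact: mule_ge0.
apply: filterS (prm_atoms w) => p Np _; congr (_ * _).
have pL : [set p] `<=` line p by move=> _ ->.
have mLp := measurable_line p.
have Np1 : N w [set p] = 1.
  apply/eqP; rewrite eq_le Np andbT; apply: le_trans (h p.1).
  by apply: le_measure; rewrite ?inE//.
have NL0 : N w (line p `\` [set p]) = 0.
  have -> : N w (line p `\` [set p]) = N w (line p) - N w (line p `&` [set p]).
    by apply: measureD => //; exact: le_lt_trans (h p.1) (ltry _).
  rewrite (setIidr pL) Np1.
  have -> : N w (line p) = 1.
    apply/eqP; rewrite eq_le h -{1}Np1; apply: le_measure; rewrite ?inE//.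
  by rewrite subee.
rewrite -(setUIDK (line p) [set p]) (setIidr pL) ge0_integral_setU//; last 3 first.
- exact: measurableD.
- exact: measurable_funTS.
- by apply/disj_setPS; rewrite setDE setICA setICr setI0.
rewrite [X in _ + X]ge0_integral_null// ?adde0; last exact: measurableD.
rewrite (eq_integral (cst (g p))) => [|q]; last by rewrite inE => ->.
by rewrite integral_cst// Np1 mule1.
Qed.

End simple.

Section adde.
Context {R : realType}.
Local Open Scope ereal_scope.
Implicit Types a b c e q : \bar R.
Lemma eq_adde a b c e : a = b -> c = e -> a + c = b + e.
Proof. by move=> -> ->. Qed.
Lemma adde_shuffle a b c e q : a + b + q + (c + e) = q + (c + b + (e + a)).
Proof. by rewrite [a + b + q]addeC -addeA [a + b]addeC addeACA [b + c]addeC [a + e]addeC. Qed.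
End adde.

Section isometry.
Context {R : realType} d (Omega : measurableType d) (P : probability Omega R).
Notation R2 := (R * R)%type.
Variable N : Omega -> {measure set R2 -> \bar R}.
Hypothesis SN : simple_prm P N.
Let fN w : locfin (N w). Proof. by case: SN. Qed.
Notation PT := (PT N).
Local Open Scope ereal_scope.

Definition NI (h : Omega * R2 -> \bar R) w := \int[N w]_p h (w, p).
Definition nuI (h : Omega * R2 -> \bar R) w := \int[nu]_p h (w, p).

Variables h k : PT -> \bar R.
Hypotheses (mh : measurable_fun setT h) (h0 : forall x, 0 <= h x).
Hypotheses (mk : measurable_fun setT k) (k0 : forall x, 0 <= k x).

Let pastI (l : Omega -> {measure set R2 -> \bar R}) (g : PT -> \bar R) : PT -> \bar R :=
  past_integral l (fun _ _ => 1) g.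

Let mpastI l (g : PT -> \bar R) : adapted N l -> measurable_fun setT g ->
  (forall x, 0 <= g x) -> measurable_fun setT (pastI l g).
Proof. by move=> al mg g0; apply: (measurable_past_integral al) => //; exact: measurable_cst. Qed.

Let pastIE l (g : PT -> \bar R) w p : pastI l g (w, p) = \int[l w]_(q in before p) g (w, q).
Proof. by rewrite /pastI /past_integral; apply: eq_integral => q _; rewrite mul1e. Qed.

Let pastI0 l (g : PT -> \bar R) x : (forall x, 0 <= g x) -> 0 <= pastI l g x.
Proof. by move=> g0; apply: integral_ge0 => q _; rewrite mul1e. Qed.

Lemma measurable_NI (g : PT -> \bar R) : measurable_fun setT g -> (forall x, 0 <= g x) ->
  measurable_fun setT (NI g).
Proof. by move=> mg g0; apply: (measurable_integral_N SN) => //; exact: (measurable_PT_fun mg). Qed.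

Lemma measurable_nuI (g : PT -> \bar R) : measurable_fun setT g -> (forall x, 0 <= g x) ->
  measurable_fun setT (nuI g).
Proof. by move=> mg g0; apply: measurable_integral_nu => //; exact: (measurable_PT_fun mg). Qed.

Lemma NI_ge0 (g : PT -> \bar R) w : (forall x, 0 <= g x) -> 0 <= NI g w.
Proof. by move=> g0; exact: integral_ge0. Qed.

Lemma nuI_ge0 (g : PT -> \bar R) w : (forall x, 0 <= g x) -> 0 <= nuI g w.
Proof. by move=> g0; exact: integral_ge0. Qed.

Lemma E_NI (g : PT -> \bar R) : measurable_fun setT g -> (forall x, 0 <= g x) ->
  \int[P]_w NI g w = \int[P]_w nuI g w.
Proof. exact: (compensation SN). Qed.

(** The later of the two points has been compensated here. Expectations of products of two integrals
    are sums of such terms; they match in the isometry and leave the diagonal alone. *)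
Let cross (l : Omega -> {measure set R2 -> \bar R}) (g g' : PT -> \bar R) :=
  \int[P]_w nuI (fun x => g x * pastI l g' x) w.

Let mcross l (g g' : PT -> \bar R) : adapted N l -> measurable_fun setT g -> (forall x, 0 <= g x) ->
  measurable_fun setT g' -> (forall x, 0 <= g' x) ->
  measurable_fun setT (fun x : PT => g x * pastI l g' x).
Proof. by move=> al mg g0 mg' g'0; apply: emeasurable_funM => //; exact: mpastI. Qed.

Let cross0 l (g g' : PT -> \bar R) x : (forall x, 0 <= g x) -> (forall x, 0 <= g' x) ->
  0 <= g x * pastI l g' x.
Proof. by move=> g0 g'0; apply: mule_ge0 => //; exact: pastI0. Qed.

Let aN := adapted_N SN.
Let anu := adapted_nu N.

Lemma E_NI_nuI (f g : PT -> \bar R) : measurable_fun setT f -> (forall x, 0 <= f x) ->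
  measurable_fun setT g -> (forall x, 0 <= g x) ->
  \int[P]_w (NI f w * nuI g w) = cross (fun=> nu) f g + cross N g f.
Proof.
move=> mf f0 mg g0.
transitivity (\int[P]_w (NI (fun x => f x * pastI (fun=> nu) g x) w + nuI (fun x => g x * pastI N f x) w)).
  apply: eq_integral => w _; rewrite /NI /nuI.
  apply: (eq_trans (@ge0_mul_integrals_nu _ (N w) (fun p => f (w, p)) (fun p => g (w, p)) (fN w)
    (measurable_PT_section w mf) (measurable_PT_section w mg) (fun=> f0 _) (fun=> g0 _))).
  by apply: eq_adde; apply: eq_integral => p _; rewrite pastIE.
rewrite ge0_integralD//.
- by rewrite E_NI// => [|x]; [exact: mcross|exact: cross0].
- by move=> w _; apply: NI_ge0 => x; exact: cross0.
- by apply: measurable_NI => [|x]; [exact: mcross|exact: cross0].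
- by move=> w _; apply: nuI_ge0 => x; exact: cross0.
- by apply: measurable_nuI => [|x]; [exact: mcross|exact: cross0].
Qed.

Lemma E_nuI_nuI : \int[P]_w (nuI h w * nuI k w) = cross (fun=> nu) h k + cross (fun=> nu) k h.
Proof.
transitivity (\int[P]_w (nuI (fun x => h x * pastI (fun=> nu) k x) w + nuI (fun x => k x * pastI (fun=> nu) h x) w)).
  apply: eq_integral => w _; rewrite /nuI.
  apply: (eq_trans (@ge0_mul_integrals_nu _ nu (fun p => h (w, p)) (fun p => k (w, p)) (@locfin_nu R)
    (measurable_PT_section w mh) (measurable_PT_section w mk) (fun=> h0 _) (fun=> k0 _))).
  by apply: eq_adde; apply: eq_integral => p _; rewrite pastIE.
rewrite ge0_integralD//.
- by move=> w _; apply: nuI_ge0 => x; exact: cross0.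
- by apply: measurable_nuI => [|x]; [exact: mcross|exact: cross0].
- by move=> w _; apply: nuI_ge0 => x; exact: cross0.
- by apply: measurable_nuI => [|x]; [exact: mcross|exact: cross0].
Qed.

Lemma E_NI_NI : \int[P]_w (NI h w * NI k w) =
  cross N h k + cross N k h + \int[P]_w NI (fun x => h x * k x) w.
Proof.
have mhk : measurable_fun setT (fun x : PT => h x * k x) by exact: emeasurable_funM.
have hk0 x : 0 <= h x * k x by exact: mule_ge0.
transitivity (\int[P]_w (NI (fun x => h x * pastI N k x) w + NI (fun x => k x * pastI N h x) w +
   NI (fun x => h x * k x) w)).
  apply: ge0_ae_eq_integral => //.
  - by apply: emeasurable_funM; exact: measurable_NI.
  - apply: emeasurable_funD; last exact: measurable_NI.
    by apply: emeasurable_funD; apply: measurable_NI => [|x]; [exact: mcross|exact: cross0|exact: mcross|exact: cross0].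
  - by move=> w _; apply: mule_ge0; exact: NI_ge0.
  - by move=> w _; apply: adde_ge0; [apply: adde_ge0|]; apply: NI_ge0 => x//; exact: cross0.
  apply: filterS (prm_diag SN) => w diag _; rewrite /NI.
  have msh := measurable_PT_section w mh; have msk := measurable_PT_section w mk.
  apply: (eq_trans (@ge0_mul_integrals _ (N w) (N w) (fun p => h (w, p)) (fun p => k (w, p)) (fN w) (fN w)
    msh msk (fun=> h0 _) (fun=> k0 _))).
  apply: eq_adde.
    by apply: eq_adde; apply: eq_integral => p _; rewrite pastIE.
  exact: (diag (fun p => h (w, p)) (fun p => k (w, p)) msh msk (fun=> h0 _) (fun=> k0 _)).
rewrite ge0_integralD//.
- apply: eq_adde => //; rewrite ge0_integralD//.
  + by rewrite !E_NI// => [|x||x]; [exact: mcross|exact: cross0|exact: mcross|exact: cross0].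
  + by move=> w _; apply: NI_ge0 => x; exact: cross0.
  + by apply: measurable_NI => [|x]; [exact: mcross|exact: cross0].
  + by move=> w _; apply: NI_ge0 => x; exact: cross0.
  + by apply: measurable_NI => [|x]; [exact: mcross|exact: cross0].
- by move=> w _; apply: adde_ge0; apply: NI_ge0 => x; exact: cross0.
- by apply: emeasurable_funD; apply: measurable_NI => [|x]; [exact: mcross|exact: cross0|exact: mcross|exact: cross0].
- by move=> w _; exact: NI_ge0.
- exact: measurable_NI.
Qed.

(* The isometry [E((N-nu)(h) (N-nu)(k)) = E(nu(h k))], written without subtraction
   so that it also holds when some of the terms are infinite. *)
Lemma isometry : \int[P]_w (NI h w * NI k w) + \int[P]_w (nuI h w * nuI k w) =
  \int[P]_w NI (fun x => h x * k x) w +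
  (\int[P]_w (NI h w * nuI k w) + \int[P]_w (nuI h w * NI k w)).
Proof.
have -> : \int[P]_w (nuI h w * NI k w) = \int[P]_w (NI k w * nuI h w).
  by apply: eq_integral => w _; rewrite muleC.
rewrite E_NI_NI E_nuI_nuI !E_NI_nuI//.
exact: adde_shuffle.
Qed.

End isometry.

Section lebesgue_translation.
Context {R : realType}.
Local Open Scope ereal_scope.

Lemma integral_mes1T (f : R -> \bar R) : measurable_fun setT f -> (forall x, 0 <= f x) ->
  \int[leb]_x f x = \int[mes1]_x f x.
Proof. by move=> mf f0; exact: integral_mes1. Qed.

Lemma integral_reflect (a : R) (f : R -> \bar R) : measurable_fun setT f -> (forall x, 0 <= f x) ->
  \int[mes1]_x f (a - x)%R = \int[mes1]_x f x.
Proof.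
move=> mf f0; rewrite -!integral_mes1T//; first exact: ge0_integral_reflect.
by apply: measurableT_comp => //; exact: measurable_funB.
Qed.

Lemma integral_translate (a : R) (f : R -> \bar R) : measurable_fun setT f -> (forall x, 0 <= f x) ->
  \int[mes1]_x f (x - a)%R = \int[mes1]_x f x.
Proof.
move=> mf f0; rewrite -[RHS](integral_reflect 0)//.
rewrite -[RHS](integral_reflect a)//; last first.
  by apply: measurableT_comp => //; exact: measurable_funB.
by apply: eq_integral => x _; rewrite sub0r opprB.
Qed.
End lebesgue_translation.

(** * The renewal operator *)

Section renewal.
Context {R : realType}.
Variable Phi : R -> R.
Hypothesis mPhi : measurable_fun (`[0%R, +oo[%classic : set R) Phi.
Hypothesis Phi0 : forall x, 0 <= x -> 0 <= Phi x.
Hypothesis Phi1 : (\int[leb]_(x in (`[0%R, +oo[%classic : set R)) (Phi x)%:E < 1)%E.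
Local Open Scope ereal_scope.

(* Restriction to positive times; the values at 0 play no role for integrals, and
   the strict inequality matches the open domain [(0, t)] of [Xz]. *)
Definition pos_part (f : R -> \bar R) (x : R) : \bar R := if (0 < x)%R then f x else 0.

Lemma pos_partE f : pos_part f = f \_ `]0%R, +oo[%classic.
Proof.
by apply/funext => x; rewrite /pos_part patchE; congr (if _ then _ else _); apply/idP/idP; rewrite inE /= in_itv/= andbT.
Qed.

Definition pos_Phi := pos_part (fun x => (Phi x)%:E).
Notation phi := pos_Phi.

Lemma phi_ge0 x : 0 <= phi x.
Proof. by rewrite /phi /pos_part; case: ifPn => // x0; rewrite lee_fin Phi0// ltW. Qed.

Lemma measurable_phi : measurable_fun setT phi.
Proof.
rewrite /phi pos_partE; apply/(measurable_restrictT _ (measurable_itv _)).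
apply/measurable_EFinP; apply: measurable_funS mPhi => // x /=.
by rewrite !in_itv/= !andbT => /ltW.
Qed.

Definition rho : R := fine (\int[leb]_(x in (`[0%R, +oo[%classic : set R)) (Phi x)%:E).

Lemma rho_ge0 : (0 <= rho)%R.
Proof. by apply: fine_ge0; apply: integral_ge0 => x; rewrite /= in_itv/= andbT lee_fin => /Phi0. Qed.

Lemma integral_phi : \int[mes1]_x phi x = rho%:E.
Proof.
have P0 : 0 <= \int[leb]_(x in (`[0%R, +oo[%classic : set R)) (Phi x)%:E.
  by apply: integral_ge0 => x; rewrite /= in_itv/= andbT lee_fin => /Phi0.
rewrite /rho fineK; last by rewrite ge0_fin_numE// (lt_trans Phi1)// ltry.
rewrite -integral_itv_obnd_cbnd; last first.
  apply/measurable_EFinP; apply: measurable_funS mPhi => // x /=.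
  by rewrite !in_itv/= !andbT => /ltW.
rewrite [RHS]integral_mkcond -integral_mes1T//; last 2 first.
- exact: measurable_phi.
- exact: phi_ge0.
by apply: eq_integral => x _; rewrite /phi pos_partE.
Qed.

Lemma rho_lt1 : (rho < 1)%R.
Proof. rewrite -lte_fin /rho fineK//.
have P0 : 0 <= \int[leb]_(x in (`[0%R, +oo[%classic : set R)) (Phi x)%:E.
  by apply: integral_ge0 => x; rewrite /= in_itv/= andbT lee_fin => /Phi0.
by rewrite ge0_fin_numE// (lt_trans Phi1)// ltry.
Qed.

Definition conv (f g : R -> \bar R) (x : R) := \int[mes1]_y (f (x - y)%R * g y).

Lemma conv_ge0 f g x : (forall x, 0 <= f x) -> (forall x, 0 <= g x) -> 0 <= conv f g x.
Proof. by move=> f0 g0; apply: integral_ge0 => y _; exact: mule_ge0. Qed.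

Lemma measurable_conv_ker (f g : R -> \bar R) : measurable_fun setT f -> measurable_fun setT g ->
  measurable_fun setT (fun z : R * R => f (z.1 - z.2)%R * g z.2).
Proof.
move=> mf mg; apply: emeasurable_funM.
  by apply: measurableT_comp => //; apply: measurable_funB.
exact: measurableT_comp.
Qed.

Lemma measurable_conv (f g : R -> \bar R) : measurable_fun setT f -> measurable_fun setT g ->
  (forall x, 0 <= f x) -> (forall x, 0 <= g x) -> measurable_fun setT (conv f g).
Proof.
move=> mf mg f0 g0.
apply: (measurable_ge0_tonelli (f := fun z : R * R => f (z.1 - z.2)%R * g z.2)).
- exact: sigma_finite_mes1.
- exact: measurable_conv_ker.
- by move=> z; exact: mule_ge0.
Qed.

Lemma integral_conv (f g : R -> \bar R) : measurable_fun setT f -> measurable_fun setT g ->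
  (forall x, 0 <= f x) -> (forall x, 0 <= g x) ->
  \int[mes1]_x conv f g x = \int[mes1]_x f x * \int[mes1]_x g x.
Proof.
move=> mf mg f0 g0.
rewrite /conv (ge0_tonelli (f := fun z : R * R => f (z.1 - z.2)%R * g z.2)) => [||||z].
- rewrite -ge0_integralZl//; last exact: integral_ge0.
  apply: eq_integral => y _ /=; rewrite ge0_integralZr//.
    by rewrite integral_translate.
  by apply: measurableT_comp => //; exact: measurable_funB.
- exact: sigma_finite_mes1.
- exact: sigma_finite_mes1.
- exact: measurable_conv_ker.
- exact: mule_ge0.
Qed.

Definition cp n := pos_part (convpow Phi n).

(** Both factors vanish at nonpositive arguments, which cuts the integral over the line down to []0,
    x[]; this differs from [[0, x]] by two points only. *)
Lemma cpS n : measurable_fun setT (cp n) -> (forall x, 0 <= cp n x) ->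
      forall x, cp n.+1 x = conv phi (cp n) x.
Proof.
move=> mcp cp0 x; rewrite /cp {1}/pos_part; case: ifPn => [x0|]; last first.
  rewrite -leNgt => x0; apply/esym/integral0_eq => y _.
  rewrite /phi /pos_part; case: ifPn => [h1|]; last by rewrite mul0e.
  by case: ifPn => [h2|]; [exfalso; lra|rewrite mule0].
have mf : measurable_fun setT (fun y : R => phi (x - y)%R * cp n y).
  apply: emeasurable_funM => //; apply: measurableT_comp; first exact: measurable_phi.
  exact: measurable_funB.
have E y : y \in `]0%R, x[%classic -> (Phi (x - y))%:E * convpow Phi n y = phi (x - y)%R * cp n y.
  by rewrite inE/= in_itv/= => /andP[y0 yx]; rewrite /phi /cp /pos_part subr_gt0 yx y0.
rewrite /=; transitivity (\int[leb]_(y in `]0%R, x[%classic) (phi (x - y)%R * cp n y)).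
  rewrite integral_itv_bndoo; first by apply: eq_integral => y /E.
  apply: eq_measurable_fun (measurable_funTS mf) => y /E h; exact/esym.
rewrite integral_mkcond integral_mes1T; last 2 first.
- by apply/(measurable_restrictT _ (measurable_itv _)); exact: measurable_funTS.
- by move=> y; rewrite patchE; case: ifPn => // _; apply: mule_ge0 => //; exact: phi_ge0.
apply: eq_integral => y _; rewrite patchE; case: ifPn => //.
rewrite notin_setE/= in_itv/= => /negP; rewrite negb_and => h.
rewrite /phi /cp /pos_part subr_gt0; case: ifPn => [h1|]; last by rewrite mul0e.
by case: ifPn => [h2|]; [move: h; rewrite h1 h2|rewrite mule0].
Qed.

Lemma measurable_cp_ge0 n : measurable_fun setT (cp n) /\ forall x, 0 <= cp n x.
Proof.
elim: n => [|n [mcp cp0]]; first by split; [exact: measurable_phi|exact: phi_ge0].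
have E := cpS mcp cp0; split => [|x].
  rewrite (_ : cp n.+1 = conv phi (cp n)); last exact/funext.
  by apply: measurable_conv => //; [exact: measurable_phi|exact: phi_ge0].
by rewrite E; apply: conv_ge0 => //; exact: phi_ge0.
Qed.

Lemma measurable_cp n : measurable_fun setT (cp n). Proof. by case: (measurable_cp_ge0 n). Qed.
Lemma cp_ge0 n x : 0 <= cp n x. Proof. by case: (measurable_cp_ge0 n). Qed.

Definition pos_Psi := pos_part (Psi Phi).
Notation psi := pos_Psi.

Lemma psiE x : psi x = \sum_(0 <= n <oo) cp n x.
Proof.
rewrite /psi /cp /pos_part; case: ifPn => // _; by rewrite eseries0.
Qed.

Lemma psi_ge0 x : 0 <= psi x.
Proof. by rewrite psiE; apply: nneseries_ge0 => n _ _; exact: cp_ge0. Qed.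

Lemma measurable_psi : measurable_fun setT psi.
Proof.
rewrite (_ : psi = fun x => \sum_(0 <= n <oo) cp n x); last by apply/funext => x; exact: psiE.
by apply: ge0_emeasurable_sum => [n x _ _|n _]; [exact: cp_ge0|exact: measurable_cp].
Qed.

Lemma psi_renewal x : psi x = phi x + conv phi psi x.
Proof.
rewrite psiE nneseries_recl//; last by move=> n _; exact: cp_ge0.
congr (_ + _).
rewrite -(nneseries_addn 1%N (f := fun n => cp n x)); last by move=> n; exact: cp_ge0.
rewrite /conv; under [RHS]eq_integral do rewrite psiE.
transitivity (\int[mes1]_y (\sum_(0 <= n <oo) (phi (x - y)%R * cp n y))).
  rewrite integral_nneseries//.
  - by apply: eq_eseriesr => n _; rewrite addn1 (cpS (measurable_cp n) (cp_ge0 n)).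
  - move=> n; apply: emeasurable_funM; last exact: measurable_cp.
    by apply: measurableT_comp; [exact: measurable_phi|exact: measurable_funB].
  - by move=> n y _; apply: mule_ge0; [exact: phi_ge0|exact: cp_ge0].
apply: eq_integral => y _.
have : phi (x - y)%R \is a fin_num by rewrite /phi /pos_part; case: ifP.
move=> /fineK <-; rewrite nneseriesZl// => n _; exact: cp_ge0.
Qed.

Lemma integral_psi_lty : \int[mes1]_x psi x < +oo.
Proof.
have i0 : \int[mes1]_x psi x = \sum_(0 <= n <oo) \int[mes1]_x cp n x.
  under eq_integral do rewrite psiE.
  rewrite integral_nneseries//; [by move=> n; exact: measurable_cp|by move=> n x _; exact: cp_ge0].
have iS n : \int[mes1]_x cp n.+1 x = rho%:E * \int[mes1]_x cp n x.
  rewrite -integral_phi -(integral_conv measurable_phi (measurable_cp n) phi_ge0 (cp_ge0 n)).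
  by apply: eq_integral => x _; exact: (cpS (measurable_cp n) (cp_ge0 n)).
have r0 := rho_ge0; have r1 := rho_lt1.
have iE n : \int[mes1]_x cp n x = (rho ^+ n.+1)%:E.
  elim: n => [|n ih]; first exact: integral_phi.
  by rewrite iS ih -EFinM -exprS.
rewrite i0; apply: (@le_lt_trans _ _ (rho / (1 - rho))%:E); last exact: ltry.
apply: lime_le.
  by apply: is_cvg_nneseries => n _ _; apply: integral_ge0 => x _; exact: cp_ge0.
apply: nearW => n; under eq_bigr do rewrite iE.
rewrite sumEFin lee_fin ler_pdivlMr ?subr_gt0//.
suff -> : ((\sum_(0 <= i < n) rho ^+ i.+1) * (1 - rho) = rho - rho ^+ n.+1)%R.
  by rewrite gerBl exprn_ge0.
elim: n => [|n ih]; first by rewrite big_nil mul0r expr1 subrr.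
by rewrite big_nat_recr//= mulrDl ih !exprS; ring.
Qed.

(** Adjoint to the convolution with [Phi]: an accepted point at time [s] contributes to the
    intensity at the later times [t], where [f] is read. *)
Definition Pop (f : R -> \bar R) (s : R) := \int[mes1]_t (phi (t - s)%R * f t).
Definition Rop (f : R -> \bar R) (s : R) := f s + \int[mes1]_t (psi (t - s)%R * f t).

Section op.
Variable f : R -> \bar R.
Hypotheses (mf : measurable_fun setT f) (f0 : forall x, 0 <= f x).

Let mK (g : R -> \bar R) : measurable_fun setT g ->
  measurable_fun setT (fun z : R * R => g (z.2 - z.1)%R * f z.2).
Proof.
move=> mg; apply: emeasurable_funM.
  by apply: measurableT_comp => //; apply: measurable_funB.
exact: measurableT_comp.
Qed.

Lemma measurable_Pop : measurable_fun setT (Pop f).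
Proof.
apply: (measurable_ge0_tonelli (f := fun z : R * R => phi (z.2 - z.1)%R * f z.2)).
- exact: sigma_finite_mes1.
- exact: mK measurable_phi.
- by move=> z; apply: mule_ge0 => //; exact: phi_ge0.
Qed.

Lemma Pop_ge0 s : 0 <= Pop f s.
Proof. by apply: integral_ge0 => t _; apply: mule_ge0 => //; exact: phi_ge0. Qed.

Let mPs : measurable_fun setT (fun s : R => \int[mes1]_t (psi (t - s)%R * f t)).
Proof.
apply: (measurable_ge0_tonelli (f := fun z : R * R => psi (z.2 - z.1)%R * f z.2)).
- exact: sigma_finite_mes1.
- exact: mK measurable_psi.
- by move=> z; apply: mule_ge0 => //; exact: psi_ge0.
Qed.

Let Ps0 s : 0 <= \int[mes1]_t (psi (t - s)%R * f t).
Proof. by apply: integral_ge0 => t _; apply: mule_ge0 => //; exact: psi_ge0. Qed.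

Lemma measurable_Rop : measurable_fun setT (Rop f).
Proof. exact: emeasurable_funD. Qed.

Lemma Rop_ge0 s : 0 <= Rop f s.
Proof. exact: adde_ge0. Qed.

(** This is the renewal equation [psi = phi + phi * psi] integrated against [f], with Tonelli for
    the double integral. *)
Lemma Rop_fixpoint s : Rop f s = f s + Pop (Rop f) s.
Proof.
rewrite {1}/Rop; congr (_ + _).
have msub (g : R -> \bar R) (a : R) : measurable_fun setT g -> measurable_fun setT (fun t : R => g (t - a)%R).
  by move=> mg; apply: measurableT_comp => //; exact: measurable_funB.
have msubr (g : R -> \bar R) (a : R) : measurable_fun setT g -> measurable_fun setT (fun t : R => g (a - t)%R).
  by move=> mg; apply: measurableT_comp => //; exact: measurable_funB.
have mc : measurable_fun setT (conv phi psi).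
  by apply: measurable_conv; [exact: measurable_phi|exact: measurable_psi|exact: phi_ge0|exact: psi_ge0].
have c0 x : 0 <= conv phi psi x by apply: conv_ge0; [exact: phi_ge0|exact: psi_ge0].
transitivity (\int[mes1]_t (phi (t - s)%R * f t + conv phi psi (t - s)%R * f t)).
  apply: eq_integral => t _; rewrite psi_renewal; apply: ge0_muleDl => //; exact: phi_ge0.
rewrite ge0_integralD//; last 4 first.
- by move=> t _; apply: mule_ge0 => //; exact: phi_ge0.
- by apply: emeasurable_funM => //; apply: msub; exact: measurable_phi.
- by move=> t _; exact: mule_ge0.
- by apply: emeasurable_funM => //; exact: msub.
transitivity (\int[mes1]_t (phi (t - s)%R * f t + phi (t - s)%R * \int[mes1]_u (psi (u - t)%R * f u))); last first.
  by apply: eq_integral => t _; apply/esym/ge0_muleDr.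
rewrite [RHS]ge0_integralD//; last 4 first.
- by move=> t _; apply: mule_ge0 => //; exact: phi_ge0.
- by apply: emeasurable_funM => //; apply: msub; exact: measurable_phi.
- by move=> t _; apply: mule_ge0 => //; exact: phi_ge0.
- by apply: emeasurable_funM => //; apply: msub; exact: measurable_phi.
congr (_ + _).
pose K (z : R * R) := phi (z.1 - s)%R * (psi (z.2 - z.1)%R * f z.2).
have mK' : measurable_fun setT K.
  apply: emeasurable_funM; last exact: mK measurable_psi.
  apply: measurableT_comp; first exact: measurable_phi.
  by apply: measurable_funB.
have K0 z : 0 <= K z.
  by apply: mule_ge0; [exact: phi_ge0|apply: mule_ge0 => //; exact: psi_ge0].
transitivity (\int[mes1]_t \int[mes1]_u K (t, u)); last first.
  apply: eq_integral => t _; rewrite -ge0_integralZl//.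
  - by apply: emeasurable_funM => //; apply: msub; exact: measurable_psi.
  - by move=> u _; apply: mule_ge0 => //; exact: psi_ge0.
  - exact: phi_ge0.
rewrite (ge0_tonelli sigma_finite_mes1 sigma_finite_mes1 mK' K0).
apply: eq_integral => u _.
have -> : conv phi psi (u - s)%R = \int[mes1]_t (phi (t - s)%R * psi (u - t)%R).
  have mk : measurable_fun setT (fun y : R => phi (u - s - y)%R * psi y).
    by apply: emeasurable_funM; [apply: msubr; exact: measurable_phi|exact: measurable_psi].
  have k0 y : 0 <= phi (u - s - y)%R * psi y by apply: mule_ge0; [exact: phi_ge0|exact: psi_ge0].
  rewrite /conv -(integral_reflect u mk k0).
  by apply: eq_integral => t _; congr (phi _ * psi _); ring.
rewrite -ge0_integralZr//.
- by apply: eq_integral => t _; rewrite /K/= muleA.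
- by apply: emeasurable_funM; [apply: msub; exact: measurable_phi|apply: msubr; exact: measurable_psi].
- by move=> t _; apply: mule_ge0; [exact: phi_ge0|exact: psi_ge0].
Qed.

(** Only times after [s] enter [Rop f s], so the support stays up to [T]; the bound is [c] times one
    plus the integral of [psi], finite because [rho < 1]. *)
Lemma Rop_bounded (c T : R) : (0 <= c)%R -> (forall t, f t <= c%:E) -> (forall t, (T < t)%R -> f t = 0) ->
  exists2 c' : R, (0 <= c')%R & (forall t, Rop f t <= c'%:E) /\ (forall t, (T < t)%R -> Rop f t = 0).
Proof.
move=> c0 fc fT.
have S0 : 0 <= \int[mes1]_x psi x by apply: integral_ge0 => x _; exact: psi_ge0.
have Sfin : \int[mes1]_x psi x \is a fin_num by rewrite ge0_fin_numE// integral_psi_lty.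
exists (c + fine (\int[mes1]_x psi x) * c)%R.
  by rewrite addr_ge0// mulr_ge0// fine_ge0.
split => [s|s Ts].
  rewrite EFinD EFinM fineK//; apply: leeD => //.
  rewrite -(integral_translate s measurable_psi psi_ge0).
  rewrite -ge0_integralZr//.
  - apply: ge0_le_integral => //.
    + by move=> t _; apply: mule_ge0 => //; exact: psi_ge0.
    + apply: emeasurable_funM => //; apply: measurableT_comp; first exact: measurable_psi.
      exact: measurable_funB.
    + apply: emeasurable_funM => //; apply: measurableT_comp; first exact: measurable_psi.
      exact: measurable_funB.
    + by move=> t _; apply: lee_wpmul2l => //; exact: psi_ge0.
  - by apply: measurableT_comp; [exact: measurable_psi|exact: measurable_funB].
  - by move=> t _; exact: psi_ge0.
rewrite /Rop fT// add0e; apply: integral0_eq => t _.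
have [ts|st] := leP t s; last by rewrite (fT t) ?mule0// (lt_trans Ts).
by rewrite /psi /pos_part ifF ?mul0e//; apply/negbTE; rewrite -leNgt subr_le0.
Qed.
End op.

(** The renewal equation at [s - v], after a translation; hence the factors [Psi (s - v)] in the
    formulas for [X^Phi]. *)
Lemma Rop_phi (s v : R) : Rop (fun u => phi (s - u)%R) v = psi (s - v)%R.
Proof.
rewrite psi_renewal /Rop; congr (_ + _); rewrite /conv.
have mk : measurable_fun setT (fun y : R => phi (s - v - y)%R * psi y).
  apply: emeasurable_funM; last exact: measurable_psi.
  by apply: measurableT_comp; [exact: measurable_phi|exact: measurable_funB].
have k0 y : 0 <= phi (s - v - y)%R * psi y by apply: mule_ge0; [exact: phi_ge0|exact: psi_ge0].
rewrite -(integral_translate v mk k0).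
by apply: eq_integral => t _; rewrite muleC; congr (phi _ * _); ring.
Qed.

Lemma Rop_cvg (f_ : (R -> \bar R)^nat) (f : R -> \bar R) :
  (forall n, measurable_fun setT (f_ n)) -> (forall n x, 0 <= f_ n x) ->
  (forall x, nondecreasing_seq (f_ ^~ x)) -> (forall x, f_ n x @[n --> \oo] --> f x) ->
  forall s, nondecreasing_seq (fun n => Rop (f_ n) s) /\ Rop (f_ n) s @[n --> \oo] --> Rop f s.
Proof.
move=> mf f0 nd cv s.
have mpsi : measurable_fun setT (fun t : R => psi (t - s)%R).
  by apply: measurableT_comp; [exact: measurable_psi|exact: measurable_funB].
have f0' t : 0 <= f t.
  rewrite -(cvg_lim _ (cv t))//; apply: lime_ge; first by apply/cvg_ex; exists (f t).
  exact: nearW.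
have ndp t : nondecreasing_seq (fun n => psi (t - s)%R * f_ n t).
  by move=> m n mn; apply: lee_wpmul2l; [exact: psi_ge0|exact: nd].
split.
  move=> m n mn; apply: leeD; first exact: nd.
  apply: ge0_le_integral => //.
  - by move=> t _; apply: mule_ge0 => //; exact: psi_ge0.
  - exact: emeasurable_funM.
  - exact: emeasurable_funM.
  - by move=> t _; exact: ndp.
apply: cvgeD.
- by apply: ge0_adde_def; rewrite inE//; apply: integral_ge0 => t _; apply: mule_ge0 => //; exact: psi_ge0.
- exact: cv.
rewrite (_ : \int[mes1]_t _ = \int[mes1]_t limn (fun n => psi (t - s)%R * f_ n t)).
  apply: cvg_monotone_convergence => //.
  - by move=> n; exact: emeasurable_funM.
  - by move=> n t _; apply: mule_ge0 => //; exact: psi_ge0.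
apply: eq_integral => t _; apply/esym/cvg_lim => //.
have [p0|pN] := eqVneq (psi (t - s)%R * f t) 0; last first.
  by apply: cvgeM => //; [exact: neq0_mule_def|exact: cvg_cst].
apply: ge0_cvge_nondecreasing_mul => //.
- by move=> n; exact: psi_ge0.
- exact: cvg_cst.
Qed.

End renewal.

Section mct.
Context d (T : measurableType d) (R : realType) (m : {measure set T -> \bar R}).
Local Open Scope ereal_scope.

Lemma ge0_integral_cvg (f_ : (T -> \bar R)^nat) (f : T -> \bar R) :
  (forall n, measurable_fun setT (f_ n)) -> (forall n x, 0 <= f_ n x) ->
  (forall x, nondecreasing_seq (f_ ^~ x)) -> (forall x, f_ n x @[n --> \oo] --> f x) ->
  \int[m]_x f_ n x @[n --> \oo] --> \int[m]_x f x.
Proof.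
move=> mf f0 nd cv.
rewrite (_ : \int[m]_x f x = \int[m]_x limn (f_ ^~ x)).
  by apply: cvg_monotone_convergence => // x _; exact: nd.
by apply: eq_integral => x _; apply/esym/cvg_lim => //; exact: cv.
Qed.

Lemma ge0_le_integralT (f g : T -> \bar R) : measurable_fun setT f -> measurable_fun setT g ->
  (forall x, 0 <= f x) -> (forall x, f x <= g x) -> \int[m]_x f x <= \int[m]_x g x.
Proof. by move=> mf mg f0 fg; apply: ge0_le_integral. Qed.
End mct.

(** * The minimal solution *)

Section thinning.
Context {R : realType} d (Omega : measurableType d) (P : probability Omega R).
Notation R2 := (R * R)%type.
Variable N : Omega -> {measure set R2 -> \bar R}.
Hypothesis SN : simple_prm P N.
Notation PT := (PT N).
Local Open Scope ereal_scope.

(* The points of [N] kept when thinning with intensity [l]; the inequality is strict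
   so that [acc] is continuous along increasing sequences of intensities. *)
Definition acc (l : Omega -> R -> \bar R) (x : Omega * R2) : \bar R :=
  if [&& (0 < x.2.1)%R, (0 <= x.2.2)%R & x.2.2%:E < l x.1 x.2.1] then 1 else 0.

Lemma acc_ge0 l x : 0 <= acc l x. Proof. by rewrite /acc; case: ifPn. Qed.

Lemma le_acc l l' x : (forall w t, l w t <= l' w t) -> acc l x <= acc l' x.
Proof.
move=> ll'; rewrite /acc; case: ifPn => [/and3P[a b c]|_]; last by case: ifPn.
by rewrite a b (lt_le_trans c).
Qed.

Lemma acc_idem l x : acc l x * acc l x = acc l x.
Proof. by rewrite /acc; case: ifPn; rewrite ?mule1 ?mule0. Qed.

Definition pred_int (l : Omega -> R -> \bar R) :=
  measurable_fun setT (fun x : PT => l x.1 x.2.1) /\ forall w t, 0 <= l w t.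

Lemma measurable_PT_time : measurable_fun setT (fun x : PT => x.2.1).
Proof. by apply: measurableT_comp; [exact: measurable_fst|exact: measurable_PT_snd]. Qed.

Lemma measurable_PT_mark : measurable_fun setT (fun x : PT => x.2.2).
Proof. by apply: measurableT_comp; [exact: measurable_snd|exact: measurable_PT_snd]. Qed.

Lemma measurable_acc l : pred_int l -> measurable_fun setT (acc l : PT -> \bar R).
Proof.
move=> [ml l0].
apply: measurable_fun_ifT; [|exact: measurable_cst|exact: measurable_cst].
apply: measurable_and; first by apply: measurable_fun_ltr; [exact: measurable_cst|exact: measurable_PT_time].
apply: measurable_and; first by apply: measurable_fun_ler; [exact: measurable_cst|exact: measurable_PT_mark].
by apply: measurable_fun_lte => //; apply/measurable_EFinP; exact: measurable_PT_mark.
Qed.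

Lemma measurable_time_fun (f : R -> \bar R) : measurable_fun setT f ->
  measurable_fun setT (fun x : PT => f x.2.1).
Proof. by move=> mf; apply: measurableT_comp => //; exact: measurable_PT_time. Qed.

Lemma pred_int_section l w : pred_int l -> measurable_fun setT (l w).
Proof.
move=> [ml l0]; have := measurable_PT_section w ml => /= mlw.
by apply: (@measurableT_comp _ _ _ _ _ _ (fun p : R2 => l w p.1) setT (fun s : R => (s, 0%R : R))).
Qed.

Definition thin l (f : R -> \bar R) (x : Omega * R2) : \bar R := f x.2.1 * acc l x.

Lemma measurable_thin l f : pred_int l -> measurable_fun setT f ->
  measurable_fun setT (thin l f : PT -> \bar R).
Proof. by move=> pl mf; apply: emeasurable_funM; [exact: measurable_time_fun|exact: measurable_acc]. Qed.

Lemma thin_ge0 l f x : (forall s, 0 <= f s) -> 0 <= thin l f x.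
Proof. by move=> f0; apply: mule_ge0 => //; exact: acc_ge0. Qed.

(** The marks below [l w s] fill an interval of length [l w s], also when this is infinite. *)
Lemma nuI_thin l f w : pred_int l -> measurable_fun setT f -> (forall s, 0 <= f s) ->
  nuI (thin l f) w = \int[mes1]_s (pos_part f s * l w s).
Proof.
move=> pl mf f0; have l0 := pl.2; have mlw := pred_int_section w pl.
rewrite /nuI integral_nu; last 2 first.
- exact: measurable_PT_section w (measurable_thin pl mf).
- by move=> p; exact: thin_ge0.
rewrite integral_mkcond; apply: eq_integral => s _; rewrite patchE.
case: ifPn => [|]; last first.
  rewrite notin_setE/= in_itv/= andbT => /negP; rewrite -ltNge => s0.
  by rewrite /pos_part ifF ?mul0e// ltNge ltW.
rewrite inE/= in_itv/= andbT le_eqVlt => /predU1P[<-|s0].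
  rewrite /pos_part ltxx mul0e; apply: integral0_eq => x _.
  by rewrite /thin /acc /= ltxx/= mule0.
rewrite /pos_part s0.
pose A : set R := [set x : R | (0 <= x)%R /\ x%:E < l w s].
have mA : measurable A.
  have -> : A = `[0%R, +oo[%classic `&` [set x | x%:E < l w s].
    by apply/seteqP; split => x /=; rewrite in_itv/= andbT.
  apply: measurableI => //; rewrite -[X in measurable X]setTI.
  by apply: (measurable_fun_lte _ _ measurableT (Y := [set true])) => //; exact: measurable_cst.
transitivity (\int[mes1]_(x in `[0%R, +oo[) (f s * (\1_A x)%:E)).
  apply: eq_integral => x _; rewrite /thin /acc /= s0/=; congr (_ * _); rewrite indicE.
  case: ifPn => [/andP[h1 h2]|h]; first by rewrite mem_set.
  by rewrite memNset// => -[h1 h2]; move: h; rewrite h1 h2.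
have mI : measurable_fun (`[0%R, +oo[%classic : set R) (fun x : R => (\1_A x : R)%:E).
  by apply/measurable_EFinP; exact: measurable_funTS.
rewrite ge0_integralZl => [|//|//|x _|//]; last by rewrite lee_fin.
congr (_ * _); rewrite integral_indic//.
rewrite (_ : _ `&` _ = A); last first.
  by apply/seteqP; split => [x [] //|x [h1 h2]]; split => //=; rewrite in_itv/= andbT.
rewrite /mes1 /= {mA mI}/A; have := l0 w s; case: (l w s) => [r|_|//].
  rewrite lee_fin => r0.
  rewrite (_ : [set x | _] = `[0%R, r[%classic).
    transitivity (@lebesgue_measure R `[0%R, r[%classic); first by [].
    by rewrite lebesgue_measure_itv/= lte_fin; case: ifPn => [_|]; [rewrite oppr0 addr0|rewrite -leNgt => ?; congr (_%:E); lra].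
  apply/seteqP; split => x /=; rewrite in_itv/= lte_fin; first by move=> [? ?]; apply/andP.
  by move=> /andP.
rewrite (_ : [set x | _] = `[0%R, +oo[%classic).
  transitivity (@lebesgue_measure R `[0%R, +oo[%classic); first by [].
  by rewrite lebesgue_measure_itv/= ltry.
apply/seteqP; split => x /=; rewrite in_itv/= andbT; first by move=> [].
by move=> x0; split => //; exact: ltry.
Qed.

Lemma NI_thin_le l l' f w : pred_int l -> pred_int l' -> measurable_fun setT f -> (forall s, 0 <= f s) ->
  (forall w t, l w t <= l' w t) -> NI N (thin l f) w <= NI N (thin l' f) w.
Proof.
move=> pl pl' mf f0 ll'; apply: ge0_le_integralT.
- exact: measurable_PT_section w (measurable_thin pl mf).
- exact: measurable_PT_section w (measurable_thin pl' mf).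
- by move=> p; exact: thin_ge0.
- by move=> p; apply: lee_wpmul2l => //; exact: le_acc.
Qed.

End thinning.

(** * Picard iteration with truncated intensities *)

Section picard.
Context {R : realType} d (Omega : measurableType d) (P : probability Omega R).
Notation R2 := (R * R)%type.
Variable N : Omega -> {measure set R2 -> \bar R}.
Hypothesis SN : simple_prm P N.
Let fN w : locfin (N w). Proof. by case: SN. Qed.
Notation PT := (PT N).
Variable Phi : R -> R.
Hypothesis mPhi : measurable_fun (`[0%R, +oo[%classic : set R) Phi.
Hypothesis Phi0 : forall x, 0 <= x -> 0 <= Phi x.
Variable mu : R.
Hypothesis mu0 : 0 < mu.
Local Open Scope ereal_scope.
Notation phi := (pos_Phi Phi).
Notation Pop := (Pop Phi).
Notation H l f := (NI N (thin l f)).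
Notation L l f := (nuI (thin l f)).

Let mphi := measurable_phi mPhi.
Let phi0 := phi_ge0 Phi0.
Let mphis s : measurable_fun setT (fun r : R => phi (s - r)%R).
Proof. by apply: measurableT_comp; [exact: mphi|exact: measurable_funB]. Qed.

(** By Tonelli, the time at which the intensity is read is integrated out before the sum over the
    accepted points; this moves [Phi] from the intensity to the test function. *)
Lemma integral_intensity l f w : pred_int N l -> measurable_fun setT f -> (forall s, 0 <= f s) ->
  \int[mes1]_s (pos_part f s * (mu%:E + H l (fun r => phi (s - r)%R) w)) =
  mu%:E * \int[mes1]_s pos_part f s + H l (Pop f) w.
Proof.
move=> pl mf f0.
have mp : measurable_fun setT (pos_part f).
  by rewrite pos_partE; apply/(measurable_restrictT _ (measurable_itv _)); exact: measurable_funTS.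
have p0 s : 0 <= pos_part f s by rewrite /pos_part; case: ifPn.
have ma : measurable_fun setT (fun q => acc l (w, q)).
  exact: measurable_PT_section w (measurable_acc pl).
pose K (z : R * R2) : \bar R := pos_part f z.1 * (phi (z.1 - z.2.1)%R * acc l (w, z.2)).
have mK : measurable_fun setT K.
  apply: emeasurable_funM; first exact: measurableT_comp.
  apply: emeasurable_funM; last exact: measurableT_comp ma measurable_snd.
  apply: measurableT_comp; first exact: mphi.
  apply: measurable_funB; first exact: measurable_fst.
  by apply: measurableT_comp; [exact: measurable_fst|exact: measurable_snd].
have K0 z : 0 <= K z.
  by apply: mule_ge0 => //; apply: mule_ge0; [exact: phi0|exact: acc_ge0].
have mKs s : measurable_fun setT (fun q : R2 => phi (s - q.1)%R * acc l (w, q)).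
  apply: emeasurable_funM => //; apply: measurableT_comp; first exact: mphi.
  by apply: measurable_funB => //; exact: measurable_cst.
have Ks0 s (q : R2) : 0 <= phi (s - q.1)%R * acc l (w, q).
  by apply: mule_ge0; [exact: phi0|exact: acc_ge0].
transitivity (\int[mes1]_s (mu%:E * pos_part f s + \int[N w]_q K (s, q))).
  apply: eq_integral => s _; rewrite ge0_muleDr//; last 2 first.
  - by rewrite lee_fin ltW.
  - by apply: integral_ge0 => q _; exact: Ks0.
  apply: eq_adde; first by rewrite muleC.
  by rewrite /NI /thin/= -ge0_integralZl.
have mI : measurable_fun setT (fun s : R => \int[N w]_q K (s, q)).
  exact: (measurable_ge0_tonelli (locfin_sigma_finite (fN w)) mK K0).
have mm : measurable_fun setT (fun s : R => mu%:E * pos_part f s) by exact: emeasurable_funM.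
transitivity (\int[mes1]_s (mu%:E * pos_part f s) + \int[mes1]_s \int[N w]_q K (s, q)).
  apply: ge0_integralD => //.
  - by move=> s _; apply: mule_ge0 => //; rewrite lee_fin ltW.
  - by move=> s _; exact: integral_ge0.
apply: eq_adde.
  by apply: ge0_integralZl => //; rewrite lee_fin ltW.
rewrite (ge0_tonelli sigma_finite_mes1 (locfin_sigma_finite (fN w)) mK K0).
apply: eq_integral => q _; rewrite /thin /K /=.
have mk1 : measurable_fun setT (fun t : R => phi (t - q.1)%R).
  by apply: measurableT_comp; [exact: mphi|exact: measurable_funB].
transitivity (\int[mes1]_s (pos_part f s * phi (s - q.1)%R * acc l (w, q))).
  by apply: eq_integral => s _; rewrite muleA.
rewrite ge0_integralZr//; last 3 first.
- exact: emeasurable_funM.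
- by move=> s _; apply: mule_ge0 => //; exact: phi0.
- exact: acc_ge0.
rewrite /acc /=; case: ifPn => [/and3P[q0 _ _]|_]; last by rewrite !mule0.
rewrite !mule1; apply: eq_integral => s _.
rewrite /pos_Phi /pos_part; have [qs|sq] := ltP 0%R (s - q.1)%R; last by rewrite mul0e mule0.
(* An accepted point has positive time, so any time [s] after it is positive and the restriction in
   [pos_part f] has no effect. *)
have -> : (0 < s)%R by rewrite (lt_trans q0)// -subr_gt0.
by rewrite muleC.
Qed.

(* The truncation at [n] confines the accepted points up to a given time to a box,
   so that all moments in the induction are finite. *)
Fixpoint lamn n : Omega -> R -> \bar R :=
  if n is n'.+1 then fun w t => mine n%:R%:E (mu%:E + H (lamn n') (fun r => phi (t - r)%R) w)
  else fun _ _ => 0.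

(** Since [phi] vanishes at nonpositive arguments, the integral over all points only sees the strict
    past. *)
Lemma predictable_past l : pred_int N l ->
  measurable_fun setT (fun x : PT => H l (fun r => phi (x.2.1 - r)%R) x.1).
Proof.
move=> pl.
rewrite (_ : (fun x => _) = past_integral N (fun t s => phi (t - s)%R) (acc l) :> (PT -> \bar R)).
  apply: (measurable_past_integral (adapted_N SN)).
  - apply: measurableT_comp; first exact: mphi.
    exact: measurable_funB.
  - by move=> s t; exact: phi0.
  - exact: measurable_acc.
  - by move=> x; exact: acc_ge0.
apply/funext => -[w [t x]]; rewrite /past_integral [RHS]integral_mkcond /NI /=.
apply: eq_integral => q _; rewrite patchE /thin/=; case: ifPn => //.
rewrite notin_setE /before /= => /negP; rewrite -leNgt => h.
by rewrite /pos_Phi /pos_part subr_gt0 ltNge h mul0e.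
Qed.

Lemma predictable_intensity l : pred_int N l ->
  pred_int N (fun w t => mu%:E + H l (fun r => phi (t - r)%R) w).
Proof.
move=> pl; split => [|w t].
  by apply: emeasurable_funD; [exact: measurable_cst|exact: predictable_past].
apply: adde_ge0; first by rewrite lee_fin ltW.
by apply: integral_ge0 => q _; apply: thin_ge0 => s; exact: phi0.
Qed.

Lemma pred_lamn n : pred_int N (lamn n).
Proof.
elim: n => [|n ih]; first by split => //=; exact: measurable_cst.
have [ml l0] := predictable_intensity ih; split => [|w t] /=.
  by apply: measurable_mine => //; exact: measurable_cst.
by rewrite le_min l0 lee_fin ler0n.
Qed.

Lemma lamn_le n w t : lamn n w t <= n%:R%:E.
Proof. by case: n => [|n] //=; rewrite ge_min lexx. Qed.

Lemma lamnS_le n w t : lamn n.+1 w t <= mu%:E + H (lamn n) (fun r => phi (t - r)%R) w.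
Proof. by rewrite /= ge_min lexx orbT. Qed.

Lemma le_lamnS n w t : lamn n w t <= lamn n.+1 w t.
Proof.
elim: n w t => [|n ih] w t; first exact: (pred_lamn 1).2.
rewrite [leLHS]/= [leRHS]/= le_min; apply/andP; split.
  by rewrite ge_min lee_fin ler_nat leqnSn.
rewrite ge_min; apply/orP; right; apply: leeD => //.
apply: (NI_thin_le w (pred_lamn n) (pred_lamn n.+1)) => //.
Qed.

Lemma nondecreasing_lamn w t : nondecreasing_seq (fun n => lamn n w t).
Proof. by apply/nondecreasing_seqP => n; exact: le_lamnS. Qed.

Definition lamoo w t := limn (fun n => lamn n w t).

Lemma cvg_lamn w t : lamn n w t @[n --> \oo] --> lamoo w t.
Proof. exact: (ereal_nondecreasing_is_cvgn (@nondecreasing_lamn w t)). Qed.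

Lemma lamn_lamoo n w t : lamn n w t <= lamoo w t.
Proof.
apply: lime_ge; first by apply/cvg_ex; exists (lamoo w t); exact: cvg_lamn.
by exists n => // m /= nm; exact: nondecreasing_lamn.
Qed.

Lemma pred_lamoo : pred_int N lamoo.
Proof.
split => [|w t]; last by apply: le_trans (lamn_lamoo 0 w t).
apply: (@emeasurable_fun_cvg _ _ _ _ (fun n (x : PT) => lamn n x.1 x.2.1)).
  by move=> n; exact: (pred_lamn n).1.
by move=> x _; exact: cvg_lamn.
Qed.

Lemma nondecreasing_acc_lamn x : nondecreasing_seq (fun n => acc (lamn n) x).
Proof. by move=> m n mn; apply: le_acc => w t; exact: nondecreasing_lamn. Qed.

Lemma cvg_acc_lamn x : acc (lamn n) x @[n --> \oo] --> acc lamoo x.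
Proof.
rewrite {2}/acc; case: ifPn => [/and3P[a b c]|h].
  have [n hn] : exists n, x.2.2%:E < lamn n x.1 x.2.1.
    apply/not_existsP => h; have := c; apply/negP; rewrite -leNgt.
    apply: lime_le; first by apply/cvg_ex; exists (lamoo x.1 x.2.1); exact: cvg_lamn.
    by apply: nearW => n; rewrite leNgt; apply/negP/h.
  apply: cvg_near_cst; exists n => // m /= nm.
  by rewrite /acc a b (lt_le_trans hn)//; exact: nondecreasing_lamn.
apply: cvg_near_cst; apply: nearW => n; apply/eqP; rewrite eq_le acc_ge0 andbT.
apply: (le_trans (le_acc (l' := lamoo) x _)); first by move=> w t; exact: lamn_lamoo.
by rewrite /acc (negbTE h).
Qed.

Lemma cvg_thin_lamn f x : 0 <= f x.2.1 -> thin (lamn n) f x @[n --> \oo] --> thin lamoo f x.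
Proof.
move=> f0; apply: ge0_cvge_nondecreasing_mul => //.
- exact: nondecreasing_acc_lamn.
- by move=> n; exact: acc_ge0.
- exact: cvg_cst.
- exact: cvg_acc_lamn.
Qed.

Lemma nondecreasing_thin_lamn f x : 0 <= f x.2.1 -> nondecreasing_seq (fun n => thin (lamn n) f x).
Proof. by move=> f0 m n mn; apply: lee_wpmul2l => //; exact: nondecreasing_acc_lamn. Qed.

Lemma nondecreasing_H f w : measurable_fun setT f -> (forall s, 0 <= f s) ->
  nondecreasing_seq (fun n => H (lamn n) f w).
Proof.
move=> mf f0 m n mn; apply: (NI_thin_le w (pred_lamn m) (pred_lamn n) mf f0) => w' t.
exact: nondecreasing_lamn.
Qed.

Lemma cvg_H f w : measurable_fun setT f -> (forall s, 0 <= f s) ->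
  H (lamn n) f w @[n --> \oo] --> H lamoo f w.
Proof.
move=> mf f0; apply: ge0_integral_cvg.
- by move=> n; exact: measurable_PT_section w (measurable_thin (pred_lamn n) mf).
- by move=> n p; exact: thin_ge0.
- by move=> p; exact: nondecreasing_thin_lamn.
- by move=> p; exact: cvg_thin_lamn.
Qed.

Lemma lamoo_eq w t : lamoo w t = mu%:E + H lamoo (fun r => phi (t - r)%R) w.
Proof.
have ps0 (s : R) : 0 <= phi (t - s)%R by exact: phi0.
have cH := @cvg_H _ w (mphis t) ps0; have ndH := @nondecreasing_H _ w (mphis t) ps0.
have mu_fin : mu%:E \is a fin_num by [].
have c : mu%:E + H (lamn n) (fun r => phi (t - r)%R) w @[n --> \oo] -->
    mu%:E + H lamoo (fun r => phi (t - r)%R) w.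
  by apply: cvgeD => //; exact: cvg_cst.
apply/eqP; rewrite eq_le; apply/andP; split.
  rewrite -[leLHS](cvg_lim _ (@cvg_lamn w t))//; apply: lime_le.
    by apply/cvg_ex; exists (lamoo w t); exact: cvg_lamn.
  apply: nearW => -[|n].
    by apply: adde_ge0; [rewrite lee_fin ltW|apply: NI_ge0 => x; exact: thin_ge0].
  apply: le_trans (lamnS_le n w t) _; apply: leeD => //.
  rewrite -(cvg_lim _ cH)//; apply: lime_ge; first by apply/cvg_ex; eexists; exact: cH.
  by exists n => // m /= nm; exact: ndH.
rewrite -(cvg_lim _ c)//; apply: lime_le; first by apply/cvg_ex; eexists; exact: c.
apply: nearW => m.
set a := mu%:E + _.
(* The stage [m] inside the sum stays fixed while the level of the truncation grows. If [a] is
   finite a large level has no effect; if [a] is infinite [lamoo w t] exceeds every integer. *)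
have h n : (m <= n)%N -> mine n.+1%:R%:E a <= lamoo w t.
  move=> mn; apply: le_trans (lamn_lamoo n.+1 w t); rewrite /= le_min.
  rewrite ge_min lexx/= ge_min; apply/orP; right.
  by apply: leeD => //; exact: ndH.
have a0 : 0 <= a.
  by apply: adde_ge0; [rewrite lee_fin ltW|apply: NI_ge0 => x; exact: thin_ge0].
case: a h a0 => [a|h _|//].
  rewrite lee_fin => h a0; apply: le_trans (h (maxn m (Num.truncn a)) (leq_maxl _ _)).
  rewrite le_min lexx andbT lee_fin ltW// (lt_le_trans (truncnS_gt a))//.
  by rewrite ler_nat ltnS leq_maxr.
have h' n : n%:R%:E <= lamoo w t.
  apply: le_trans (h (maxn m n) (leq_maxl _ _)); rewrite le_min leey andbT.
  by rewrite lee_fin ler_nat (leq_trans (leq_maxr m n)).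
move: h'; case: (lamoo w t) => [r|//|/(_ 0%N)]; last by rewrite leeNy_eq.
move=> /(_ (Num.truncn r).+1); rewrite lee_fin leNgt => /negP; case; exact: truncnS_gt.
Qed.

Lemma nuI_lamoo f w : measurable_fun setT f -> (forall s, 0 <= f s) ->
  L lamoo f w = mu%:E * \int[mes1]_s pos_part f s + H lamoo (Pop f) w.
Proof.
move=> mf f0; rewrite (nuI_thin w pred_lamoo mf f0) -(integral_intensity w pred_lamoo mf f0).
by apply: eq_integral => s _; rewrite lamoo_eq.
Qed.

Lemma nuI_lamn n f w : measurable_fun setT f -> (forall s, 0 <= f s) ->
  L (lamn n.+1) f w <= mu%:E * \int[mes1]_s pos_part f s + H (lamn n) (Pop f) w.
Proof.
move=> mf f0; rewrite (nuI_thin w (pred_lamn n.+1) mf f0) -(integral_intensity w (pred_lamn n) mf f0).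
have mp : measurable_fun setT (pos_part f).
  by rewrite pos_partE; apply/(measurable_restrictT _ (measurable_itv _)); exact: measurable_funTS.
have p0 s : 0 <= pos_part f s by rewrite /pos_part; case: ifPn.
apply: ge0_le_integralT.
- by apply: emeasurable_funM => //; exact: pred_int_section w (pred_lamn n.+1).
- apply: emeasurable_funM => //.
  exact: pred_int_section w (predictable_intensity (pred_lamn n)).
- by move=> s; apply: mule_ge0 => //; exact: (pred_lamn n.+1).2.
- by move=> s; apply: lee_wpmul2l => //; exact: lamnS_le.
Qed.

End picard.

(** * Inequalities for the second moment recursion *)

Section ereal_real.
Context {R : realType}.

(** Convexity of the square, applied to [b + r x = (1 - r) (b / (1 - r)) + r x]. The factor [r], and
    not a larger one, stays in front of [x ^ 2]. *)
Lemma sqr_convex_bound (b r x l : R) : 0 <= r -> r < 1 -> 0 <= l -> l <= b + r * x ->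
  l * l <= b ^+ 2 / (1 - r) + r * (x * x).
Proof.
move=> r0 r1 l0 lb; have r1' : 0 < 1 - r by rewrite subr_gt0.
apply: (@le_trans _ _ ((b + r * x) * (b + r * x))); first by apply: ler_pM.
rewrite -subr_ge0.
have -> : b ^+ 2 / (1 - r) + r * (x * x) - (b + r * x) * (b + r * x) =
   r * (1 - r) * (x - b / (1 - r)) ^+ 2 by field; rewrite gt_eqF.
by rewrite mulr_ge0 ?sqr_ge0// mulr_ge0// ltW.
Qed.

(** The weights are such that twice the right side contains [e] times the square of [x], which can
    be absorbed when [e < 1]. *)
Lemma young (e x l : R) : 0 < e -> x * l <= e / 2 * (x * x) + (2 * e)^-1 * (l * l).
Proof.
move=> e0; rewrite -subr_ge0.
have -> : e / 2 * (x * x) + (2 * e)^-1 * (l * l) - x * l = (2 * e)^-1 * (e * x - l) ^+ 2.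
  by field; rewrite gt_eqF.
by rewrite mulr_ge0 ?sqr_ge0// invr_ge0; lra.
Qed.

(** In the application [X] is a number of accepted points and [Y] its compensator: [y], [z], [c],
    [x] are the expectations of [X ^ 2], [Y ^ 2], [X Y] and [X], related by the isometry. *)
Lemma absorb_cross_term (e y z x c : R) : 0 < e -> e < 1 -> y + z = x + (c + c) ->
  c <= e / 2 * y + (2 * e)^-1 * z -> y <= x / (1 - e) + z / e.
Proof.
move=> e0 e1 E hc; have e1' : 0 < 1 - e by rewrite subr_gt0.
have -> : x / (1 - e) + z / e = (x + (e^-1 - 1) * z) / (1 - e).
  by field; rewrite !gt_eqF.
rewrite ler_pdivlMr//.
have : c + c <= e * y + e^-1 * z.
  have -> : e * y + e^-1 * z = (e / 2 * y + (2 * e)^-1 * z) + (e / 2 * y + (2 * e)^-1 * z).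
    by field; rewrite gt_eqF.
  exact: lerD.
by move: E; rewrite mulrBl mulrBr mulr1 mul1r (mulrC y); move: (e * y) (e^-1 * z) => p q; lra.
Qed.

Lemma second_moment_step (r e a B y z x c y' : R) : r < 1 -> 0 < e -> e < 1 ->
  y + z = x + (c + c) -> z <= B + r * y' -> c <= e / 2 * y + (2 * e)^-1 * z ->
  x <= a / (1 - r) -> y <= a / (1 - r) / (1 - e) + B / e + r / e * y'.
Proof.
move=> r1 e0 e1 E hz hc hx; apply: (le_trans (absorb_cross_term e0 e1 E hc)).
have e1' : 0 < 1 - e by rewrite subr_gt0.
have -> : a / (1 - r) / (1 - e) + B / e + r / e * y' = a / (1 - r) / (1 - e) + (B + r * y') / e.
  by rewrite mulrDl -addrA; congr (_ + (_ + _)); rewrite mulrAC.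
by apply: lerD; rewrite ler_wpM2r// invr_ge0 ltW.
Qed.

Lemma second_moment_stepe (r e a B : R) (y z x c y' : \bar R) : r < 1 -> 0 < e -> e < 1 ->
  y \is a fin_num -> z \is a fin_num -> x \is a fin_num -> c \is a fin_num -> y' \is a fin_num ->
  (y + z = x + (c + c))%E -> (z <= B%:E + r%:E * y')%E ->
  (c <= (e / 2)%:E * y + ((2 * e)^-1)%:E * z)%E -> (x <= (a / (1 - r))%:E)%E ->
  (y <= (a / (1 - r) / (1 - e) + B / e)%:E + (r / e)%:E * y')%E.
Proof.
case: y => [y||]; case: z => [z||]; case: x => [x||]; case: c => [c||]; case: y' => [y'||] //.
rewrite -!EFinM -!EFinD !lee_fin => r1 e0 e1 _ _ _ _ _ -[]; exact: second_moment_step.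
Qed.
End ereal_real.

Section affine.
Local Open Scope ereal_scope.
Lemma E_affine {R : realType} d (Omega : measurableType d) (P : probability Omega R) (b r : R)
    (g : Omega -> \bar R) : (0 <= b)%R -> (0 <= r)%R -> measurable_fun setT g -> (forall w, 0 <= g w) ->
  \int[P]_w (b%:E + r%:E * g w) = b%:E + r%:E * \int[P]_w g w.
Proof.
move=> b0 r0 mg g0; have mr : measurable_fun setT (fun w => r%:E * g w) by exact: emeasurable_funM.
have cE : \int[P]_w b%:E = b%:E by rewrite integral_cst// [X in _ * X]probability_setT mule1.
transitivity (\int[P]_w b%:E + \int[P]_w (r%:E * g w)).
  by apply: ge0_integralD => // w _; exact: mule_ge0.
by apply: eq_adde => //; exact: ge0_integralZl.
Qed.

Lemma le_E_affine {R : realType} d (Omega : measurableType d) (P : probability Omega R) (b r : R)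
    (f g : Omega -> \bar R) : (0 <= b)%R -> (0 <= r)%R -> measurable_fun setT f -> (forall w, 0 <= f w) ->
  measurable_fun setT g -> (forall w, 0 <= g w) -> (forall w, f w <= b%:E + r%:E * g w) ->
  \int[P]_w f w <= b%:E + r%:E * \int[P]_w g w.
Proof.
move=> b0 r0 mf f0 mg g0 fg; rewrite -(E_affine P b0 r0 mg g0).
have mr : measurable_fun setT (fun w => r%:E * g w) by exact: emeasurable_funM.
apply: ge0_le_integralT => //.
by apply: emeasurable_funD => //; exact: measurable_cst.
Qed.
End affine.

(** * Moments of the minimal solution *)

Section moment_bounds.
Context {R : realType} d (Omega : measurableType d) (P : probability Omega R).
Notation R2 := (R * R)%type.
Variable N : Omega -> {measure set R2 -> \bar R}.
Hypothesis SN : simple_prm P N.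
Let PN : is_PRM P N. Proof. by case: SN. Qed.
Let fN w : locfin (N w). Proof. by case: SN. Qed.
Notation PT := (PT N).
Variable Phi : R -> R.
Hypothesis mPhi : measurable_fun (`[0%R, +oo[%classic : set R) Phi.
Hypothesis Phi0 : forall x, 0 <= x -> 0 <= Phi x.
Hypothesis Phi1 : (\int[leb]_(x in (`[0%R, +oo[%classic : set R)) (Phi x)%:E < 1)%E.
Variable mu : R.
Hypothesis mu0 : 0 < mu.
Local Open Scope ereal_scope.
Notation phi := (pos_Phi Phi).
Notation Pop := (Pop Phi).
Notation rho := (rho Phi).
Notation H l f := (NI N (thin l f)).
Notation L l f := (nuI (thin l f)).
Notation lamn := (lamn N Phi mu).
Notation lamoo := (lamoo N Phi mu).

Let mphi := measurable_phi mPhi.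
Let phi0 := phi_ge0 Phi0.
Let plamn n : pred_int N (lamn n) := pred_lamn SN mPhi Phi0 mu0 n.

Definition upto (T s : R) : \bar R := (\1_(`]-oo, T]%classic : set R) s : R)%:E.

Lemma measurable_upto T : measurable_fun setT (upto T).
Proof. by apply/measurable_EFinP; exact: measurable_indic. Qed.

Lemma upto_ge0 T s : 0 <= upto T s.
Proof. by rewrite lee_fin. Qed.

Lemma uptoE T s : upto T s = if (s <= T)%R then 1 else 0.
Proof.
rewrite /upto indicE; case: ifPn => h; first by rewrite mem_set//= in_itv.
by rewrite memNset//= in_itv/=; exact/negP.
Qed.

(** The isometry for the indicator of the box, which is its own square: the second moment is one of
    two nonnegative terms whose sum is finite. *)
Lemma E_count2_lty m : \int[P]_w (N w (box m) * N w (box m)) < +oo.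
Proof.
pose h (x : PT) : \bar R := (\1_(setT `*` box m : set PT) x)%:E.
have mb := @measurable_box R m.
have mD : measurable (setT `*` box m : set PT).
  apply: sub_sigma_algebra; exact: predictable_rect_box.
have mh : measurable_fun setT h by apply/measurable_EFinP; exact: measurable_indic.
have h0 x : 0 <= h x by rewrite lee_fin.
have NE (k : {measure set R2 -> \bar R}) w : \int[k]_p h (w, p) = k (box m).
  rewrite (_ : (fun p => _) = (fun p => (\1_(box m) p)%:E)).
    by rewrite integral_indic ?setIT.
  apply/funext => p; rewrite /h !indicE; congr ((nat_of_bool _)%:R%:E).
  by apply/idP/idP; rewrite !inE; [move=> []|].
have hh : (fun x => h x * h x) = h.
  by apply/funext => x; rewrite /h -EFinM !indicE; case: (_ \in _); rewrite ?mulr1 ?mulr0.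
have := isometry SN mh h0 mh h0; rewrite hh /NI /nuI.
under eq_integral do rewrite !NE.
under [X in _ + X = _]eq_integral do rewrite !NE.
under [X in _ = X + _]eq_integral do rewrite !NE.
under [X in _ = _ + (X + _)]eq_integral do rewrite !NE.
under [X in _ = _ + (_ + X)]eq_integral do rewrite !NE.
have nf := @locfin_nu R m.
have nfin : (nu (box m) : \bar R) \is a fin_num by rewrite ge0_fin_numE.
have mN : measurable_fun setT (fun w => N w (box m)) by exact: (prm_measurable PN mb).
have E1 : \int[P]_w N w (box m) = nu (box m).
  have := compensation SN mh h0; under eq_integral do rewrite NE.
  under [X in _ = X]eq_integral do rewrite NE.
  by rewrite integral_cst// [X in _ * X]probability_setT mule1.
have E2 : \int[P]_w (N w (box m) * nu (box m)) = nu (box m) * nu (box m).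
  by rewrite ge0_integralZr// E1.
have E3 : \int[P]_w (nu (box m) * N w (box m)) = nu (box m) * nu (box m).
  by rewrite ge0_integralZl// E1.
rewrite E1 E2 E3 => E.
apply: (@le_lt_trans _ _ (nu (box m) + (nu (box m) * nu (box m) + nu (box m) * nu (box m)))).
  by rewrite -E leeDl//; apply: integral_ge0 => w _; exact: mule_ge0.
by rewrite -(fineK nfin) -!EFinM -!EFinD ltry.
Qed.

Variable T : R.
Hypothesis T0 : (0 <= T)%R.
Let f := upto T.
Let mf : measurable_fun setT f := measurable_upto T.
Let f0 s : 0 <= f s := upto_ge0 T s.
Let X n w := H (lamn n) f w.
Let Y n w := L (lamn n) f w.
Let mX n : measurable_fun setT (X n).
Proof. by apply: (measurable_NI SN (measurable_thin (plamn n) mf)) => x; exact: thin_ge0. Qed.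
Let mY n : measurable_fun setT (Y n).
Proof. by apply: (measurable_nuI (measurable_thin (plamn n) mf)) => x; exact: thin_ge0. Qed.
Let X0 n w : 0 <= X n w. Proof. by apply: NI_ge0 => x; exact: thin_ge0. Qed.
Let Y0 n w : 0 <= Y n w.
Proof. by apply: integral_ge0 => p _; exact: thin_ge0. Qed.

Let X_le_count n : exists m, forall w, X n w <= N w (box m).
Proof.
exists (maxn n (Num.truncn T).+1) => w.
set m := maxn _ _; have mb := @measurable_box R m.
have -> : N w (box m) = \int[N w]_p (\1_(box m) p)%:E by rewrite integral_indic ?setIT.
apply: ge0_le_integralT.
- exact: measurable_PT_section w (measurable_thin (plamn n) mf).
- by apply/measurable_EFinP; exact: measurable_indic.
- by move=> p; exact: thin_ge0.
- move=> p; rewrite /thin /f uptoE /acc /=.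
  case: ifPn => [pT|_]; last by rewrite mul0e lee_fin.
  case: ifPn => [/and3P[a b c]|_]; last by rewrite mule0 lee_fin.
  rewrite mule1 indicE mem_set//; apply: in_box.
    rewrite ger0_norm; last exact: ltW.
    apply: (le_trans pT); apply: ltW.
    by apply: (lt_le_trans (truncnS_gt T)); rewrite ler_nat leq_maxr.
  rewrite ger0_norm//; have := lt_le_trans c (lamn_le _ _ _ _ _ _).
  rewrite lte_fin => /ltW/le_trans; apply; by rewrite ler_nat leq_maxl.
Qed.

Let X_fin n w : X n w \is a fin_num.
Proof.
have [m Xm] := X_le_count n; rewrite ge0_fin_numE//.
exact: le_lt_trans (Xm w) (fN w m).
Qed.

Let y n := \int[P]_w (X n w * X n w).
Let y_lty n : y n < +oo.
Proof.
have [m Xm] := X_le_count n; apply: le_lt_trans (E_count2_lty m).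
have mN : measurable_fun setT (fun w => N w (box m)) by exact: (prm_measurable PN (measurable_box m)).
apply: ge0_le_integralT.
- exact: emeasurable_funM.
- exact: emeasurable_funM.
- by move=> w; exact: mule_ge0.
- by move=> w; exact: lee_pmul.
Qed.
Let y0 n : 0 <= y n. Proof. by apply: integral_ge0 => w _; exact: mule_ge0. Qed.

Let Pop_f s : Pop f s <= rho%:E * f s.
Proof.
rewrite {2}/f uptoE; case: ifPn => [_|sT].
  rewrite mule1 -(integral_phi mPhi Phi0 Phi1) -(integral_translate s mphi phi0).
  have mps : measurable_fun setT (fun t : R => phi (t - s)%R).
    by apply: measurableT_comp => //; exact: measurable_funB.
  apply: ge0_le_integralT => //.
  - exact: emeasurable_funM.
  - by move=> t; exact: mule_ge0.
  - move=> t; rewrite -[leRHS]mule1; apply: lee_wpmul2l => //.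
    by rewrite /f uptoE; case: ifPn.
rewrite mule0 /Pop (_ : \int[mes1]_t _ = 0)//; apply: integral0_eq => t _.
rewrite /f uptoE; case: ifPn => [tT|_]; last by rewrite mule0.
rewrite /pos_Phi /pos_part subr_gt0 ifF ?mul0e//; apply/negbTE; rewrite -leNgt.
by rewrite (le_trans tT)// ltW// ltNge.
Qed.

Let pos_f : \int[mes1]_s pos_part f s <= T%:E.
Proof.
have -> : pos_part f = EFin \o \1_(`]0%R, T]%classic : set R).
  apply/funext => s; rewrite /= /pos_part /f uptoE indicE.
  case: ifPn => [s0|s0]; last first.
    by rewrite memNset//= in_itv/= => /andP[s0']; move: s0; rewrite s0'.
  case: ifPn => sT; first by rewrite mem_set//= in_itv/= s0.
  by rewrite memNset//= in_itv/= s0/=; exact/negP.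
rewrite integral_indic//; rewrite setIT.
rewrite [leLHS](_ : _ = @lebesgue_measure R `]0%R, T]%classic)//.
rewrite lebesgue_measure_itv/=; case: ifPn => _; last by rewrite lee_fin.
by rewrite -EFinB subr0.
Qed.

Let r0 : (0 <= rho)%R := rho_ge0 Phi0.
Let r1 : (rho < 1)%R := rho_lt1 Phi0 Phi1.
Let b : R := (mu * T)%R.

Let YS n w : Y n.+1 w <= b%:E + rho%:E * X n w.
Proof.
apply: le_trans (nuI_lamn SN mPhi Phi0 mu0 n w mf f0) _; apply: leeD.
  by rewrite EFinM; apply: lee_wpmul2l => //; exact: ltW.
rewrite /X /NI -ge0_integralZl//; last 2 first.
- exact: measurable_PT_section w (measurable_thin (plamn n) mf).
- by move=> p _; exact: thin_ge0.
apply: ge0_le_integralT.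
- apply: measurable_PT_section w (measurable_thin (plamn n) _); exact: measurable_Pop.
- apply: emeasurable_funM => //.
  exact: measurable_PT_section w (measurable_thin (plamn n) mf).
- by move=> p; apply: thin_ge0 => s; exact: Pop_ge0.
- move=> p; rewrite /thin muleA; apply: lee_wpmul2r; first exact: acc_ge0.
  exact: Pop_f.
Qed.

Let Y_fin n w : Y n w \is a fin_num.
Proof.
case: n => [|n].
  rewrite (_ : Y 0 w = 0)//; apply: integral0_eq => p _.
  rewrite /thin /acc ifF ?mule0//; apply/negbTE/negP => /and3P[_ h]/=.
  by rewrite lte_fin ltNge h.
rewrite ge0_fin_numE//; apply: le_lt_trans (YS n w) _.
by rewrite -(fineK (X_fin n w)) -EFinM -EFinD ltry.
Qed.

Let EX n : \int[P]_w X n w = \int[P]_w Y n w.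
Proof. by apply: (E_NI SN (measurable_thin (plamn n) mf)) => x; exact: thin_ge0. Qed.

Let b0 : (0 <= b)%R. Proof. by rewrite mulr_ge0// ltW. Qed.

(** The bound is the fixed point of [x = b + rho x], the recursion that compensation gives for the
    means. *)
Let EX_le n : \int[P]_w X n w <= (b / (1 - rho))%:E.
Proof.
have r1' : (0 < 1 - rho)%R by rewrite subr_gt0.
elim: n => [|n ih].
  rewrite EX (_ : Y 0 = fun=> 0) ?integral0; first by rewrite lee_fin divr_ge0// ltW.
  apply/funext => w; apply: integral0_eq => p _.
  rewrite /thin /acc ifF ?mule0//; apply/negbTE/negP => /and3P[_ h]/=.
  by rewrite lte_fin ltNge h.
rewrite EX; apply: (@le_trans _ _ (b%:E + rho%:E * \int[P]_w X n w)).
  exact: le_E_affine (YS n).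
apply: (@le_trans _ _ (b%:E + rho%:E * (b / (1 - rho))%:E)).
  by rewrite leeD2l// lee_wpmul2l.
rewrite -EFinM -EFinD lee_fin le_eqVlt; apply/orP; left; apply/eqP; field.
by rewrite gt_eqF.
Qed.

(* Any [eta] with [rho < eta < 1] makes the recursion [yS] for the second moments
   a contraction. *)
Let eta := ((1 + rho) / 2)%R.
Let kap := (rho / eta)%R.
Let B := (b ^+ 2 / (1 - rho))%R.
Let C := (b / (1 - rho) / (1 - eta) + B / eta)%R.

Let z n := \int[P]_w (Y n w * Y n w).
Let zS n : z n.+1 <= B%:E + rho%:E * y n.
Proof.
have mXX : measurable_fun setT (fun w => X n w * X n w) by exact: emeasurable_funM.
have XX0 w : 0 <= X n w * X n w by exact: mule_ge0.
have B0 : (0 <= B)%R by rewrite divr_ge0 ?sqr_ge0// subr_ge0 ltW.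
apply: le_E_affine => //.
- exact: emeasurable_funM.
- by move=> w; exact: mule_ge0.
- move=> w; have := YS n w; rewrite -(fineK (X_fin n w)) -(fineK (Y_fin n.+1 w)).
  rewrite -!EFinM -!EFinD !lee_fin; apply: sqr_convex_bound => //.
  by apply: fine_ge0.
Qed.

Let c n := \int[P]_w (X n w * Y n w).
Let e0 : (0 < eta)%R. Proof. by rewrite /eta divr_gt0// ltr_pwDl. Qed.
Let e1 : (eta < 1)%R.
Proof. have := r1; rewrite /eta; move: rho => r hr; lra. Qed.

Let c_le n : c n <= (eta / 2)%:E * y n + ((2 * eta)^-1)%:E * z n.
Proof.
have mXX : measurable_fun setT (fun w => X n w * X n w) by exact: emeasurable_funM.
have XX0 w : 0 <= X n w * X n w by exact: mule_ge0.
have mYY : measurable_fun setT (fun w => Y n w * Y n w) by exact: emeasurable_funM.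
have YY0 w : 0 <= Y n w * Y n w by exact: mule_ge0.
have h1 : 0 <= (eta / 2)%:E by rewrite lee_fin divr_ge0// ltW.
have h2 : 0 <= ((2 * eta)^-1)%:E by rewrite lee_fin invr_ge0 mulr_ge0// ltW.
apply: (@le_trans _ _ (\int[P]_w ((eta / 2)%:E * (X n w * X n w) + ((2 * eta)^-1)%:E * (Y n w * Y n w)))).
  apply: ge0_le_integralT.
  - exact: emeasurable_funM.
  - by apply: emeasurable_funD; exact: emeasurable_funM.
  - by move=> w; exact: mule_ge0.
  - move=> w; rewrite -(fineK (X_fin n w)) -(fineK (Y_fin n w)) -!EFinM -!EFinD lee_fin.
    exact: young.
rewrite ge0_integralD//.
- by apply: leeD; rewrite ge0_integralZl.
- by move=> w _; exact: mule_ge0.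
- exact: emeasurable_funM.
- by move=> w _; exact: mule_ge0.
- exact: emeasurable_funM.
Qed.

Let ff n : (fun x => thin (lamn n) f x * thin (lamn n) f x) = thin (lamn n) f.
Proof.
apply/funext => x; rewrite /thin muleACA acc_idem /f uptoE.
by case: ifPn; rewrite ?mule1 ?mule0.
Qed.

Let yS n : y n.+1 <= C%:E + kap%:E * y n.
Proof.
have tm : measurable_fun setT (thin (lamn n.+1) f : PT -> \bar R) := measurable_thin (plamn n.+1) mf.
have t0 x : 0 <= thin (lamn n.+1) f x by exact: thin_ge0.
have := isometry SN tm t0 tm t0; rewrite ff.
have -> : \int[P]_w (L (lamn n.+1) f w * H (lamn n.+1) f w) = c n.+1.
  by apply: eq_integral => w _; rewrite muleC.
rewrite -/(X n.+1) -/(Y n.+1) -/(y n.+1) -/(z n.+1) -/(c n.+1) => E.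
have yf k : y k \is a fin_num by rewrite ge0_fin_numE.
have z0 : 0 <= z n.+1 by apply: integral_ge0 => w _; exact: mule_ge0.
have zf : z n.+1 \is a fin_num.
  rewrite (ge0_fin_numE z0); apply: le_lt_trans (zS n) _.
  by rewrite -(fineK (yf n)) -EFinM -EFinD ltry.
have c0 : 0 <= c n.+1 by apply: integral_ge0 => w _; exact: mule_ge0.
have cf : c n.+1 \is a fin_num.
  rewrite (ge0_fin_numE c0); apply: le_lt_trans (c_le n.+1) _.
  by rewrite -(fineK (yf n.+1)) -(fineK zf) -!EFinM -EFinD ltry.
have x0 : 0 <= \int[P]_w X n.+1 w by exact: integral_ge0.
have xf : \int[P]_w X n.+1 w \is a fin_num.
  by rewrite ge0_fin_numE//; apply: le_lt_trans (EX_le n.+1) _; rewrite ltry.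
exact: (second_moment_stepe r1 e0 e1 (yf n.+1) zf xf cf (yf n) E (zS n) (c_le n.+1) (EX_le n.+1)).
Qed.

Let kap0 : (0 <= kap)%R. Proof. by rewrite divr_ge0// ltW. Qed.
Let kap1 : (kap < 1)%R.
Proof. by rewrite ltr_pdivrMr// mul1r /eta; have := r1; move: rho => r; lra. Qed.

Let C0 : (0 <= C)%R.
Proof.
have h : (0 <= 1 - rho)%R by rewrite subr_ge0 ltW.
have h' : (0 <= 1 - eta)%R by rewrite subr_ge0 ltW.
have h'' : (0 <= eta)%R by rewrite ltW.
by rewrite /C addr_ge0// divr_ge0// divr_ge0// sqr_ge0.
Qed.

Let y_le n : y n <= (C / (1 - kap))%:E.
Proof.
have k1' : (0 < 1 - kap)%R by rewrite subr_gt0.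
elim: n => [|n ih].
  rewrite /y (_ : (fun w => _) = fun=> 0).
    by rewrite integral0 lee_fin divr_ge0//; apply: ltW.
  apply/funext => w; rewrite (_ : X 0 w = 0) ?mule0//; apply: integral0_eq => p _.
  rewrite /thin /acc ifF ?mule0//; apply/negbTE/negP => /and3P[_ h]/=.
  by rewrite lte_fin ltNge h.
apply: (le_trans (yS n)).
apply: (@le_trans _ _ (C%:E + kap%:E * (C / (1 - kap))%:E)).
  by rewrite leeD2l// lee_wpmul2l.
rewrite -EFinM -EFinD lee_fin le_eqVlt; apply/orP; left; apply/eqP; field.
by rewrite gt_eqF.
Qed.

Let cX w : X n w @[n --> \oo] --> H lamoo f w.
Proof. exact: (cvg_H SN mPhi Phi0 mu0). Qed.

Let ndX w : nondecreasing_seq (X ^~ w).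
Proof. exact: (nondecreasing_H SN mPhi Phi0 mu0). Qed.

Lemma E_H_lty : \int[P]_w H lamoo f w < +oo.
Proof.
apply: (@le_lt_trans _ _ (b / (1 - rho))%:E); last exact: ltry.
have cc : \int[P]_w X n w @[n --> \oo] --> \int[P]_w H lamoo f w by exact: ge0_integral_cvg.
rewrite -(cvg_lim _ cc)//; apply: lime_le; first by apply/cvg_ex; eexists; exact: cc.
by apply: nearW => n; exact: EX_le.
Qed.

Lemma E_H2_lty : \int[P]_w (H lamoo f w * H lamoo f w) < +oo.
Proof.
apply: (@le_lt_trans _ _ (C / (1 - kap))%:E); last exact: ltry.
have cc : y n @[n --> \oo] --> \int[P]_w (H lamoo f w * H lamoo f w).
  apply: ge0_integral_cvg.
  - by move=> n; exact: emeasurable_funM.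
  - by move=> n w; exact: mule_ge0.
  - by move=> w m n mn; apply: lee_pmul => //; exact: ndX.
  - by move=> w; apply: ge0_cvge_nondecreasing_mul => //; exact: ndX.
rewrite -(cvg_lim _ cc)//; apply: lime_le; first by apply/cvg_ex; eexists; exact: cc.
by apply: nearW => n; exact: y_le.
Qed.

End moment_bounds.

Lemma cancel_cross_terms_real {R : realFieldType} (uv uq pv pq ab aq pb m : R) :
  uv + uq + (pv + pq) + (ab + aq + (pb + pq)) = m + (ab + uq + (pb + pq) + (ab + aq + (pv + pq))) ->
  uv = ab + m.
Proof. by move=> h; lra. Qed.

(** * First and second moment formulas *)

Section moments.
Context {R : realType} d (Omega : measurableType d) (P : probability Omega R).
Notation R2 := (R * R)%type.
Variable N : Omega -> {measure set R2 -> \bar R}.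
Hypothesis SN : simple_prm P N.
Variable Phi : R -> R.
Hypothesis mPhi : measurable_fun (`[0%R, +oo[%classic : set R) Phi.
Hypothesis Phi0 : forall x, 0 <= x -> 0 <= Phi x.
Hypothesis Phi1 : (\int[leb]_(x in (`[0%R, +oo[%classic : set R)) (Phi x)%:E < 1)%E.
Variable mu : R.
Hypothesis mu0 : 0 < mu.
Local Open Scope ereal_scope.
Notation Pop := (Pop Phi).
Notation Rop := (Rop Phi).
Notation psi := (pos_Psi Phi).
Notation lamoo := (lamoo N Phi mu).
Notation H f := (NI N (thin lamoo f)).
Notation L f := (nuI (thin lamoo f)).

Let plamoo : pred_int N lamoo := pred_lamoo SN mPhi Phi0 mu0.
Let mpsi : measurable_fun setT psi := measurable_psi mPhi Phi0.
Let psi0 := psi_ge0 mPhi Phi0.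

Implicit Types f g k : R -> \bar R.

Lemma measurable_H f : measurable_fun setT f -> (forall s, 0 <= f s) -> measurable_fun setT (H f).
Proof. by move=> mf f0; apply: (measurable_NI SN (measurable_thin plamoo mf)) => x; exact: thin_ge0. Qed.

Lemma H_ge0 f w : (forall s, 0 <= f s) -> 0 <= H f w.
Proof. by move=> f0; apply: NI_ge0 => x; exact: thin_ge0. Qed.

Lemma le_H f g w : measurable_fun setT f -> measurable_fun setT g ->
  (forall s, 0 <= f s) -> (forall s, f s <= g s) -> H f w <= H g w.
Proof.
move=> mf mg f0 fg; apply: ge0_le_integralT.
- exact: measurable_PT_section w (measurable_thin plamoo mf).
- exact: measurable_PT_section w (measurable_thin plamoo mg).
- by move=> p; exact: thin_ge0.
- by move=> p; apply: lee_wpmul2r; [exact: acc_ge0|exact: fg].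
Qed.

Lemma HD f g w : measurable_fun setT f -> measurable_fun setT g ->
  (forall s, 0 <= f s) -> (forall s, 0 <= g s) -> H (fun s => f s + g s) w = H f w + H g w.
Proof.
move=> mf mg f0 g0; transitivity (\int[N w]_p (thin lamoo f (w, p) + thin lamoo g (w, p))).
  by apply: eq_integral => p _; rewrite /thin ge0_muleDl.
apply: ge0_integralD => //.
- by move=> p _; exact: thin_ge0.
- exact: measurable_PT_section w (measurable_thin plamoo mf).
- by move=> p _; exact: thin_ge0.
- exact: measurable_PT_section w (measurable_thin plamoo mg).
Qed.

Lemma HZ (c : R) f w : (0 <= c)%R -> measurable_fun setT f -> (forall s, 0 <= f s) ->
  H (fun s => c%:E * f s) w = c%:E * H f w.
Proof.
move=> c0 mf f0; transitivity (\int[N w]_p (c%:E * thin lamoo f (w, p))).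
  by apply: eq_integral => p _; rewrite /thin muleA.
apply: ge0_integralZl => //.
- exact: measurable_PT_section w (measurable_thin plamoo mf).
- by move=> p _; exact: thin_ge0.
Qed.

Lemma H_cvg (f_ : (R -> \bar R)^nat) f w : (forall n, measurable_fun setT (f_ n)) ->
  (forall n s, 0 <= f_ n s) -> (forall s, nondecreasing_seq (f_ ^~ s)) ->
  (forall s, f_ n s @[n --> \oo] --> f s) -> H (f_ n) w @[n --> \oo] --> H f w.
Proof.
move=> mf f0 nd cv; apply: ge0_integral_cvg.
- by move=> n; exact: measurable_PT_section w (measurable_thin plamoo (mf n)).
- by move=> n p; exact: thin_ge0.
- by move=> p m n mn; apply: lee_wpmul2r; [exact: acc_ge0|exact: nd].
- move=> p; apply: ge0_cvge_nondecreasing_mul => //.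
  + by move=> n; exact: acc_ge0.
  + exact: cvg_cst.
Qed.

Lemma E_H_cvg (f_ : (R -> \bar R)^nat) f : (forall n, measurable_fun setT (f_ n)) ->
  (forall n s, 0 <= f_ n s) -> (forall s, nondecreasing_seq (f_ ^~ s)) ->
  (forall s, f_ n s @[n --> \oo] --> f s) ->
  \int[P]_w H (f_ n) w @[n --> \oo] --> \int[P]_w H f w.
Proof.
move=> mf f0 nd cv; apply: ge0_integral_cvg.
- by move=> n; exact: measurable_H.
- by move=> n w; exact: H_ge0.
- by move=> w m n mn; apply: le_H => // s; exact: nd.
- by move=> w; exact: H_cvg.
Qed.

Definition bounded_upto T f := exists2 c : R, (0 <= c)%R & forall s, f s <= c%:E * upto T s.

Lemma bounded_uptoP T f : (forall s, 0 <= f s) -> (exists2 c : R, (0 <= c)%R &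
  (forall s, f s <= c%:E) /\ (forall s, (T < s)%R -> f s = 0)) -> bounded_upto T f.
Proof.
move=> f0 [c c0 [fc fT]]; exists c => // s; rewrite uptoE; case: ifPn => [_|].
  by rewrite mule1.
by rewrite -ltNge => /fT ->; rewrite mule0.
Qed.

Lemma bounded_upto_bound T f : (forall s, 0 <= f s) -> bounded_upto T f -> exists2 c : R, (0 <= c)%R &
  (forall s, f s <= c%:E) /\ (forall s, (T < s)%R -> f s = 0).
Proof.
move=> f0 [c c0 fc]; exists c => //; split => [s|s Ts].
  apply: le_trans (fc s) _; rewrite -[leRHS]mule1; apply: lee_wpmul2l => //.
  by rewrite uptoE; case: ifPn.
apply/eqP; rewrite eq_le f0 andbT; apply: le_trans (fc s) _.
by rewrite uptoE ifF ?mule0//; apply/negbTE; rewrite -ltNge.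
Qed.

Lemma bounded_upto_le T f g : (forall s, f s <= g s) -> bounded_upto T g -> bounded_upto T f.
Proof. by move=> fg [c c0 gc]; exists c => // s; exact: le_trans (gc s). Qed.

Lemma bounded_upto_mul T f g : (forall s, 0 <= f s) -> (forall s, 0 <= g s) ->
  bounded_upto T f -> bounded_upto T g -> bounded_upto T (fun s => f s * g s).
Proof.
move=> f0 g0 [c c0 fc] [c' c'0 gc]; exists (c * c')%R; first exact: mulr_ge0.
move=> s; apply: (@le_trans _ _ (c%:E * upto T s * (c'%:E * upto T s))); first exact: lee_pmul.
by rewrite muleACA uptoE -EFinM; case: ifPn; rewrite ?mule1 ?mule0.
Qed.

Lemma bounded_upto_Rop T f : measurable_fun setT f -> (forall s, 0 <= f s) ->
  bounded_upto T f -> bounded_upto T (Rop f).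
Proof.
move=> mf f0 bf; apply: bounded_uptoP; first exact: (Rop_ge0 mPhi Phi0).
have [c c0 [h1 h2]] := bounded_upto_bound f0 bf.
exact: (Rop_bounded mPhi Phi0 Phi1 mf f0 c0 h1 h2).
Qed.

Section upto_T.
Variable T : R.
Hypothesis T0 : (0 <= T)%R.

Lemma bounded_H f : measurable_fun setT f -> (forall s, 0 <= f s) -> bounded_upto T f ->
  exists2 c : R, (0 <= c)%R & forall w, H f w <= c%:E * H (upto T) w.
Proof.
move=> mf f0 [c c0 fc]; exists c => // w.
have mu_T : measurable_fun setT (upto T) by exact: measurable_upto.
rewrite -(HZ w c0 mu_T (upto_ge0 T)).
by apply: le_H => //; exact: emeasurable_funM.
Qed.

Lemma bounded_E_H f : measurable_fun setT f -> (forall s, 0 <= f s) -> bounded_upto T f ->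
  \int[P]_w H f w < +oo.
Proof.
move=> mf f0 bf; have [c c0 Hc] := bounded_H mf f0 bf.
have mu_T : measurable_fun setT (upto T) := measurable_upto T; have u0 := upto_ge0 T.
have mHu := measurable_H mu_T u0; have mHf := measurable_H mf f0.
apply: (@le_lt_trans _ _ (c%:E * \int[P]_w H (upto T) w)).
  rewrite -ge0_integralZl//; last by move=> w _; exact: H_ge0.
  apply: ge0_le_integralT => //; first exact: emeasurable_funM.
  by move=> w; exact: H_ge0.
have := E_H_lty SN mPhi Phi0 Phi1 mu0 T0.
by apply: lte_mul_pinfty.
Qed.

Lemma bounded_E_HH f g : measurable_fun setT f -> (forall s, 0 <= f s) -> bounded_upto T f ->
  measurable_fun setT g -> (forall s, 0 <= g s) -> bounded_upto T g ->
  \int[P]_w (H f w * H g w) < +oo.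
Proof.
move=> mf f0 bf mg g0 bg; have [c c0 Hc] := bounded_H mf f0 bf.
have [c' c'0 Hc'] := bounded_H mg g0 bg.
have mu_T : measurable_fun setT (upto T) := measurable_upto T; have u0 := upto_ge0 T.
have mHu := measurable_H mu_T u0; have mHf := measurable_H mf f0; have mHg := measurable_H mg g0.
have mHH : measurable_fun setT (fun w => H (upto T) w * H (upto T) w) by exact: emeasurable_funM.
have HH0 w : 0 <= H (upto T) w * H (upto T) w by apply: mule_ge0; exact: H_ge0.
apply: (@le_lt_trans _ _ ((c * c')%:E * \int[P]_w (H (upto T) w * H (upto T) w))).
  rewrite -ge0_integralZl//; last by rewrite lee_fin mulr_ge0.
  apply: ge0_le_integralT.
  - exact: emeasurable_funM.
  - exact: emeasurable_funM.
  - by move=> w; apply: mule_ge0; exact: H_ge0.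
  - move=> w; rewrite EFinM muleACA; apply: lee_pmul => //; exact: H_ge0.
have := E_H2_lty SN mPhi Phi0 Phi1 mu0 T0.
by apply: lte_mul_pinfty; rewrite // lee_fin mulr_ge0.
Qed.

Lemma H_Rop f w : measurable_fun setT f -> (forall s, 0 <= f s) ->
  H (Rop f) w = H f w + H (Pop (Rop f)) w.
Proof.
move=> mf f0.
have mF : measurable_fun setT (Rop f) by exact: (measurable_Rop mPhi Phi0).
have F0 s : 0 <= Rop f s by exact: (Rop_ge0 mPhi Phi0).
have mPF : measurable_fun setT (Pop (Rop f)) by exact: (measurable_Pop mPhi Phi0).
have PF0 s : 0 <= Pop (Rop f) s by exact: (Pop_ge0 Phi0).
apply: (eq_trans _ (HD w mf mPF f0 PF0)).
by apply: eq_integral => p _; rewrite /thin (Rop_fixpoint mPhi Phi0 mf f0).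
Qed.

Lemma bounded_first_moment f : measurable_fun setT f -> (forall s, 0 <= f s) -> bounded_upto T f ->
  \int[P]_w H f w = mu%:E * \int[mes1]_s pos_part (Rop f) s.
Proof.
move=> mf f0 bf; set F := Rop f.
have mF : measurable_fun setT F by exact: (measurable_Rop mPhi Phi0).
have F0 s : 0 <= F s by exact: (Rop_ge0 mPhi Phi0).
have bF : bounded_upto T F by exact: bounded_upto_Rop.
have mPF : measurable_fun setT (Pop F) by exact: (measurable_Pop mPhi Phi0).
have PF0 s : 0 <= Pop F s by exact: (Pop_ge0 Phi0).
have bPF : bounded_upto T (Pop F).
  by apply: bounded_upto_le bF => s; rewrite /F (Rop_fixpoint mPhi Phi0 mf f0) leeDr.
have h1 : \int[P]_w H F w = \int[P]_w H f w + \int[P]_w H (Pop F) w.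
  under eq_integral do rewrite H_Rop//.
  apply: ge0_integralD => //.
  - by move=> w _; exact: H_ge0.
  - exact: measurable_H.
  - by move=> w _; exact: H_ge0.
  - exact: measurable_H.
have pF0 : 0 <= mu%:E * \int[mes1]_s pos_part F s.
  apply: mule_ge0; first by rewrite lee_fin ltW.
  by apply: integral_ge0 => s _; rewrite /pos_part; case: ifPn.
have h2 : \int[P]_w H F w = mu%:E * \int[mes1]_s pos_part F s + \int[P]_w H (Pop F) w.
  rewrite (E_NI SN (measurable_thin plamoo mF)); last by move=> x; exact: thin_ge0.
  under eq_integral do rewrite (nuI_lamoo SN mPhi Phi0 mu0)//.
  set a := mu%:E * _.
  have aE : \int[P]_w (fun=> a) w = a.
    by rewrite integral_cst// [X in _ * X]probability_setT mule1.
  rewrite -{2}aE; apply: ge0_integralD => //.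
  - by move=> w _; exact: H_ge0.
  - exact: measurable_H.
(* The term to be cancelled is finite because [Pop F <= F] is bounded and vanishes after [T]. *)
have fin : \int[P]_w H (Pop F) w \is a fin_num.
  by rewrite ge0_fin_numE ?bounded_E_H//; apply: integral_ge0 => w _; exact: H_ge0.
by rewrite -[LHS](addeK _ fin) -h1 h2 addeK.
Qed.

Lemma E_mulDD (u p v q : Omega -> \bar R) :
  measurable_fun setT u -> measurable_fun setT p -> measurable_fun setT v -> measurable_fun setT q ->
  (forall w, 0 <= u w) -> (forall w, 0 <= p w) -> (forall w, 0 <= v w) -> (forall w, 0 <= q w) ->
  \int[P]_w ((u w + p w) * (v w + q w)) =
  \int[P]_w (u w * v w) + \int[P]_w (u w * q w) + (\int[P]_w (p w * v w) + \int[P]_w (p w * q w)).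
Proof.
move=> mu_ mp mv mq u0 p0 v0 q0.
have D (a b c : Omega -> \bar R) : measurable_fun setT a -> measurable_fun setT b -> measurable_fun setT c ->
  (forall w, 0 <= a w) -> (forall w, 0 <= b w) -> (forall w, 0 <= c w) ->
  \int[P]_w (a w * (b w + c w)) = \int[P]_w (a w * b w) + \int[P]_w (a w * c w).
  move=> ma mb mc a0 b0 c0.
  transitivity (\int[P]_w (a w * b w + a w * c w)).
    by apply: eq_integral => w _; rewrite ge0_muleDr.
  apply: ge0_integralD => //.
  - by move=> w _; exact: mule_ge0.
  - exact: emeasurable_funM.
  - by move=> w _; exact: mule_ge0.
  - exact: emeasurable_funM.
rewrite -D// -D//.
transitivity (\int[P]_w (u w * (v w + q w) + p w * (v w + q w))).
  by apply: eq_integral => w _; rewrite ge0_muleDl.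
have mvq : measurable_fun setT (fun w => v w + q w) by exact: emeasurable_funD.
have vq0 w : 0 <= v w + q w by exact: adde_ge0.
apply: ge0_integralD => //.
- by move=> w _; exact: mule_ge0.
- exact: emeasurable_funM.
- by move=> w _; exact: mule_ge0.
- exact: emeasurable_funM.
Qed.

(* The isometry for [R f], [R g] with [H (R f) = u + p], [nu (R f) = a + p],
   [H (R g) = v + q], [nu (R g) = b + q]; each variable is the expectation of the
   product spelled by its name. *)
Lemma cancel_cross_terms (uv uq pv pq ab aq pb m ub av : \bar R) :
  uv \is a fin_num -> uq \is a fin_num -> pv \is a fin_num -> pq \is a fin_num -> ab \is a fin_num ->
  aq \is a fin_num -> pb \is a fin_num -> m \is a fin_num -> ub = ab -> av = ab ->
  uv + uq + (pv + pq) + (ab + aq + (pb + pq)) = m + (ub + uq + (pb + pq) + (av + aq + (pv + pq))) ->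
  uv = ab + m.
Proof.
move=> h1 h2 h3 h4 h5 h6 h7 h8 -> ->; move: h1 h2 h3 h4 h5 h6 h7 h8.
case: uv => [uv||]//; case: uq => [uq||]//; case: pv => [pv||]//; case: pq => [pq||]//.
case: ab => [ab||]//; case: aq => [aq||]//; case: pb => [pb||]//; case: m => [m||]//.
by rewrite -!EFinD => _ _ _ _ _ _ _ _ [] h; congr (_%:E); move: h; exact: cancel_cross_terms_real.
Qed.

Lemma bounded_second_moment f g :
  measurable_fun setT f -> (forall s, 0 <= f s) -> bounded_upto T f ->
  measurable_fun setT g -> (forall s, 0 <= g s) -> bounded_upto T g ->
  \int[P]_w (H f w * H g w) =
  \int[P]_w H f w * \int[P]_w H g w + \int[P]_w H (fun s => Rop f s * Rop g s) w.
Proof.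
move=> mf f0 bf mg g0 bg.
have mF : measurable_fun setT (Rop f) by exact: (measurable_Rop mPhi Phi0).
have F0 s : 0 <= Rop f s by exact: (Rop_ge0 mPhi Phi0).
have bF : bounded_upto T (Rop f) by exact: bounded_upto_Rop.
have mPF : measurable_fun setT (Pop (Rop f)) by exact: (measurable_Pop mPhi Phi0).
have PF0 s : 0 <= Pop (Rop f) s by exact: (Pop_ge0 Phi0).
have bPF : bounded_upto T (Pop (Rop f)).
  by apply: bounded_upto_le bF => s; rewrite (Rop_fixpoint mPhi Phi0 mf f0) leeDr.
have mG : measurable_fun setT (Rop g) by exact: (measurable_Rop mPhi Phi0).
have G0 s : 0 <= Rop g s by exact: (Rop_ge0 mPhi Phi0).
have bG : bounded_upto T (Rop g) by exact: bounded_upto_Rop.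
have mPG : measurable_fun setT (Pop (Rop g)) by exact: (measurable_Pop mPhi Phi0).
have PG0 s : 0 <= Pop (Rop g) s by exact: (Pop_ge0 Phi0).
have bPG : bounded_upto T (Pop (Rop g)).
  by apply: bounded_upto_le bG => s; rewrite (Rop_fixpoint mPhi Phi0 mg g0) leeDr.
pose u := H f; pose p := H (Pop (Rop f)); pose v := H g; pose q := H (Pop (Rop g)).
pose a := \int[P]_w u w; pose b := \int[P]_w v w.
have mu_ : measurable_fun setT u := measurable_H mf f0.
have mp : measurable_fun setT p := measurable_H mPF PF0.
have mv : measurable_fun setT v := measurable_H mg g0.
have mq : measurable_fun setT q := measurable_H mPG PG0.
have u0 w : 0 <= u w := H_ge0 w f0.
have p0 w : 0 <= p w := H_ge0 w PF0.
have v0 w : 0 <= v w := H_ge0 w g0.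
have q0 w : 0 <= q w := H_ge0 w PG0.
have a0 : 0 <= a by exact: integral_ge0.
have b0 : 0 <= b by exact: integral_ge0.
have af : a \is a fin_num by rewrite (ge0_fin_numE a0); exact: bounded_E_H.
have bf' : b \is a fin_num by rewrite (ge0_fin_numE b0); exact: bounded_E_H.
have mK : measurable_fun setT (fun s => Rop f s * Rop g s) by exact: emeasurable_funM.
have K0 s : 0 <= Rop f s * Rop g s by exact: mule_ge0.
have tF := measurable_thin plamoo mF; have tG := measurable_thin plamoo mG.
have tF0 x : 0 <= thin lamoo (Rop f) x by exact: thin_ge0.
have tG0 x : 0 <= thin lamoo (Rop g) x by exact: thin_ge0.
have := isometry SN tF tF0 tG tG0.
have -> : (fun x => thin lamoo (Rop f) x * thin lamoo (Rop g) x) = thin lamoo (fun s => Rop f s * Rop g s).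
  by apply/funext => x; rewrite /thin muleACA acc_idem.
have HF w : H (Rop f) w = u w + p w by exact: H_Rop.
have HG w : H (Rop g) w = v w + q w by exact: H_Rop.
have LF w : L (Rop f) w = a + p w.
  by rewrite (nuI_lamoo SN mPhi Phi0 mu0)// /a bounded_first_moment.
have LG w : L (Rop g) w = b + q w.
  by rewrite (nuI_lamoo SN mPhi Phi0 mu0)// /b bounded_first_moment.
have E1 : \int[P]_w (H (Rop f) w * H (Rop g) w) = \int[P]_w ((u w + p w) * (v w + q w)).
  by apply: eq_integral => w _; rewrite HF HG.
have E2 : \int[P]_w (L (Rop f) w * L (Rop g) w) = \int[P]_w ((a + p w) * (b + q w)).
  by apply: eq_integral => w _; rewrite LF LG.
have E3 : \int[P]_w (H (Rop f) w * L (Rop g) w) = \int[P]_w ((u w + p w) * (b + q w)).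
  by apply: eq_integral => w _; rewrite HF LG.
have E4 : \int[P]_w (L (Rop f) w * H (Rop g) w) = \int[P]_w ((a + p w) * (v w + q w)).
  by apply: eq_integral => w _; rewrite LF HG.
have ma : measurable_fun setT ((fun=> a) : Omega -> \bar R) by exact: measurable_cst.
have mb : measurable_fun setT ((fun=> b) : Omega -> \bar R) by exact: measurable_cst.
rewrite (eq_trans E1 (E_mulDD mu_ mp mv mq u0 p0 v0 q0)).
rewrite (eq_trans E2 (E_mulDD ma mp mb mq (fun=> a0) p0 (fun=> b0) q0)).
rewrite (eq_trans E3 (E_mulDD mu_ mp mb mq u0 p0 (fun=> b0) q0)).
rewrite (eq_trans E4 (E_mulDD ma mp mv mq (fun=> a0) p0 v0 q0)).
have abE : \int[P]_w (a * b) = a * b.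
  by rewrite integral_cst// [X in _ * X]probability_setT mule1.
have finI (h : Omega -> \bar R) : (forall w, 0 <= h w) -> \int[P]_w h w < +oo -> \int[P]_w h w \is a fin_num.
  by move=> h0; rewrite ge0_fin_numE//; exact: integral_ge0.
have fin2 (h h' : R -> \bar R) : measurable_fun setT h -> (forall s, 0 <= h s) -> bounded_upto T h ->
  measurable_fun setT h' -> (forall s, 0 <= h' s) -> bounded_upto T h' -> \int[P]_w (H h w * H h' w) \is a fin_num.
  move=> mh h0 bh mh' h'0 bh'; apply: finI; last exact: bounded_E_HH.
  by move=> w; apply: mule_ge0; exact: H_ge0.
have fin1 (h : R -> \bar R) : measurable_fun setT h -> (forall s, 0 <= h s) -> bounded_upto T h ->
  \int[P]_w H h w \is a fin_num.
  move=> mh h0 bh; apply: finI; last exact: bounded_E_H.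
  by move=> w; exact: H_ge0.
have Zl (x : \bar R) (h : Omega -> \bar R) : measurable_fun setT h -> (forall w, 0 <= h w) -> 0 <= x ->
  \int[P]_w (x * h w) = x * \int[P]_w h w by move=> mh h0 x0; exact: ge0_integralZl.
have Zr (x : \bar R) (h : Omega -> \bar R) : measurable_fun setT h -> (forall w, 0 <= h w) -> 0 <= x ->
  \int[P]_w (h w * x) = \int[P]_w h w * x by move=> mh h0 x0; exact: ge0_integralZr.
move=> E.
suff : \int[P]_w (u w * v w) = \int[P]_w (a * b) + \int[P]_w H (fun s => Rop f s * Rop g s) w.
  by rewrite abE.
apply: cancel_cross_terms E.
- exact: fin2 mf f0 bf mg g0 bg.
- exact: fin2 mf f0 bf mPG PG0 bPG.
- exact: fin2 mPF PF0 bPF mg g0 bg.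
- exact: fin2 mPF PF0 bPF mPG PG0 bPG.
- by rewrite abE; exact: fin_numM af bf'.
- by rewrite (Zl a q mq q0 a0); exact: fin_numM af (fin1 _ mPG PG0 bPG).
- by rewrite (Zr b p mp p0 b0); exact: fin_numM (fin1 _ mPF PF0 bPF) bf'.
- apply: fin1 => //; exact: bounded_upto_mul.
- by rewrite (Zr b u mu_ u0 b0) abE.
- by rewrite (Zl a v mv v0 a0) abE.
Qed.

End upto_T.

(** The test function [Phi (s - _)] may be unbounded and is reached by truncation. Every term of the
    formulas is monotone in the test functions, so the limits exist, possibly infinite. *)
Definition trunc f n s : \bar R := mine (f s) n%:R%:E.

Lemma trunc_props T f : measurable_fun setT f -> (forall s, 0 <= f s) -> (forall s, (T < s)%R -> f s = 0) ->
  [/\ forall n, measurable_fun setT (trunc f n), forall n s, 0 <= trunc f n s,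
    forall s, nondecreasing_seq (trunc f ^~ s), forall s, trunc f n s @[n --> \oo] --> f s
    & forall n, bounded_upto T (trunc f n)].
Proof.
move=> mf f0 fT; split.
- by move=> n; apply: measurable_mine => //; exact: measurable_cst.
- by move=> n s; rewrite /trunc le_min f0 lee_fin ler0n.
- move=> s m n mn; rewrite /trunc le_min ge_min lexx/= ge_min lee_fin ler_nat mn orbT//.
- move=> s; rewrite /trunc; have := f0 s; case: (f s) => [r|_|//].
    rewrite lee_fin => r0; apply: cvg_near_cst; exists (Num.truncn r).+1 => // n /= rn.
    apply/min_idPl; rewrite lee_fin; apply/ltW/(lt_le_trans (truncnS_gt r)).
    by rewrite ler_nat.
  rewrite (_ : (fun n => _) = (fun n => n%:R%:E)); first by apply/cvgenyP.
  by apply/funext => n; rewrite min_r// leey.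
- move=> n; apply: bounded_uptoP; first by move=> s; rewrite /trunc le_min f0 lee_fin ler0n.
  exists n%:R => //; split => [s|s Ts]; first by rewrite /trunc ge_min lexx orbT.
  by rewrite /trunc fT// min_l// lee_fin.
Qed.

Variable T : R.
Hypothesis T0 : (0 <= T)%R.

Lemma first_moment_Rop f : measurable_fun setT f -> (forall s, 0 <= f s) ->
  (forall s, (T < s)%R -> f s = 0) -> \int[P]_w H f w = mu%:E * \int[mes1]_s pos_part (Rop f) s.
Proof.
move=> mf f0 fT; have [mt t0 ndt ct bt] := trunc_props mf f0 fT.
have c1 := E_H_cvg mt t0 ndt ct.
have rc := Rop_cvg mPhi Phi0 mt t0 ndt ct.
have mr n : measurable_fun setT (pos_part (Rop (trunc f n))).
  rewrite pos_partE; apply/(measurable_restrictT _ (measurable_itv _)); apply: measurable_funTS.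
  exact: (measurable_Rop mPhi Phi0).
have r0 n s : 0 <= pos_part (Rop (trunc f n)) s.
  by rewrite /pos_part; case: ifPn => // _; exact: (Rop_ge0 mPhi Phi0).
have c2 : \int[mes1]_s pos_part (Rop (trunc f n)) s @[n --> \oo] --> \int[mes1]_s pos_part (Rop f) s.
  apply: ge0_integral_cvg => //.
  - move=> s m n mn; have [nd _] := rc s; rewrite /pos_part.
    by case: ifPn => [_|_]; [exact: nd _ _ mn|exact: lexx].
  - by move=> s; rewrite /pos_part; case: ifPn => // _; [exact: (rc s).2|exact: cvg_cst].
have c3 : mu%:E * \int[mes1]_s pos_part (Rop (trunc f n)) s @[n --> \oo] -->
    mu%:E * \int[mes1]_s pos_part (Rop f) s by exact: cvgeZl.
apply: cvg_unique c1 _ => //.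
rewrite (_ : (fun n => _) = (fun n => mu%:E * \int[mes1]_s pos_part (Rop (trunc f n)) s))//.
by apply/funext => n; exact: (bounded_first_moment T0).
Qed.

Lemma second_moment f g :
  measurable_fun setT f -> (forall s, 0 <= f s) -> (forall s, (T < s)%R -> f s = 0) ->
  measurable_fun setT g -> (forall s, 0 <= g s) -> (forall s, (T < s)%R -> g s = 0) ->
  \int[P]_w (H f w * H g w) =
  \int[P]_w H f w * \int[P]_w H g w + \int[P]_w H (fun s => Rop f s * Rop g s) w.
Proof.
move=> mf f0 fT mg g0 gT.
have [mt t0 ndt ct bt] := trunc_props mf f0 fT.
have [mt' t0' ndt' ct' bt'] := trunc_props mg g0 gT.
have ndH (h : R -> \bar R) w : measurable_fun setT h -> (forall s, 0 <= h s) -> (forall s, (T < s)%R -> h s = 0) ->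
    nondecreasing_seq (fun n => H (trunc h n) w).
  move=> mh h0 hT; have [mt1 t01 ndt1 _ _] := trunc_props mh h0 hT.
  by move=> m n mn; apply: le_H => // s; exact: ndt1.
have ndEH (h : R -> \bar R) : measurable_fun setT h -> (forall s, 0 <= h s) -> (forall s, (T < s)%R -> h s = 0) ->
    nondecreasing_seq (fun n => \int[P]_w H (trunc h n) w).
  move=> mh h0 hT; have [mt1 t01 ndt1 _ _] := trunc_props mh h0 hT.
  move=> m n mn; apply: ge0_le_integralT.
  - exact: measurable_H.
  - exact: measurable_H.
  - by move=> w; exact: H_ge0.
  - by move=> w; exact: ndH.
have c1 : \int[P]_w (H (trunc f n) w * H (trunc g n) w) @[n --> \oo] --> \int[P]_w (H f w * H g w).
  apply: ge0_integral_cvg.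
  - by move=> n; apply: emeasurable_funM; exact: measurable_H.
  - by move=> n w; apply: mule_ge0; exact: H_ge0.
  - by move=> w m n mn; apply: lee_pmul; [exact: H_ge0|exact: H_ge0|exact: ndH|exact: ndH].
  - move=> w; apply: ge0_cvge_nondecreasing_mul.
    + exact: ndH.
    + exact: ndH.
    + by move=> n; exact: H_ge0.
    + by move=> n; exact: H_ge0.
    + exact: H_cvg.
    + exact: H_cvg.
have c2 : \int[P]_w H (trunc f n) w * \int[P]_w H (trunc g n) w @[n --> \oo] -->
    \int[P]_w H f w * \int[P]_w H g w.
  apply: ge0_cvge_nondecreasing_mul.
  - exact: ndEH.
  - exact: ndEH.
  - by move=> n; apply: integral_ge0 => w _; exact: H_ge0.
  - by move=> n; apply: integral_ge0 => w _; exact: H_ge0.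
  - exact: E_H_cvg.
  - exact: E_H_cvg.
have rc := Rop_cvg mPhi Phi0 mt t0 ndt ct.
have rc' := Rop_cvg mPhi Phi0 mt' t0' ndt' ct'.
have mR n : measurable_fun setT (Rop (trunc f n)) by exact: (measurable_Rop mPhi Phi0).
have mR' n : measurable_fun setT (Rop (trunc g n)) by exact: (measurable_Rop mPhi Phi0).
have R0 n s : 0 <= Rop (trunc f n) s by exact: (Rop_ge0 mPhi Phi0).
have R0' n s : 0 <= Rop (trunc g n) s by exact: (Rop_ge0 mPhi Phi0).
have c3 : \int[P]_w H (fun s => Rop (trunc f n) s * Rop (trunc g n) s) w @[n --> \oo] -->
    \int[P]_w H (fun s => Rop f s * Rop g s) w.
  apply: (E_H_cvg (f_ := fun n s => Rop (trunc f n) s * Rop (trunc g n) s)).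
  - by move=> n; exact: emeasurable_funM.
  - by move=> n s; exact: mule_ge0.
  - move=> s m n mn; have [nd _] := rc s; have [nd' _] := rc' s.
    exact: lee_pmul (R0 m s) (R0' m s) (nd _ _ mn) (nd' _ _ mn).
  - move=> s; have [nd cv] := rc s; have [nd' cv'] := rc' s.
    exact: ge0_cvge_nondecreasing_mul nd nd' (R0 ^~ s) (R0' ^~ s) cv cv'.
apply: cvg_unique c1 _ => //.
rewrite (_ : (fun n => \int[P]_w (H (trunc f n) w * H (trunc g n) w)) = (fun n =>
  \int[P]_w H (trunc f n) w * \int[P]_w H (trunc g n) w +
  \int[P]_w H (fun s => Rop (trunc f n) s * Rop (trunc g n) s) w)).
  apply: cvgeD => //; apply: ge0_adde_def; rewrite inE.
    by apply: mule_ge0; apply: integral_ge0 => w _; exact: H_ge0.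
  apply: integral_ge0 => w _; apply: H_ge0 => s; apply: mule_ge0; exact: (Rop_ge0 mPhi Phi0).
by apply/funext => n; exact: (bounded_second_moment T0).
Qed.

(** Tonelli moves the resolvent from the test function to the intensity: [mu] times the factor of
    [pos_part f t] on the right is the mean intensity at time [t]. *)
Lemma integral_pos_Rop f : measurable_fun setT f -> (forall s, 0 <= f s) ->
  \int[mes1]_s pos_part (Rop f) s =
  \int[mes1]_t (pos_part f t * (1 + \int[mes1]_s pos_part (fun s => psi (t - s)%R) s)).
Proof.
move=> mf f0.
pose u (s : R) : \bar R := pos_part (fun=> 1) s.
have mu_ : measurable_fun setT u.
  rewrite /u pos_partE; apply/(measurable_restrictT _ (measurable_itv _)).
  exact: measurable_cst.
have u0 s : 0 <= u s by rewrite /u /pos_part; case: ifPn.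
have pu (h : R -> \bar R) s : pos_part h s = u s * h s.
  by rewrite /u /pos_part; case: ifPn; rewrite ?mul1e ?mul0e.
pose K (z : R * R) := u z.1 * (psi (z.2 - z.1)%R * f z.2).
have mK : measurable_fun setT K.
  apply: emeasurable_funM; first exact: measurableT_comp.
  apply: emeasurable_funM; last exact: measurableT_comp.
  by apply: measurableT_comp => //; exact: measurable_funB.
have K0 z : 0 <= K z by apply: mule_ge0 => //; exact: mule_ge0.
have mK1 := measurable_ge0_tonelli (@sigma_finite_mes1 R) mK K0.
have muf : measurable_fun setT (fun s => u s * f s) by exact: emeasurable_funM.
have mps (s : R) : measurable_fun setT (fun t : R => psi (t - s)%R).
  by apply: measurableT_comp => //; exact: measurable_funB.
have mpsr (s : R) : measurable_fun setT (fun t : R => psi (s - t)%R).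
  by apply: measurableT_comp => //; exact: measurable_funB.
transitivity (\int[mes1]_s (u s * f s + \int[mes1]_t K (s, t))).
  apply: eq_integral => s _; rewrite pu /Rop ge0_muleDr//; last first.
    by apply: integral_ge0 => t _; exact: mule_ge0.
  apply: eq_adde => //; rewrite -ge0_integralZl//.
  - exact: emeasurable_funM.
  - by move=> t _; exact: mule_ge0.
transitivity (\int[mes1]_s (u s * f s) + \int[mes1]_s \int[mes1]_t K (s, t)).
  apply: ge0_integralD => //.
  - by move=> s _; exact: mule_ge0.
  - by move=> s _; exact: integral_ge0.
rewrite (ge0_tonelli (@sigma_finite_mes1 R) (@sigma_finite_mes1 R) mK K0).
have mKt : measurable_fun setT (fun t => \int[mes1]_s K (s, t)).
  have mK' : measurable_fun setT (fun z : R * R => K (z.2, z.1)).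
    by apply: measurableT_comp => //; exact: measurable_swap.
  exact: (measurable_ge0_tonelli (f := fun z : R * R => K (z.2, z.1)) (@sigma_finite_mes1 R) mK').
transitivity (\int[mes1]_t (u t * f t + \int[mes1]_s K (s, t))).
  apply/esym/ge0_integralD => //.
  - by move=> s _; exact: mule_ge0.
  - by move=> s _; exact: integral_ge0.
apply: eq_integral => t _; rewrite pu ge0_muleDr//; last first.
  by apply: integral_ge0 => s _; rewrite pu; exact: mule_ge0.
rewrite mule1; apply: eq_adde => //.
transitivity (\int[mes1]_s (f t * pos_part (fun s => psi (t - s)%R) s)).
  by apply: eq_integral => s _; rewrite pu /K /= muleCA [RHS]muleCA muleC -muleA.
rewrite ge0_integralZl//; last 2 first.
- by rewrite (_ : pos_part _ = fun s => u s * psi (t - s)%R); [exact: emeasurable_funM|apply/funext => s; exact: pu].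
- by move=> s _; rewrite pu; exact: mule_ge0.
(* At a nonpositive [t] the integral of [psi] vanishes along with [u t], as no positive time
   precedes [t]. *)
rewrite /u /pos_part; case: ifPn => [_|]; first by rewrite mul1e.
rewrite -leNgt => t0; rewrite !mul0e integral0_eq ?mule0// => s _.
case: ifPn => // s0; rewrite /pos_Psi /pos_part subr_gt0 ifF//.
by apply/negbTE; rewrite -leNgt (le_trans t0)// ltW.
Qed.

Lemma first_moment f : measurable_fun setT f -> (forall s, 0 <= f s) -> (forall s, (T < s)%R -> f s = 0) ->
  \int[P]_w H f w =
  mu%:E * \int[mes1]_t (pos_part f t * (1 + \int[mes1]_s pos_part (fun s => psi (t - s)%R) s)).
Proof. by move=> mf f0 fT; rewrite first_moment_Rop// integral_pos_Rop. Qed.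

End moments.

(** * Uniqueness *)

Section first_time.
Context {R : realType}.
Notation R2 := (R * R)%type.
Variable m : {measure set R2 -> \bar R}.
Local Open Scope ereal_scope.

Definition until (t : R) : set R2 := [set p | (p.1 <= t)%R].

Lemma measurable_until t : measurable (until t).
Proof.
rewrite (_ : until t = `]-oo, t]%classic `*` setT); first by apply: measurableX.
by apply/seteqP; split => [[x y]|[x y] []] /=; rewrite /until /= in_itv.
Qed.

Hypothesis atoms : {ae m, forall p, 1 <= m [set p]}.

(** A set not contained in the exceptional null set has a point that is an atom of mass at least
    1. *)
Lemma atomic_ge1 (B : set R2) : measurable B -> m B = 0 \/ 1 <= m B.
Proof.
move=> mB; have [Z [mZ Z0 hZ]] := atoms.
have [BZ|] := pselect (B `<=` Z).
  by left; apply/eqP; rewrite eq_le measure_ge0 andbT -Z0 le_measure// inE.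
move=> /existsNP[p /not_implyP[Bp Zp]]; right.
have : 1 <= m [set p] by apply: contrapT => h; apply: Zp; exact: hZ.
move=> /le_trans; apply; apply: le_measure; rewrite ?inE//.
  rewrite (_ : [set p] = [set p.1] `*` [set p.2]); first exact: measurableX.
  by case: p {Bp Zp} => x y; apply/seteqP; split => [_ ->|[x' y'] [/= -> ->]].
by move=> q ->.
Qed.

(* The points of [D] cannot accumulate, so if [D] had any there would be a first time. *)
Lemma first_time_null (D : set R2) : measurable D -> D `<=` [set p | (0 < p.1)%R] ->
  (forall T, m (D `&` until T) < +oo) ->
  (forall t, (0 < t)%R -> m (D `&` [set p | (p.1 < t)%R]) = 0 -> m (D `&` [set p | p.1 = t]) = 0) ->
  m D = 0.
Proof.
move=> mD D0 Dfin Dt.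
have mDu t : measurable (D `&` until t) by apply: measurableI => //; exact: measurable_until.
have mono s t : (s <= t)%R -> m (D `&` until s) <= m (D `&` until t).
  move=> st; apply: le_measure; rewrite ?inE// => p [Dp ps]; split => //.
  exact: le_trans ps st.
have [//|D1] := atomic_ge1 mD.
pose S := [set t | 1 <= m (D `&` until t)].
have neg t : ~ S t -> m (D `&` until t) = 0 by case: (atomic_ge1 (mDu t)).
have S0 t : S t -> (0 <= t)%R.
  move=> St; rewrite leNgt; apply/negP => t0.
  move: St; rewrite /S /= (_ : _ `&` _ = set0) ?measure0 ?lte_fin// => [|]; last first.
    by apply/seteqP; split => // p [/D0/= p0 pt]; have := lt_le_trans p0 (le_trans pt (ltW t0)); rewrite ltxx.
  by rewrite leNgt lte_fin ltr01.
have ntn (F : nat -> R) : (forall n, ~ S (F n)) -> m (\bigcup_n (D `&` until (F n))) = 0.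
  move=> h; have : m.-negligible (\bigcup_n (D `&` until (F n))).
    by apply: negligible_bigcup => n; apply/negligibleP => //; exact/neg/h.
  by move/negligibleP; apply; exact: bigcup_measurable.
have [t0 St0] : exists t, S t.
  apply/not_existsP => h; have := ntn (fun n => n%:R) (fun n => h _).
  rewrite (_ : \bigcup_n _ = D); first by move=> e; move: D1; rewrite e leNgt lte_fin ltr01.
  apply/seteqP; split => [p [n _ []] //|p Dp].
  by exists (Num.truncn p.1).+1 => //; split => //; exact/ltW/truncnS_gt.
have lbS : has_lbound S by exists 0%R => t; exact: S0.
pose tau := inf S.
have tau_lb t : S t -> (tau <= t)%R by move=> St; exact: ge_inf.
have Stau n : S (tau + n.+1%:R^-1)%R.
  have [t St] : exists2 t, S t & (t < inf S + n.+1%:R^-1)%R.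
    by apply: inf_adherent => //; split => //; exists t0.
  by move=> /ltW/mono h; exact: le_trans h.
(* Finite mass up to each time gives continuity from above, so the infimum of [S] belongs to [S]. *)
have ctau : m (D `&` until (tau + n.+1%:R^-1)%R) @[n --> \oo] --> m (\bigcap_n (D `&` until (tau + n.+1%:R^-1)%R)).
  apply: (nonincreasing_cvg_mu (F := fun n => D `&` until (tau + n.+1%:R^-1)%R)).
  - exact: Dfin.
  - by move=> n; exact: mDu.
  - exact: bigcapT_measurable.
  - move=> i j ij; apply/subsetPset => p [Dp pu]; split => //.
    rewrite /until /= (le_trans pu)// lerD2l lef_pV2 ?posrE// ler_nat ltnS//.
have capE : \bigcap_n (D `&` until (tau + n.+1%:R^-1)%R) = D `&` until tau.
  apply/seteqP; split => [p h|p [Dp pt] n _]; last first.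
    by split => //; rewrite /until /= (le_trans pt)// lerDl.
  split; first by case: (h 0%N Logic.I).
  rewrite /until /=; apply/ler_addgt0Pr => e e0.
  have [_ /=] := h (Num.truncn e^-1) Logic.I.
  rewrite /until /= => /le_trans; apply; rewrite lerD2l.
  by rewrite -[leRHS]invrK lef_pV2 ?posrE ?invr_gt0// ltW// truncnS_gt.
have Stau' : 1 <= m (D `&` until tau).
  rewrite -capE -(cvg_lim _ ctau)//; apply: lime_ge; first by apply/cvg_ex; eexists; exact: ctau.
  by apply: nearW => n; exact: Stau.
have tau0 : (0 < tau)%R.
  rewrite lt_neqAle (S0 _ Stau') andbT; apply/eqP => t0'.
  move: Stau'; rewrite -t0' (_ : _ `&` _ = set0).
    by rewrite measure0 leNgt lte_fin ltr01.
  by apply/seteqP; split => // p [/D0/= p0]; rewrite /until /= leNgt p0.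
have before0 : m (D `&` [set p | (p.1 < tau)%R]) = 0.
  rewrite (_ : _ `&` _ = \bigcup_n (D `&` until (tau - n.+1%:R^-1)%R)).
    apply: ntn => n /tau_lb; rewrite leNgt => /negP; apply.
    by rewrite ltrBlDr ltrDl invr_gt0.
  apply/seteqP; split => [p [Dp /= pt]|p [n _ [Dp]]]; last first.
    rewrite /until /= => h; split => //=; apply: le_lt_trans h _.
    by rewrite ltrBlDr ltrDl invr_gt0.
  exists (Num.truncn (tau - p.1)^-1) => //; split => //.
  have h : (0 < tau - p.1)%R by rewrite subr_gt0.
  rewrite /until /= lerBrDr addrC -lerBrDr.
  by rewrite -[leRHS]invrK lef_pV2 ?posrE ?invr_gt0// ltW// truncnS_gt.
have at0 := Dt _ tau0 before0.
have m1 : measurable (D `&` [set p : R2 | (p.1 < tau)%R]).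
  apply: measurableI => //; exact: (measurable_before (tau, 0%R)).
have m2 : measurable (D `&` [set p : R2 | p.1 = tau]).
  apply: measurableI => //; exact: (measurable_line (tau, 0%R)).
have : m (D `&` until tau) <= 0.
  rewrite -[leRHS]adde0 -{1}before0 -at0; apply: le_trans (measureU2 _ m1 m2).
  apply: le_measure; rewrite ?inE//; first exact: measurableU.
  move=> p [Dp]; rewrite /until /= le_eqVlt => /predU1P[->|h]; [by right|by left].
by move=> /(le_trans Stau'); rewrite leNgt lte_fin ltr01.
Qed.

End first_time.

Section indic.
Context {R : realType} (T : Type).
Lemma indic_in (D : set T) (x : T) : D x -> \1_D x = 1 :> R.
Proof. by move=> Dx; rewrite indicE mem_set. Qed.
Lemma indic_notin (D : set T) (x : T) : ~ D x -> \1_D x = 0 :> R.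
Proof. by move=> Dx; rewrite indicE memNset. Qed.
End indic.

(** * Finitely many points below a finite intensity *)

Section finite_mass.
Context {R : realType}.
Notation R2 := (R * R)%type.
Variable m : {measure set R2 -> \bar R}.
Hypothesis fm : locfin m.
Local Open Scope ereal_scope.
Variable f : R -> \bar R.
Hypotheses (mf : measurable_fun setT f) (f0 : forall x, 0 <= f x).
Variable c : R.
Hypotheses (fc : forall x, (c < x)%R -> f x = 0) (fneg : forall x, (x <= 0)%R -> f x = 0).
Hypotheses (f1 : forall x, f x <= 1) (fpos : 0 < \int[mes1]_x f x).
Variable A : set R2.
Hypotheses (mA : measurable A) (A0 : A `<=` [set p | (0 < p.1)%R]).
Hypothesis afin : forall t, (0 <= t)%R -> \int[m]_p (f (t - p.1)%R * (\1_A p)%:E) < +oo.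

Let a t := \int[m]_p (f (t - p.1)%R * (\1_A p)%:E).
Let K (z : R * R2) := f (z.1 - z.2.1)%R * (\1_A z.2)%:E.
Let mK : measurable_fun setT K.
Proof.
apply: emeasurable_funM.
  apply: measurableT_comp => //; apply: measurable_funB; first exact: measurable_fst.
  by apply: measurableT_comp; [exact: measurable_fst|exact: measurable_snd].
by apply/measurable_EFinP; apply: measurableT_comp; [exact: measurable_indic|exact: measurable_snd].
Qed.
Let K0 z : 0 <= K z. Proof. by apply: mule_ge0 => //; rewrite lee_fin. Qed.
Let ma : measurable_fun setT a.
Proof. exact: (measurable_ge0_tonelli (locfin_sigma_finite fm) mK K0). Qed.
Let a0 t : 0 <= a t. Proof. by apply: integral_ge0 => p _; exact: (K0 (t, p)). Qed.

(* The finite function [a] is at most some [M] off a set of small Lebesgue measure, and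
   each point of [A] contributes a definite amount to the integral of [a] over the
   remaining times. *)
Lemma mass_until_lty T : m (A `&` until T) < +oo.
Proof.
have [T0|T0] := leP T 0%R.
  rewrite (_ : _ `&` _ = set0) ?measure0//.
  by apply/seteqP; split => // p [/A0/= p0]; rewrite /until /= leNgt (le_lt_trans T0).
(* A point of time in []0, T]] acts through [f] within this interval only, since [f] vanishes beyond
   [c] and at nonpositive arguments. *)
pose S := `[0%R, (T + c)%R]%classic.
pose E n := S `&` [set t | n%:R%:E < a t].
have mS : measurable S by exact: measurable_itv.
have mE n : measurable (E n).
  exact: (measurable_lte mS (measurable_cst (n%:R%:E : \bar R)) (measurable_funTS ma)).
have Sfin : mes1 S < +oo.
  rewrite (_ : mes1 S = @lebesgue_measure R S)// lebesgue_measure_itv/=.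
  by case: ifPn => _; rewrite ?ltry// -EFinB ltry.
have cE : mes1 (E n) @[n --> \oo] --> mes1 (\bigcap_n E n).
  apply: nonincreasing_cvg_mu => //.
  - by apply: le_lt_trans Sfin; apply: le_measure; rewrite ?inE// => t [].
  - exact: bigcapT_measurable.
  - move=> i j ij; apply/subsetPset => t [St /= h]; split => //=; apply: le_lt_trans h.
    by rewrite lee_fin ler_nat.
have capE : \bigcap_n E n = set0.
  apply/seteqP; split => // t h; have [+ _] := h 0%N Logic.I.
  rewrite /S /= in_itv/= => /andP[t0 _].
  have := afin t0; rewrite -/(a t); have := a0 t.
  case at_: (a t) => [r||] // r0 _.
  have [_ /=] := h (Num.truncn r).+1 Logic.I.
  by rewrite at_ lte_fin ltNge ltW// truncnS_gt.
rewrite capE measure0 in cE.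
pose kap := \int[mes1]_x f x.
(* As [f <= 1], discarding a set of times of length at most [k] costs a point at most [k] of its
   total contribution [kap]; at least [k] remains. *)
have [k k0 kle] : exists2 k : R, (0 < k)%R & (k + k)%:E <= kap.
  have : 0 < kap by [].
  case: kap => [r|_|]; [|by exists 1%R; rewrite ?leey|by rewrite ltNge leNye].
  rewrite lte_fin => r0; exists (r / 2)%R; first by rewrite divr_gt0.
  by rewrite lee_fin; lra.
have [M ME] : exists M, mes1 (E M) <= k%:E.
  apply/not_existsP => h.
  have : k%:E <= limn (fun n => mes1 (E n)).
    apply: lime_ge; first by apply/cvg_ex; exists 0; exact: cE.
    by apply: nearW => n; rewrite leNgt; apply/negP => /ltW; exact: h.
  by rewrite (cvg_lim _ cE)// lee_fin leNgt k0.
pose B := S `\` E M.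
have mB : measurable B by exact: measurableD.
have BM t : B t -> a t <= M%:R%:E.
  by move=> [St h]; rewrite leNgt; apply/negP => h'; apply: h.
have mfs (s : R) : measurable_fun setT (fun t : R => f (t - s)%R).
  by apply: measurableT_comp => //; exact: measurable_funB.
have m1B (D : set R) : measurable D -> measurable_fun setT (fun t : R => (\1_D t : R)%:E).
  by move=> mD; apply/measurable_EFinP; exact: measurable_indic.
have ind1 (D : set R) : measurable D -> mes1 D = \int[mes1]_t (\1_D t : R)%:E.
  by move=> mD; rewrite integral_indic// setIT.
have indm (D : set R2) : measurable D -> m D = \int[m]_p (\1_D p : R)%:E.
  by move=> mD; rewrite integral_indic// setIT.
have low s : (0 < s <= T)%R -> k%:E <= \int[mes1]_t ((\1_B t)%:E * f (t - s)%R).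
  move=> /andP[s0 sT].
  have h : kap <= \int[mes1]_t ((\1_B t)%:E * f (t - s)%R) + mes1 (E M).
    rewrite /kap -(integral_translate s mf f0).
    rewrite (ind1 _ (mE M)).
    have mI : measurable_fun setT (fun t : R => (\1_B t)%:E * f (t - s)%R).
      by apply: emeasurable_funM => //; exact: m1B.
    have mI' := m1B _ (mE M).
    have <- : \int[mes1]_t ((\1_B t)%:E * f (t - s)%R + (\1_(E M) t : R)%:E) =
       \int[mes1]_t ((\1_B t)%:E * f (t - s)%R) + \int[mes1]_t (\1_(E M) t : R)%:E.
      by apply: ge0_integralD => // t _; exact: mule_ge0.
    apply: ge0_le_integralT => //; first exact: emeasurable_funD.
    move=> t; have [tS|tS] := pselect (S t); last first.
      rewrite (_ : f (t - s)%R = 0).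
        by apply: adde_ge0; [rewrite mule0|rewrite lee_fin].
      have [ts|ts] := leP t s; first by rewrite fneg// subr_le0.
      rewrite fc// ltNge; apply/negP => h; apply: tS; rewrite /S /= in_itv/=.
      by rewrite (ltW (lt_trans s0 ts))/=; move: h sT; lra.
    have [tE|tE] := pselect (E M t).
      rewrite (@indic_in _ _ (E M))//.
      apply: (le_trans (f1 _)); rewrite leeDr//; exact: mule_ge0.
    by rewrite (@indic_in _ _ B)// mul1e leeDl.
  have hk : (k + k)%:E <= \int[mes1]_t ((\1_B t)%:E * f (t - s)%R) + k%:E.
    by apply: (le_trans kle); apply: (le_trans h); rewrite leeD2l.
  by move: hk; rewrite EFinD leeD2rE.
pose G (z : R * R2) := (\1_B z.1 : R)%:E * ((\1_(until T) z.2 : R)%:E * K z).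
have mG : measurable_fun setT G.
  apply: emeasurable_funM; first exact: measurableT_comp (m1B _ mB) measurable_fst.
  apply: emeasurable_funM => //; apply/measurable_EFinP.
  by apply: measurableT_comp; [apply: measurable_indic; exact: measurable_until|exact: measurable_snd].
have G0 z : 0 <= G z.
  by apply: mule_ge0; [rewrite lee_fin|apply: mule_ge0; [rewrite lee_fin|]].
have sf := locfin_sigma_finite fm.
have up : \int[mes1]_t \int[m]_p G (t, p) <= M%:R%:E * mes1 B.
  rewrite (ind1 _ mB) -ge0_integralZl//; last exact: m1B.
  apply: ge0_le_integralT => //.
  - exact: (measurable_ge0_tonelli sf mG G0).
  - by apply: emeasurable_funM => //; exact: m1B.
  - by move=> t; apply: integral_ge0 => p _; exact: G0.
  move=> t; have [tB|tB] := pselect (B t); last first.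
    rewrite integral0_eq ?mule_ge0 ?lee_fin// => p _.
    by rewrite /G /= (@indic_notin _ _ B)// mul0e.
  rewrite (@indic_in _ _ B)// mule1; apply: le_trans (BM t tB).
  apply: ge0_le_integralT.
  - by apply: (measurableT_comp mG); exact: measurable_pair1.
  - have mKt : measurable_fun setT (fun p => K (t, p)).
      by apply: (measurableT_comp mK); exact: measurable_pair1.
    exact: mKt.
  - by move=> p; exact: G0.
  - move=> p; rewrite /G /= (@indic_in _ _ B)// mul1e -[leRHS]mul1e; apply: lee_wpmul2r; first exact: K0.
    by rewrite lee_fin indicE; case: (_ \in _).
have lo : k%:E * m (A `&` until T) <= \int[m]_p \int[mes1]_t G (t, p).
  have mAu : measurable (A `&` until T) by apply: measurableI => //; exact: measurable_until.
  rewrite (indm _ mAu) -ge0_integralZl//; last 2 first.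
  - by apply/measurable_EFinP; exact: measurable_indic.
  - by rewrite lee_fin ltW.
  apply: ge0_le_integralT => //.
  - by apply: emeasurable_funM => //; apply/measurable_EFinP; exact: measurable_indic.
  - have mG' : measurable_fun setT (fun z : R2 * R => G (z.2, z.1)).
      by apply: measurableT_comp => //; exact: measurable_swap.
    exact: (measurable_ge0_tonelli (f := fun z : R2 * R => G (z.2, z.1)) (@sigma_finite_mes1 R) mG').
  - by move=> p; rewrite mule_ge0// ?lee_fin// ltW.
  move=> p; have [[pA pT]|pn] := pselect ((A `&` until T) p); last first.
    by rewrite (@indic_notin _ _ (A `&` until T))// mule0; apply: integral_ge0 => t _; exact: G0.
  rewrite (@indic_in _ _ (A `&` until T))// mule1 (_ : \int[mes1]_t _ = \int[mes1]_t ((\1_B t)%:E * f (t - p.1)%R)).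
    by apply: low; rewrite (A0 pA).
  apply: eq_integral => t _; rewrite /G /K/= (@indic_in _ _ A)// (@indic_in _ _ (until T))//.
  by rewrite mul1e mule1.
have := le_trans lo (_ : _ <= M%:R%:E * mes1 B).
rewrite -(ge0_tonelli (@sigma_finite_mes1 R) sf mG G0) => /(_ up) h.
have BS : mes1 B < +oo by apply: le_lt_trans Sfin; apply: le_measure; rewrite ?inE// => t [].
have : k%:E * m (A `&` until T) < +oo.
  by apply: (le_lt_trans h); apply: lte_mul_pinfty => //; rewrite lee_fin.
have := measure_ge0 m (A `&` until T).
case: (m _) => [r _ _|_|//]; first exact: ltry.
by rewrite gt0_muley.
Qed.

End finite_mass.

(** * Identification of a given solution with the minimal one *)

Section identification.
Context {R : realType} d (Omega : measurableType d) (P : probability Omega R).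
Notation R2 := (R * R)%type.
Variable N : Omega -> {measure set R2 -> \bar R}.
Hypothesis SN : simple_prm P N.
Let fN w : locfin (N w). Proof. by case: SN. Qed.
Notation PT := (PT N).
Variable Phi : R -> R.
Hypothesis mPhi : measurable_fun (`[0%R, +oo[%classic : set R) Phi.
Hypothesis Phi0 : forall x, 0 <= x -> 0 <= Phi x.
Hypothesis Phi1 : (\int[leb]_(x in (`[0%R, +oo[%classic : set R)) (Phi x)%:E < 1)%E.
Variable mu : R.
Hypothesis mu0 : 0 < mu.
Variable lam : Omega -> R -> R.
Hypothesis mlam : measurable_fun ([set: Omega] `*` (`[0%R, +oo[%classic : set R))
    (fun p : Omega * R => lam p.1 p.2).
Local Open Scope ereal_scope.
Notation phi := (pos_Phi Phi).
Notation rho := (rho Phi).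
Notation lamn := (lamn N Phi mu).
Notation lamoo := (lamoo N Phi mu).
Notation H l f := (NI N (thin l f)).

Let plamn n : pred_int N (lamn n) := pred_lamn SN mPhi Phi0 mu0 n.
Let plamoo : pred_int N lamoo := pred_lamoo SN mPhi Phi0 mu0.
Let mphi : measurable_fun setT phi := measurable_phi mPhi.
Let phi0 x : 0 <= phi x := phi_ge0 Phi0 x.
Let mphis s : measurable_fun setT (fun r : R => phi (s - r)%R).
Proof. by apply: measurableT_comp; [exact: mphi|exact: measurable_funB]. Qed.
Let mphis2 (s : R) : measurable_fun setT (fun p : R2 => phi (s - p.1)%R).
Proof. by apply: (measurableT_comp (mphis s)); exact: measurable_fst. Qed.

Definition below w : set R2 := [set p | [/\ (0 < p.1)%R, (0 <= p.2)%R & (p.2 <= lam w p.1)%R]].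

Lemma measurable_below w : measurable (below w).
Proof.
pose g (s : R) : R := ((fun p : Omega * R => lam p.1 p.2) \_ ([set: Omega] `*` (`[0%R, +oo[%classic : set R))) (w, s).
have mD : measurable ([set: Omega] `*` (`[0%R, +oo[%classic : set R)) by exact: measurableX.
have mg : measurable_fun setT g.
  apply: (@measurableT_comp _ _ _ _ _ _ _ _ (fun s : R => (w, s)) ((measurable_restrictT _ mD).1 mlam)).
  exact: measurable_pair1.
have mS (A B : R2 -> R) : measurable_fun setT A -> measurable_fun setT B ->
    measurable [set p : R2 | (A p < B p)%R].
  move=> mA mB; rewrite -[X in measurable X]setTI.
  exact: measurable_fun_ltr mA mB measurableT [set true] _.
have mS' (A B : R2 -> R) : measurable_fun setT A -> measurable_fun setT B ->
    measurable [set p : R2 | (A p <= B p)%R].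
  move=> mA mB; rewrite -[X in measurable X]setTI.
  exact: measurable_fun_ler mA mB measurableT [set true] _.
rewrite (_ : below w = [set p : R2 | (0 < p.1)%R] `&` ([set p : R2 | (0 <= p.2)%R] `&` [set p : R2 | (p.2 <= g p.1)%R])).
  apply: measurableI; first by apply: mS; [exact: measurable_cst|exact: measurable_fst].
  apply: measurableI; first by apply: mS'; [exact: measurable_cst|exact: measurable_snd].
  by apply: mS'; [exact: measurable_snd|apply: (measurableT_comp mg); exact: measurable_fst].
have gE s : (0 < s)%R -> g s = lam w s.
  by move=> s0; rewrite /g patchE ifT// inE; split => //=; rewrite in_itv/= andbT ltW.
by apply/seteqP; split => p /=; [move=> [a b c]|move=> [/= a [b c]]]; move: c; rewrite gE.
Qed.

Lemma XzE (zeta : R -> R) t w : Xz N lam zeta t w =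
  \int[N w]_p (pos_part (fun x => (zeta x)%:E) (t - p.1)%R * (\1_(below w) p : R)%:E).
Proof.
rewrite /Xz integral_mkcond; apply: eq_integral => p _; rewrite patchE.
have [p1|p1] := pselect (0 < p.1)%R; last first.
  rewrite ifF; last by apply/negbTE; rewrite notin_setE /= => -[/andP[]].
  by rewrite (@indic_notin _ _ (below w)) ?mule0// => -[].
have [p2|p2] := pselect (0 <= p.2)%R; last first.
  rewrite ifF; last by apply/negbTE; rewrite notin_setE /= => -[].
  by rewrite (@indic_notin _ _ (below w)) ?mule0// => -[].
rewrite /pos_part subr_gt0; case: ifPn.
  rewrite inE /= => -[/andP[_ pt] _]; rewrite pt EFinM; congr (_ * _).
  case: ifPn => h; first by rewrite (@indic_in _ _ (below w)).
  by rewrite (@indic_notin _ _ (below w))// => -[_ _ h']; move: h; rewrite h'.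
by rewrite notin_setE /= => h; rewrite ifF ?mul0e//; apply/negP => pt; apply: h; rewrite p1 pt.
Qed.

Definition solution w := forall t, (0 <= t)%R -> (lam w t)%:E = mu%:E + Xz N lam Phi t w.

(** Points accepted by [lam] and rejected by [lamoo]. The opposite discrepancy does not occur,
    [lamoo] being below every solution. *)
Definition discrepancy w : set R2 := below w `\` [set p | p.2%:E < lamoo w p.1].

Lemma measurable_discrepancy w : measurable (discrepancy w).
Proof.
apply: measurableD; first exact: measurable_below.
rewrite -[X in measurable X]setTI; apply: measurable_lte => //.
  by apply/measurable_EFinP; exact: measurable_snd.
by apply: (measurableT_comp (pred_int_section w plamoo)); exact: measurable_fst.
Qed.

(** The weak inequality in [Xz] and the strict one in [acc] differ exactly here when the two
    intensities agree. *)
Definition graph w : set R2 := [set p | [/\ (0 < p.1)%R, (0 <= p.2)%R & p.2%:E = lamoo w p.1]].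

Lemma measurable_graph w : measurable (graph w).
Proof.
rewrite (_ : graph w = (`]0%R, +oo[%classic `*` `[0%R, +oo[%classic) `&` [set p : R2 | p.2%:E = lamoo w p.1]).
  apply: measurable_eqe; first exact: measurableX.
    by apply/measurable_EFinP; apply: measurable_funTS; exact: measurable_snd.
  apply: measurable_funTS.
  by apply: (measurableT_comp (pred_int_section w plamoo)); exact: measurable_fst.
apply/seteqP; split => -[x y] /=; rewrite !in_itv/= !andbT; first by move=> [].
by move=> [[]].
Qed.

Section path.
Variable w : Omega.
Hypothesis sw : solution w.

Let m1 : measurable_fun setT (fun p : R2 => (\1_(below w) p : R)%:E).
Proof. by apply/measurable_EFinP; apply: measurable_indic; exact: measurable_below. Qed.

Let K t p := phi (t - p.1)%R * (\1_(below w) p : R)%:E.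
Let mK t : measurable_fun setT (K t).
Proof. exact: emeasurable_funM. Qed.
Let K0 t p : 0 <= K t p. Proof. by apply: mule_ge0 => //; rewrite lee_fin. Qed.

Lemma solutionE t : (0 <= t)%R -> (lam w t)%:E = mu%:E + \int[N w]_p K t p.
Proof. by move=> t0; rewrite sw// XzE. Qed.

Lemma acc_below (l : Omega -> R -> \bar R) p : (forall t, (0 <= t)%R -> l w t <= (lam w t)%:E) ->
  acc l (w, p) <= (\1_(below w) p : R)%:E.
Proof.
move=> h; rewrite /acc /=; case: ifPn => [/and3P[a b c]|_]; last by rewrite lee_fin.
rewrite (@indic_in _ _ (below w))//; split => //.
by rewrite -lee_fin ltW// (lt_le_trans c)// h// ltW.
Qed.

Lemma lamn_le_sol n t : (0 <= t)%R -> lamn n w t <= (lam w t)%:E.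
Proof.
elim: n t => [|n ih] t t0.
  rewrite solutionE//; apply: adde_ge0; first by rewrite lee_fin ltW.
  exact: integral_ge0.
apply: (le_trans (lamnS_le _ _ _ _ _ _)); rewrite solutionE// leeD2l//.
apply: ge0_le_integralT => //.
- exact: measurable_PT_section w (measurable_thin (plamn n) (mphis t)).
- by move=> p; apply: thin_ge0 => s; exact: phi0.
- by move=> p; apply: lee_wpmul2l => //; exact: acc_below.
Qed.

Lemma lamoo_le_sol t : (0 <= t)%R -> lamoo w t <= (lam w t)%:E.
Proof.
move=> t0; apply: lime_le.
  by apply/cvg_ex; exists (lamoo w t); exact: (cvg_lamn SN mPhi Phi0 mu0).
by apply: nearW => n; exact: lamn_le_sol.
Qed.

Lemma accE p : ~ discrepancy w p -> acc lamoo (w, p) = (\1_(below w) p : R)%:E.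
Proof.
move=> Dp; have [bp|bp] := pselect (below w p); last first.
  apply/eqP; rewrite eq_le; apply/andP; split.
    by apply: acc_below; exact: lamoo_le_sol.
  by rewrite (@indic_notin _ _ (below w))//; exact: acc_ge0.
rewrite (@indic_in _ _ (below w))// /acc /=; case: (bp) => -> -> _ /=.
by case: ifPn => // h; exfalso; apply: Dp; split => //; exact/negP.
Qed.

Hypothesis graph0 : N w (graph w) = 0.

(* Before the first time of a discrepancy the two intensities see the same points, so
   they agree at that time, and the discrepant point lies on the graph of [lamoo]. *)
Lemma discrepancy_null_pos : (0 < rho)%R -> N w (discrepancy w) = 0.
Proof.
move=> rho0.
(* Cutting [phi] at height 1 and at time [c] gives the bounded function of bounded support that
   [mass_until_lty] asks for. If its integral vanished for every [c], so would that of [phi]. *)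
have [c fpos] : exists c : nat, 0 < \int[mes1]_x (mine (phi x) 1 * upto c%:R x).
  apply/not_existsP => h.
  have mm : measurable_fun setT (fun x => mine (phi x) 1).
    by apply: measurable_mine => //; exact: measurable_cst.
  have m0 x : 0 <= mine (phi x) 1 by rewrite le_min phi0 lee01.
  have cv : \int[mes1]_x (mine (phi x) 1 * upto n%:R x) @[n --> \oo] --> \int[mes1]_x mine (phi x) 1.
    apply: ge0_integral_cvg.
    - by move=> n; apply: emeasurable_funM => //; exact: measurable_upto.
    - by move=> n x; apply: mule_ge0 => //; exact: upto_ge0.
    - move=> x i j ij; apply: lee_wpmul2l => //; rewrite !uptoE.
      case: ifPn => [xi|_]; last by case: ifPn.
      by rewrite ifT// (le_trans xi)// ler_nat.
    - move=> x; apply: cvg_near_cst; exists (Num.truncn x).+1 => // n /= xn.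
      rewrite uptoE ifT ?mule1// ltW// (lt_le_trans (truncnS_gt x))//.
      by rewrite ler_nat.
  have z n : \int[mes1]_x (mine (phi x) 1 * upto n%:R x) = 0.
    apply/eqP; rewrite eq_le leNgt; apply/andP; split; first exact/negP/h.
    by apply: integral_ge0 => x _; apply: mule_ge0 => //; exact: upto_ge0.
  have z' : \int[mes1]_x mine (phi x) 1 = 0.
    rewrite -(cvg_lim _ cv)//; under eq_fun do rewrite z; exact: lim_cst.
  have ae0 : ae_eq mes1 setT (fun x => mine (phi x) 1) (cst 0).
    apply/(ae_eq_integral_abs mes1 measurableT mm); rewrite -[RHS]z'.
    by apply: eq_integral => x _; rewrite gee0_abs.
  have : \int[mes1]_x phi x = 0.
    rewrite (_ : 0 = \int[mes1]_x (cst 0 x)); last by rewrite integral_cst// mul0e.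
    apply: ge0_ae_eq_integral => //.
    apply: filterS ae0 => x /= h' /h'; rewrite minEle; case: ifPn => // _ /eqP.
    by rewrite onee_eq0.
  by rewrite integral_phi// => -[] r0; move: rho0; rewrite r0 ltxx.
pose f x := mine (phi x) 1 * upto c%:R x.
have mf : measurable_fun setT f.
  by apply: emeasurable_funM; [apply: measurable_mine => //; exact: measurable_cst|exact: measurable_upto].
have f0 x : 0 <= f x by apply: mule_ge0; [rewrite le_min phi0 lee01|exact: upto_ge0].
have u1 x : upto (c%:R : R) x <= 1 by rewrite uptoE; case: ifPn.
have ffphi x : f x <= phi x.
  rewrite -[leRHS]mule1; apply: lee_pmul => //; [by rewrite le_min phi0 lee01|exact: upto_ge0|].
  by rewrite ge_min lexx.
have f1 x : f x <= 1.
  rewrite -[leRHS]mule1; apply: lee_pmul => //; [by rewrite le_min phi0 lee01|exact: upto_ge0|].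
  by rewrite ge_min lexx orbT.
have fc x : (c%:R < x)%R -> f x = 0 by move=> cx; rewrite /f uptoE leNgt cx mule0.
have fneg x : (x <= 0)%R -> f x = 0.
  by move=> x0; rewrite /f /pos_Phi /pos_part ltNge x0/= min_l ?mul0e// lee01.
(* The value [lam w t] is a real number and dominates the sum of [f (t - s)] over the points below
   [lam]; this rules out an accumulation of points. *)
have bfin T : N w (below w `&` until T) < +oo.
  apply: (mass_until_lty (fN w) mf f0 fc fneg f1 fpos (measurable_below w)).
    by move=> p [].
  move=> t t0; apply: (@le_lt_trans _ _ (\int[N w]_p K t p)).
    apply: ge0_le_integralT => //.
    - apply: emeasurable_funM => //; apply: measurableT_comp => //.
      by apply: measurable_funB; [exact: measurable_cst|exact: measurable_fst].
    - by move=> p; apply: mule_ge0 => //; rewrite lee_fin.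
    - by move=> p; apply: lee_wpmul2r => //; rewrite lee_fin.
  apply: (@le_lt_trans _ _ (lam w t)%:E); last exact: ltry.
  by rewrite solutionE// leeDr// lee_fin ltW.
have mD := measurable_discrepancy w.
apply: (first_time_null (prm_atoms SN w)) => //.
- by move=> p [[]].
- move=> T; apply: le_lt_trans (bfin T); apply: le_measure; rewrite ?inE.
  + by apply: measurableI => //; exact: measurable_until.
  + by apply: measurableI; [exact: measurable_below|exact: measurable_until].
  + by move=> p [[bp _] pT].
- move=> t t0 before0.
  have lamE : lamoo w t = (lam w t)%:E.
    rewrite (lamoo_eq SN mPhi Phi0 mu0) solutionE ?ltW//; congr (_ + _).
    apply: ge0_ae_eq_integral => //.
    + exact: measurable_PT_section w (measurable_thin plamoo (mphis t)).
    + by move=> p _; apply: thin_ge0 => s; exact: phi0.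
    + exists (discrepancy w `&` [set p | (p.1 < t)%R]); split => //.
        by apply: measurableI => //; exact: (measurable_before (t, 0%R)).
      move=> p /= /not_implyP[_ hp]; apply: contrapT => h; apply: hp.
      rewrite /thin /K /=.
      have [pt|tp] := ltP p.1 t.
        by rewrite accE// => Dp; apply: h.
      by rewrite /pos_Phi /pos_part subr_gt0 ltNge tp/= !mul0e.
  apply/eqP; rewrite eq_le measure_ge0 andbT -[leRHS]graph0.
  apply: le_measure; rewrite ?inE.
  + by apply: measurableI => //; exact: (measurable_line (t, 0%R)).
  + exact: measurable_graph.
  move=> p [[[p1 p2 p3] /negP p4] /= pt]; split => //.
  apply/eqP; rewrite eq_le; apply/andP; split; last by rewrite leNgt.
  by rewrite pt lamE -pt lee_fin.
Qed.

(* When [Phi] vanishes a.e. the intensity equals [mu] at every point of [N]: the case is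
   separate because [N] may then have infinitely many points below [lam]. *)
Lemma discrepancy_null_zero :
  {ae N w, forall p, H (fun _ _ => +oo) (fun r => phi (p.1 - r)%R) w = 0} ->
  N w (discrepancy w) = 0.
Proof.
move=> [Z [mZ Z0 hZ]].
have poo : pred_int N (fun _ _ => +oo) by split => //; exact: measurable_cst.
have mD := measurable_discrepancy w.
apply/eqP; rewrite eq_le measure_ge0 andbT.
have mgraph := measurable_graph w.
rewrite -[leRHS]adde0 -{1}graph0 -Z0; apply: le_trans (measureU2 _ mgraph mZ).
apply: le_measure; rewrite ?inE//; first exact: measurableU.
move=> p [[p1 p2 p3] /negP p4].
have [pZ|pZ] := pselect (Z p); [by right|left].
have h : H (fun _ _ => +oo) (fun r => phi (p.1 - r)%R) w = 0.
  by apply: contrapT => h; apply: pZ; exact: hZ.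
split => //; apply/eqP; rewrite eq_le; apply/andP; split; last by rewrite leNgt.
apply: (@le_trans _ _ mu%:E); last first.
  rewrite (lamoo_eq SN mPhi Phi0 mu0) leeDl//; apply: NI_ge0 => x; apply: thin_ge0 => s.
  exact: phi0.
apply: (@le_trans _ _ (lam w p.1)%:E); first by rewrite lee_fin.
rewrite solutionE; last exact: ltW.
rewrite -[leRHS]adde0 leeD2l// -h.
apply: ge0_le_integralT => //.
- exact: measurable_PT_section w (measurable_thin poo (mphis p.1)).
- move=> q; apply: lee_wpmul2l => //.
  have [[q1 q2 _]|bq] := pselect (below w q); last first.
    by rewrite (@indic_notin _ _ (below w))//; exact: acc_ge0.
  by rewrite /acc /= q1 q2 ltry lee_fin indicE; case: (_ \in _).
Qed.

End path.

(** The graph is predictable and has at most one mark at each time, hence zero intensity;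
    compensation transfers this to [N]. *)
Lemma graph_null : {ae P, forall w, N w (graph w) = 0}.
Proof.
pose g (x : PT) : \bar R := if [&& (0 < x.2.1)%R, (0 <= x.2.2)%R & (x.2.2%:E <= lamoo x.1 x.2.1) &&
  (lamoo x.1 x.2.1 <= x.2.2%:E)] then 1 else 0.
have mmark : measurable_fun setT (fun x : PT => x.2.2%:E).
  by apply/measurable_EFinP; exact: measurable_PT_mark.
have mg : measurable_fun setT g.
  apply: measurable_fun_ifT; [|exact: measurable_cst|exact: measurable_cst].
  apply: measurable_and; first by apply: measurable_fun_ltr; [exact: measurable_cst|exact: measurable_PT_time].
  apply: measurable_and; first by apply: measurable_fun_ler; [exact: measurable_cst|exact: measurable_PT_mark].
  by apply: measurable_and; apply: measurable_fun_lee => //; exact: plamoo.1.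
have g0 x : 0 <= g x by rewrite /g; case: ifPn.
have gE w p : g (w, p) = (\1_(graph w) p : R)%:E.
  rewrite /g /=; case: ifPn => [/and3P[a b c]|h].
    by rewrite (@indic_in _ _ (graph w))//; split => //; apply/eqP; rewrite eq_le.
  by rewrite (@indic_notin _ _ (graph w))// => -[/= a b c]; move: h; rewrite a b c lexx.
have NE w : NI N g w = N w (graph w).
  rewrite /NI (eq_integral (fun p => (\1_(graph w) p : R)%:E)) => [|p _]; last exact: gE.
  by rewrite integral_indic ?setIT//; exact: measurable_graph.
have nu0 w : nuI g w = 0.
  rewrite /nuI integral_nu//; last exact: measurable_PT_section w mg.
  apply: integral0_eq => s _; apply/eqP; rewrite eq_le; apply/andP; split; last exact: integral_ge0.
  (* Where [lamoo] is infinite the section of the graph is empty, and the default value of [fine]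
     only enlarges it to a point. *)
  apply: (@le_trans _ _ (\int[mes1]_(x in `[0%R, +oo[) (\1_[set fine (lamoo w s)] x : R)%:E)).
    have mgs : measurable_fun setT (fun x : R => g (w, (s, x))).
      apply: (measurableT_comp (measurable_PT_section w mg)); exact: measurable_pair1.
    apply: ge0_le_integral => //.
    - exact: measurable_funTS.
    - by apply/measurable_EFinP; apply: measurable_funTS; exact: measurable_indic.
    - move=> x _; rewrite /g /=; case: ifPn => [/and3P[_ _ h]|_]; last by rewrite lee_fin.
      by rewrite indic_in//= -[x]/(fine x%:E); congr fine; apply/eqP; rewrite eq_le.
  rewrite integral_indic//.
  rewrite [leLHS](_ : _ = @lebesgue_measure R ([set fine (lamoo w s)] `&` `[0%R, +oo[%classic))//.
  by rewrite -[leRHS](lebesgue_measure_set1 (fine (lamoo w s))); apply: le_measure; rewrite ?inE//; exact: measurableI.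
have E0 : \int[P]_w NI N g w = 0.
  by rewrite (E_NI SN mg g0); apply: integral0_eq => w _.
have mNg := measurable_NI SN mg g0.
have : ae_eq P setT (NI N g) (cst 0).
  apply/(ae_eq_integral_abs P measurableT mNg); rewrite -[RHS]E0.
  by apply: eq_integral => w _; rewrite gee0_abs//; exact: NI_ge0.
by apply: filterS => w /(_ Logic.I); rewrite NE.
Qed.

(** The intensity [+oo] accepts every point of positive time and nonnegative mark, so the sum bounds
    that over any thinning. It is zero at almost every time because [phi] has zero integral, and
    compensation turns this into zero at the points of [N]. *)
Lemma past_null : rho = 0%R ->
  {ae P, forall w, {ae N w, forall p, H (fun _ _ => +oo) (fun r => phi (p.1 - r)%R) w = 0}}.
Proof.
move=> r0.
have poo : pred_int N (fun _ _ => +oo) by split => //; exact: measurable_cst.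
pose k (x : PT) := H (fun _ _ => +oo) (fun r => phi (x.2.1 - r)%R) x.1.
have mk : measurable_fun setT k by exact: (predictable_past SN mPhi Phi0 poo).
have k0 x : 0 <= k x by apply: NI_ge0 => y; apply: thin_ge0 => s; exact: phi0.
have nu0 w : nuI k w = 0.
  rewrite /nuI integral_nu//; last exact: measurable_PT_section w mk.
  pose G (z : R * R2) := phi (z.1 - z.2.1)%R * acc (fun _ _ => +oo) (w, z.2).
  have ma : measurable_fun setT (fun q => acc (fun _ _ => +oo : \bar R) (w, q)).
    exact: measurable_PT_section w (measurable_acc poo).
  have mG : measurable_fun setT G.
    apply: emeasurable_funM; last exact: measurableT_comp ma measurable_snd.
    apply: measurableT_comp; first exact: mphi.
    apply: measurable_funB; first exact: measurable_fst.
    by apply: measurableT_comp; [exact: measurable_fst|exact: measurable_snd].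
  have G0 z : 0 <= G z by apply: mule_ge0; [exact: phi0|exact: acc_ge0].
  have sf := locfin_sigma_finite (fN w).
  have mg := measurable_ge0_tonelli sf mG G0.
  have z : \int[mes1]_s \int[N w]_q G (s, q) = 0.
    rewrite (ge0_tonelli (@sigma_finite_mes1 R) sf mG G0); apply: integral0_eq => q _.
    rewrite /G /= ge0_integralZr//; last 2 first.
    - by apply: (measurableT_comp mphi); exact: measurable_funB.
    - exact: acc_ge0.
    by rewrite (integral_translate q.1 mphi phi0) integral_phi// r0 mul0e.
  pose g (s : R) := \int[N w]_q G (s, q).
  have g0 s : 0 <= g s by apply: integral_ge0 => q _; exact: G0.
  (* The integrand does not depend on the mark, and the axis of marks has infinite length; the
     product is still zero by [0 * +oo = 0]. *)
  transitivity (\int[mes1]_(s in `[0%R, +oo[) (g s * mes1 `[0%R, +oo[%classic)).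
    by apply: eq_integral => s _; rewrite -[RHS]integral_cst.
  have gz : \int[mes1]_(s in `[0%R, +oo[) g s = 0.
    apply/eqP; rewrite eq_le; apply/andP; split; last exact: integral_ge0.
    by rewrite -[leRHS]z; apply: ge0_subset_integral.
  have mgI : measurable_fun (`[0%R, +oo[%classic : set R) g by exact: measurable_funTS.
  transitivity (\int[mes1]_(s in `[0%R, +oo[) g s * mes1 `[0%R, +oo[%classic); last by rewrite gz mul0e.
  exact: ge0_integralZr.
have E0 : \int[P]_w NI N k w = 0.
  by rewrite (E_NI SN mk k0); apply: integral0_eq => w _.
have mNk := measurable_NI SN mk k0.
have : ae_eq P setT (NI N k) (cst 0).
  apply/(ae_eq_integral_abs P measurableT mNk); rewrite -[RHS]E0.
  by apply: eq_integral => w _; rewrite gee0_abs//; exact: NI_ge0.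
apply: filterS => w /(_ Logic.I) /= Nk.
have : ae_eq (N w) setT (fun p => k (w, p)) (cst 0).
  apply/(ae_eq_integral_abs (N w) measurableT (measurable_PT_section w mk)); rewrite -[RHS]Nk.
  by apply: eq_integral => p _; rewrite gee0_abs.
by apply: filterS => p /(_ Logic.I).
Qed.

Hypothesis sol : {ae P, forall w, solution w}.

Lemma discrepancy_null : {ae P, forall w, N w (discrepancy w) = 0}.
Proof.
have := rho_ge0 Phi0; rewrite le_eqVlt => /predU1P[r0|r0].
  have := past_null (esym r0); apply: filterS3 sol graph_null => w sw gw pw.
  exact: discrepancy_null_zero.
apply: filterS2 sol graph_null => w sw gw; exact: discrepancy_null_pos.
Qed.

Lemma Xz_thin (zeta : R -> R) : measurable_fun setT (pos_part (fun x => (zeta x)%:E)) ->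
  (forall x, 0 <= pos_part (fun x => (zeta x)%:E) x) ->
  {ae P, forall w, forall t, Xz N lam zeta t w = H lamoo (fun r => pos_part (fun x => (zeta x)%:E) (t - r)%R) w}.
Proof.
move=> mz z0; apply: filterS2 sol discrepancy_null => w sw D0 t; rewrite XzE.
have mzt : measurable_fun setT (fun r : R => pos_part (fun x => (zeta x)%:E) (t - r)%R).
  by apply: measurableT_comp => //; exact: measurable_funB.
apply: ge0_ae_eq_integral => //.
- apply: emeasurable_funM; first by apply: (measurableT_comp mzt); exact: measurable_fst.
  by apply/measurable_EFinP; apply: measurable_indic; exact: measurable_below.
- exact: measurable_PT_section w (measurable_thin plamoo mzt).
- by move=> p _; apply: mule_ge0 => //; rewrite lee_fin.
- by move=> p _; exact: thin_ge0.
- exists (discrepancy w); split => //; first exact: measurable_discrepancy.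
  move=> p /= /not_implyP[_ hp]; apply: contrapT => h; apply: hp.
  by rewrite /thin accE.
Qed.

End identification.

(** * The moments of the Hawkes process *)

Section open_interval.
Context {R : realType}.
Local Open Scope ereal_scope.

(** Passes from the closed intervals of the statement to functions on the line supported in the open
    interval. The endpoints are a null set, so [F] is arbitrary there. *)
Lemma I_oo (a b : R) (F g : R -> \bar R) : measurable_fun setT g -> (forall x, 0 <= g x) ->
  (forall x, (a < x < b)%R -> F x = g x) -> (forall x, ~~ (a < x < b)%R -> g x = 0) ->
  I a b F = \int[mes1]_x g x.
Proof.
move=> mg g0 Fg gz.
have E x : x \in `]a, b[%classic -> F x = g x by rewrite inE/= in_itv/= => /Fg.
rewrite /I integral_itv_bndoo; last first.
  by apply: (eq_measurable_fun g) => [x /E//|]; exact: measurable_funTS.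
transitivity (\int[leb]_(x in `]a, b[) g x); first exact: eq_integral.
rewrite integral_mkcond -integral_mes1T//.
apply: eq_integral => x _; rewrite patchE; case: ifPn => //.
by rewrite notin_setE/= in_itv/= => /negP h; rewrite gz.
Qed.

Lemma pos_part_ge0 (f : R -> \bar R) x : (forall x, 0 <= f x) -> 0 <= pos_part f x.
Proof. by move=> f0; rewrite /pos_part; case: ifPn. Qed.

Lemma measurable_pos_part (f : R -> \bar R) : measurable_fun setT f -> measurable_fun setT (pos_part f).
Proof.
move=> mf; rewrite pos_partE; apply/(measurable_restrictT _ (measurable_itv _)).
exact: measurable_funTS.
Qed.

Lemma pos_partZ (f g : R -> \bar R) x : pos_part (fun x => f x * g x) x = pos_part f x * g x.
Proof. by rewrite /pos_part; case: ifPn => // _; rewrite mul0e. Qed.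

End open_interval.

(** * The integrals in the covariance formulas *)

Section covariance.
Context {R : realType}.
Variable Phi : R -> R.
Hypothesis mPhi : measurable_fun (`[0%R, +oo[%classic : set R) Phi.
Hypothesis Phi0 : forall x, 0 <= x -> 0 <= Phi x.
Local Open Scope ereal_scope.
Notation psi := (pos_Psi Phi).
Let mpsi : measurable_fun setT psi := measurable_psi mPhi Phi0.
Let psi0 x : 0 <= psi x := psi_ge0 mPhi Phi0 x.

Definition psi_mass (t : R) := \int[mes1]_s pos_part (fun s => psi (t - s)%R) s.

Let mpsiB : measurable_fun setT (fun z : R * R => psi (z.1 - z.2)%R).
Proof. by apply: measurableT_comp => //; exact: measurable_funB. Qed.

Lemma psi_mass_ge0 t : 0 <= psi_mass t.
Proof. by apply: integral_ge0 => s _; exact: pos_part_ge0. Qed.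

Lemma measurable_psi_mass : measurable_fun setT psi_mass.
Proof.
pose one (s : R) : \bar R := pos_part (fun=> 1) s.
have m1 : measurable_fun setT one by apply: measurable_pos_part; exact: measurable_cst.
have E t s : pos_part (fun s => psi (t - s)%R) s = one s * psi (t - s)%R.
  by rewrite /one /pos_part; case: ifPn; rewrite ?mul1e ?mul0e.
rewrite (_ : psi_mass = fun t => \int[mes1]_s (one s * psi (t - s)%R)); last first.
  by apply/funext => t; apply: eq_integral => s _; exact: E.
apply: (measurable_ge0_tonelli (f := fun z : R * R => one z.2 * psi (z.1 - z.2)%R)).
- exact: sigma_finite_mes1.
- by apply: emeasurable_funM => //; exact: measurableT_comp.
- by move=> z; apply: mule_ge0 => //; exact: pos_part_ge0.
Qed.

Let mpsis t : measurable_fun setT (fun s : R => psi (t - s)%R).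
Proof. by apply: measurableT_comp => //; exact: measurable_funB. Qed.

Lemma psi_neg x : (x <= 0)%R -> psi x = 0.
Proof. by move=> x0; rewrite /pos_Psi /pos_part ltNge x0. Qed.

Lemma psi_pos x : (0 < x)%R -> psi x = Psi Phi x.
Proof. by move=> x0; rewrite /pos_Psi /pos_part x0. Qed.

Lemma psi_mass_rev t : I 0 t (fun w => Psi Phi (t - w)%R) = psi_mass t.
Proof.
apply: I_oo.
- exact: measurable_pos_part.
- by move=> s; exact: pos_part_ge0.
- by move=> x /andP[x0 xt]; rewrite /pos_part x0 psi_pos// subr_gt0.
- move=> x; rewrite negb_and -!leNgt /pos_part; case: ifPn => // x0 /orP[|tx].
    by rewrite leNgt x0.
  by rewrite psi_neg// subr_le0.
Qed.

Lemma psi_massE t : I 0 t (Psi Phi) = psi_mass t.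
Proof.
rewrite /psi_mass -(integral_reflect t (measurable_pos_part (mpsis t))); last first.
  by move=> x; exact: pos_part_ge0.
have E x : pos_part (fun s => psi (t - s)%R) (t - x)%R = if (x < t)%R then psi x else 0.
  by rewrite /pos_part subr_gt0; case: ifPn => // _; congr psi; ring.
rewrite (eq_integral _ _ (fun x _ => E x)); apply: I_oo.
- rewrite (_ : (fun x => _) = (fun x => pos_part (fun s => psi (t - s)%R) (t - x)%R)); last first.
    by apply/funext => x; rewrite E.
  apply: (measurableT_comp (measurable_pos_part (mpsis t))); exact: measurable_funB.
- by move=> x; case: ifPn.
- by move=> x /andP[x0 ->]; rewrite psi_pos.
- move=> x; rewrite negb_and -!leNgt => /orP[x0|tx].
    by rewrite psi_neg//; case: ifPn.
  by rewrite ltNge tx.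
Qed.

Variable z : R -> \bar R.
Hypotheses (mz : measurable_fun setT z) (z0 : forall x, 0 <= z x).
Variable F : R -> \bar R.
Hypotheses (mF : measurable_fun setT F) (F0 : forall x, 0 <= F x).
Variable t : R.

Let mzt : measurable_fun setT (fun s : R => z (t - s)%R).
Proof. by apply: measurableT_comp => //; exact: measurable_funB. Qed.

Let W v := pos_part F v * (1 + psi_mass v).
Let mW : measurable_fun setT W.
Proof.
apply: emeasurable_funM; first exact: measurable_pos_part.
by apply: emeasurable_funD; [exact: measurable_cst|exact: measurable_psi_mass].
Qed.
Let W0 v : 0 <= W v.
Proof. by apply: mule_ge0; [exact: pos_part_ge0|apply: adde_ge0 => //; exact: psi_mass_ge0]. Qed.

Definition cov_kernel (u v : R) := z (t - u)%R * psi (u - v)%R * (pos_part F v * (1 + psi_mass v)).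

Lemma measurable_cov_kernel : measurable_fun setT (fun x : R * R => cov_kernel x.1 x.2).
Proof.
apply: emeasurable_funM; last exact: (measurableT_comp mW measurable_snd).
by apply: emeasurable_funM => //; exact: (measurableT_comp mzt measurable_fst).
Qed.

Lemma cov_kernel_ge0 u v : 0 <= cov_kernel u v.
Proof. by apply: mule_ge0; [exact: mule_ge0|exact: W0]. Qed.

(** The two terms of [Rop] applied to the second test function give the single and the double
    integral of the theorem; [F] stands for the resolvent of the first one, and [1 + psi_mass] comes
    from the mean intensity. *)
Lemma cov_terms :
  \int[mes1]_v (pos_part (fun v => F v * Rop Phi (fun r => z (t - r)%R) v) v * (1 + psi_mass v)) =
  \int[mes1]_v (z (t - v)%R * (pos_part F v * (1 + psi_mass v))) +
  \int[mes1]_u \int[mes1]_v cov_kernel u v.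
Proof.
have mK := measurable_cov_kernel.
have K0 x : 0 <= cov_kernel x.1 x.2 by exact: cov_kernel_ge0.
have mK' : measurable_fun setT (fun x : R * R => cov_kernel x.2 x.1).
  apply: (@measurableT_comp _ _ _ _ _ _ (fun x : R * R => cov_kernel x.1 x.2) setT (fun x : R * R => (x.2, x.1)) mK).
  exact: measurable_swap.
have mKi := measurable_ge0_tonelli (f := fun x : R * R => cov_kernel x.2 x.1) (@sigma_finite_mes1 R) mK' (fun x => K0 (x.2, x.1)).
have mzW : measurable_fun setT (fun v : R => z (t - v)%R * W v) by exact: emeasurable_funM.
transitivity (\int[mes1]_v (z (t - v)%R * W v + \int[mes1]_u cov_kernel u v)).
  apply: eq_integral => v _; rewrite pos_partZ /Rop.
  have mpv : measurable_fun setT (fun u : R => psi (u - v)%R).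
    by apply: measurableT_comp => //; exact: measurable_funB.
  have mpz : measurable_fun setT (fun u : R => psi (u - v)%R * z (t - u)%R) by exact: emeasurable_funM.
  have pz0 u : 0 <= psi (u - v)%R * z (t - u)%R by exact: mule_ge0.
  have I0' : 0 <= \int[mes1]_u (psi (u - v)%R * z (t - u)%R) by exact: integral_ge0.
  rewrite (ge0_muleDr _ (z0 _) I0').
  rewrite ge0_muleDl//; last 2 first.
  - by apply: mule_ge0 => //; exact: pos_part_ge0.
  - by apply: mule_ge0; [exact: pos_part_ge0|exact: integral_ge0].
  apply: eq_adde; first by rewrite /W [z _ * _]muleCA muleA.
  rewrite -muleA [X in _ * X]muleC muleA -/(W v) -ge0_integralZl//.
  by apply: eq_integral => u _; rewrite /cov_kernel -/(W v) muleC [psi _ * _]muleC.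
transitivity (\int[mes1]_v (z (t - v)%R * W v) + \int[mes1]_v \int[mes1]_u cov_kernel u v).
  apply: ge0_integralD => //.
  - by move=> v _; exact: mule_ge0.
  - by move=> v _; apply: integral_ge0 => u _; exact: cov_kernel_ge0.
apply: eq_adde; first exact: erefl.
exact/esym/(ge0_tonelli (f := fun x : R * R => cov_kernel x.1 x.2) (@sigma_finite_mes1 R) (@sigma_finite_mes1 R) mK K0).
Qed.

Variable s : R.
Hypotheses (st : (s <= t)%R) (Fs : forall v, (s <= v)%R -> F v = 0) (zneg : forall x, (x <= 0)%R -> z x = 0).

Lemma first_cov_term (G : R -> \bar R) :
  (forall v, (0 < v < s)%R -> G v = z (t - v)%R * (F v * (1 + psi_mass v))) ->
  I 0 s G = \int[mes1]_v (z (t - v)%R * (pos_part F v * (1 + psi_mass v))).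
Proof.
move=> GE; apply: I_oo.
- exact: emeasurable_funM.
- by move=> v; apply: mule_ge0 => //; exact: W0.
- by move=> v h; rewrite GE// /pos_part; case/andP: h => ->.
- move=> v; rewrite negb_and -!leNgt => /orP[v0|sv].
    by rewrite /pos_part ltNge v0 mul0e mule0.
  by rewrite /pos_part Fs//; case: ifPn => _; rewrite mul0e mule0.
Qed.

(** The ranges come from supports: [F] vanishes from [s] on, [psi (u - v)] for [v >= u] and
    [z (t - u)] for [u >= t]. *)
Lemma second_cov_term (G : R -> R -> \bar R) :
  (forall u v, (0 < u < t)%R -> (0 < v < Num.min s u)%R ->
     G u v = z (t - u)%R * psi (u - v)%R * (F v * (1 + psi_mass v))) ->
  I 0 t (fun u => I 0 (Num.min s u) (G u)) = \int[mes1]_u \int[mes1]_v cov_kernel u v.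
Proof.
move=> GE.
have mK := measurable_cov_kernel.
have K0 x : 0 <= cov_kernel x.1 x.2 by exact: cov_kernel_ge0.
apply: I_oo.
- exact: (measurable_ge0_tonelli (f := fun x : R * R => cov_kernel x.1 x.2) (@sigma_finite_mes1 R) mK K0).
- by move=> u; apply: integral_ge0 => v _; exact: cov_kernel_ge0.
- move=> u ut; apply: I_oo.
  + exact: (@measurableT_comp _ _ _ _ _ _ _ _ (fun v : R => (u, v)) mK (measurable_pair1 u)).
  + by move=> v; exact: cov_kernel_ge0.
  + by move=> v vs; rewrite GE// /cov_kernel /pos_part; case/andP: vs => ->.
  + move=> v; rewrite negb_and -!leNgt => /orP[v0|].
      by rewrite /cov_kernel /pos_part ltNge v0 mul0e mule0.
    rewrite ge_min => /orP[sv|uv].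
      by rewrite /cov_kernel /pos_part Fs//; case: ifPn => _; rewrite mul0e mule0.
    by rewrite /cov_kernel psi_neg ?subr_le0// mule0 mul0e.
- move=> u; rewrite negb_and -!leNgt => /orP[u0|tu].
    apply: integral0_eq => v _; rewrite /cov_kernel /pos_part; case: ifPn => [v0|_].
      by rewrite psi_neg ?mule0 ?mul0e// subr_le0 (le_trans u0)// ltW.
    by rewrite mul0e mule0.
  by apply: integral0_eq => v _; rewrite /cov_kernel zneg ?mul0e// subr_le0.
Qed.

End covariance.

Section hawkes.
Context {R : realType} d (Omega : measurableType d) (P : probability Omega R).
Notation R2 := (R * R)%type.
Variable N : Omega -> {measure set R2 -> \bar R}.
Hypothesis PN : is_PRM P N.
Variable Phi : R -> R.
Hypothesis mPhi : measurable_fun (`[0%R, +oo[%classic : set R) Phi.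
Hypothesis Phi0 : forall x, 0 <= x -> 0 <= Phi x.
Hypothesis Phi1 : (\int[leb]_(x in (`[0%R, +oo[%classic : set R)) (Phi x)%:E < 1)%E.
Variable mu : R.
Hypothesis mu0 : 0 < mu.
Variable lam : Omega -> R -> R.
Hypothesis mlam : measurable_fun ([set: Omega] `*` (`[0%R, +oo[%classic : set R))
    (fun p : Omega * R => lam p.1 p.2).
Hypothesis sol : {ae P, forall w, forall t, 0 <= t ->
     (lam w t)%:E = (mu%:E + Xz N lam Phi t w)%E}.
Local Open Scope ereal_scope.
Notation phi := (pos_Phi Phi).
Notation psi := (pos_Psi Phi).

Let mphi : measurable_fun setT phi := measurable_phi mPhi.
Let phi0 x : 0 <= phi x := phi_ge0 Phi0 x.
Let mpsi : measurable_fun setT psi := measurable_psi mPhi Phi0.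
Let psi0 x : 0 <= psi x := psi_ge0 mPhi Phi0 x.

Definition ext (zeta : R -> R) : R -> \bar R := pos_part (fun x => (zeta x)%:E).

Lemma ext_neg zeta x : (x <= 0)%R -> ext zeta x = 0.
Proof. by move=> x0; rewrite /ext /pos_part ltNge x0. Qed.

Lemma ext_pos zeta x : (0 < x)%R -> ext zeta x = (zeta x)%:E.
Proof. by move=> x0; rewrite /ext /pos_part x0. Qed.

Lemma Xz_ge0 zeta t w : (forall x, 0 <= ext zeta x) -> 0 <= Xz N lam zeta t w.
Proof.
move=> z0; apply: integral_ge0 => p [/andP[_ pt] _].
have := z0 (t - p.1)%R; rewrite ext_pos ?subr_gt0// => h.
by rewrite EFinM; apply: mule_ge0 => //; rewrite lee_fin; case: ifPn.
Qed.

Definition admissible (zeta : R -> R) := measurable_fun setT (ext zeta) /\ forall x, 0 <= ext zeta x.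

Lemma admissible_Phi : admissible Phi.
Proof. by split. Qed.

Lemma admissible_one : admissible (fun=> 1%R).
Proof.
split; first by apply: measurable_pos_part; exact: measurable_cst.
by move=> x; apply: pos_part_ge0 => _; rewrite lee_fin.
Qed.

Let shift zeta t (r : R) : \bar R := ext zeta (t - r)%R.

Let mshift zeta t : admissible zeta -> measurable_fun setT (shift zeta t).
Proof. by move=> [mz _]; apply: measurableT_comp => //; exact: measurable_funB. Qed.

Let shift0 zeta t r : admissible zeta -> 0 <= shift zeta t r.
Proof. by move=> [_ z0]; exact: z0. Qed.

Let shift_neg zeta t r : (t <= r)%R -> shift zeta t r = 0.
Proof. by move=> tr; rewrite /shift ext_neg// subr_le0. Qed.

Section with_simple.
Variable N' : Omega -> {measure set R2 -> \bar R}.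
Hypothesis SN : simple_prm P N'.
Hypothesis NN : {ae P, forall w, N' w = N w}.
Notation lamoo := (lamoo N' Phi mu).
Notation H f := (NI N' (thin lamoo f)).

Lemma Xz_H zeta : admissible zeta ->
  {ae P, forall w, forall t, Xz N lam zeta t w = H (shift zeta t) w}.
Proof.
move=> [mz z0].
have sol' : {ae P, forall w, solution N' Phi mu lam w}.
  apply: filterS2 NN sol => w Nw sw t t0; rewrite sw//.
  by rewrite /Xz Nw.
have := Xz_thin SN mPhi Phi0 Phi1 mu0 mlam sol' mz z0.
by apply: filterS2 NN => w Nw h t; rewrite -h /Xz Nw.
Qed.

(** Measurability of [Xz] in [w] is bypassed: almost sure equality with a measurable function
    determines the integral. *)
Lemma E_Xz zeta t : admissible zeta -> Exp P (Xz N lam zeta t) = \int[P]_w H (shift zeta t) w.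
Proof.
move=> az; apply: ge0_ae_integral_measurable_eq.
- by move=> w; apply: Xz_ge0; exact: az.2.
- by move=> w; apply: H_ge0 => r; exact: shift0.
- by apply: (measurable_H SN mPhi Phi0 mu0) => [|r]; [exact: mshift|exact: shift0].
- by apply: filterS (Xz_H az) => w.
Qed.

Lemma E_XzXz zeta zeta' s t : admissible zeta -> admissible zeta' ->
  Exp P (fun w => Xz N lam zeta s w * Xz N lam zeta' t w) =
  \int[P]_w (H (shift zeta s) w * H (shift zeta' t) w).
Proof.
move=> az az'; apply: ge0_ae_integral_measurable_eq.
- by move=> w; apply: mule_ge0; apply: Xz_ge0; [exact: az.2|exact: az'.2].
- by move=> w; apply: mule_ge0; apply: H_ge0 => r; exact: shift0.
- apply: emeasurable_funM.
    by apply: (measurable_H SN mPhi Phi0 mu0) => [|r]; [exact: mshift|exact: shift0].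
  by apply: (measurable_H SN mPhi Phi0 mu0) => [|r]; [exact: mshift|exact: shift0].
- by apply: filterS2 (Xz_H az) (Xz_H az') => w -> ->.
Qed.

Let mR f : measurable_fun setT f -> (forall x, 0 <= f x) -> measurable_fun setT (Rop Phi f).
Proof. by move=> mf f0; exact: (measurable_Rop mPhi Phi0). Qed.

(** The diagonal term of the second moment is the mean of a sum over accepted points, so the first
    moment formula applies to it with the product of the two resolvents as test function. *)
Lemma E_XzXz_Rop zeta zeta' s t : admissible zeta -> admissible zeta' -> (0 <= s)%R -> (s <= t)%R ->
  (forall v, (s <= v)%R -> Rop Phi (shift zeta s) v = 0) ->
  Exp P (fun w => Xz N lam zeta s w * Xz N lam zeta' t w) =
  Exp P (Xz N lam zeta s) * Exp P (Xz N lam zeta' t) +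
  mu%:E * \int[mes1]_v (ext zeta' (t - v)%R * (pos_part (Rop Phi (shift zeta s)) v * (1 + psi_mass Phi v))) +
  mu%:E * \int[mes1]_u \int[mes1]_v cov_kernel Phi (ext zeta') (Rop Phi (shift zeta s)) t u v.
Proof.
move=> az az' s0 st Rs; rewrite E_XzXz// !E_Xz//.
have t0 := le_trans s0 st.
have m1 := mshift s az; have m2 := mshift t az'.
have p1 r : 0 <= shift zeta s r by exact: shift0.
have p2 r : 0 <= shift zeta' t r by exact: shift0.
have mR1 := mR m1 p1; have mR2 := mR m2 p2.
have R1 r : 0 <= Rop Phi (shift zeta s) r by exact: (Rop_ge0 mPhi Phi0).
have R2' r : 0 <= Rop Phi (shift zeta' t) r by exact: (Rop_ge0 mPhi Phi0).
rewrite (second_moment SN mPhi Phi0 Phi1 mu0 t0 m1 p1 _ m2 p2); last 2 first.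
- by move=> r tr; rewrite shift_neg// (le_trans st)// ltW.
- by move=> r tr; rewrite shift_neg// ltW.
rewrite -addeA; apply: eq_adde => //.
have mk : measurable_fun setT (fun v => Rop Phi (shift zeta s) v * Rop Phi (shift zeta' t) v).
  exact: emeasurable_funM.
rewrite (first_moment SN mPhi Phi0 Phi1 mu0 t0 mk); last 2 first.
- by move=> r; exact: mule_ge0.
- by move=> r tr; rewrite Rs ?mul0e// (le_trans st)// ltW.
rewrite (cov_terms mPhi Phi0 az'.1 az'.2 mR1 R1 t) ge0_muleDr//.
- apply: integral_ge0 => v _; apply: mule_ge0; first exact: az'.2.
  apply: mule_ge0; first exact: pos_part_ge0.
  by apply: adde_ge0 => //; exact: psi_mass_ge0.
- apply: integral_ge0 => u _; apply: integral_ge0 => v _.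
  exact: (cov_kernel_ge0 mPhi Phi0 az'.2 R1).
Qed.

Lemma E_X_Phi s : (0 <= s)%R -> Exp P (Xz N lam Phi s) = mu%:E * I 0 s (Psi Phi).
Proof.
move=> s0; rewrite (E_Xz s admissible_Phi) (psi_massE mPhi Phi0).
rewrite (first_moment_Rop SN mPhi Phi0 Phi1 mu0 s0); last 3 first.
- exact: (mshift s admissible_Phi).
- by move=> r; exact: (shift0 s r admissible_Phi).
- by move=> r sr; rewrite shift_neg// ltW.
congr (_ * _); apply: eq_integral => v _; congr (pos_part _ v); apply/funext => u.
exact: (Rop_phi mPhi Phi0).
Qed.

Lemma E_X_one s : (0 <= s)%R -> Exp P (Xz N lam (fun=> 1%R) s) =
  (mu * s)%:E + mu%:E * I 0 s (fun u => I 0 u (Psi Phi)).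
Proof.
move=> s0; rewrite (E_Xz s admissible_one).
have m1 := mshift s admissible_one.
have p1 r := shift0 s r admissible_one.
rewrite (first_moment SN mPhi Phi0 Phi1 mu0 s0 m1 p1); last first.
  by move=> r sr; rewrite shift_neg// ltW.
pose u := pos_part (shift (fun=> 1%R) s).
have mu_ : measurable_fun setT u by exact: measurable_pos_part.
have u0 r : 0 <= u r by exact: pos_part_ge0.
have uE r : u r = (\1_(`]0%R, s[%classic : set R) r : R)%:E.
  rewrite /u /pos_part /shift /ext /pos_part subr_gt0 indicE.
  have [r0|r0] := ltP 0%R r; have [rs|rs] := ltP r s.
  - by rewrite mem_set//= in_itv/= r0.
  - by rewrite memNset//= in_itv/= r0/=; apply/negP; rewrite -leNgt.
  - by rewrite memNset//= in_itv/= ltNge r0.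
  - by rewrite memNset//= in_itv/= ltNge r0.
have q0 v := psi_mass_ge0 mPhi Phi0 v.
have mq := measurable_psi_mass mPhi Phi0.
transitivity (mu%:E * (\int[mes1]_v u v + \int[mes1]_v (u v * psi_mass Phi v))).
  congr (_ * _); transitivity (\int[mes1]_v (u v + u v * psi_mass Phi v)).
    by apply: eq_integral => v _; rewrite -[X in _ + X]/(psi_mass Phi v) (ge0_muleDr _ lee01 (q0 v)) mule1.
  apply: ge0_integralD => //; first by move=> v _; exact: mule_ge0.
  exact: emeasurable_funM.
rewrite ge0_muleDr//; last 2 first.
- exact: integral_ge0.
- by apply: integral_ge0 => v _; exact: mule_ge0.
apply: eq_adde.
  rewrite EFinM; congr (_ * _).
  rewrite (eq_integral _ _ (fun r _ => uE r)) integral_indic// setIT.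
  rewrite [LHS](_ : _ = @lebesgue_measure R `]0%R, s[%classic)//.
  by rewrite lebesgue_measure_itv/= lte_fin; case: ifPn => [_|]; [rewrite -EFinB subr0|rewrite -leNgt => ?; congr (_%:E); apply/eqP; rewrite eq_le s0].
congr (_ * _); apply/esym/I_oo.
- exact: emeasurable_funM.
- by move=> v; exact: mule_ge0.
- by move=> v h; rewrite uE indicE mem_set//= mul1e (psi_massE mPhi Phi0).
- by move=> v h; rewrite uE indicE memNset ?mul0e//= in_itv/=; exact/negP.
Qed.

Lemma Rop_one_lt s v : (v < s)%R ->
  Rop Phi (shift (fun=> 1%R) s) v = 1 + I v s (fun y => Psi Phi (y - v)%R).
Proof.
move=> vs.
have m1 := mshift s admissible_one.
have p1 r := shift0 s r admissible_one.
have mpv : measurable_fun setT (fun t : R => psi (t - v)%R).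
  by apply: measurableT_comp => //; exact: measurable_funB.
rewrite /Rop; apply: eq_adde; first by rewrite /shift ext_pos// subr_gt0.
apply/esym/I_oo.
- exact: emeasurable_funM.
- by move=> y; exact: mule_ge0.
- move=> y /andP[vy ys]; rewrite psi_pos ?subr_gt0// /shift ext_pos ?subr_gt0//.
  by rewrite mule1.
- move=> y; rewrite negb_and -!leNgt => /orP[yv|sy].
    by rewrite psi_neg ?mul0e// subr_le0.
  by rewrite shift_neg// mule0.
Qed.

Lemma Rop_shift_ge zeta s v : (s <= v)%R -> Rop Phi (shift zeta s) v = 0.
Proof.
move=> sv; rewrite /Rop shift_neg// add0e; apply: integral0_eq => y _.
have [yv|vy] := leP y v; first by rewrite psi_neg ?mul0e// subr_le0.
by rewrite shift_neg ?mule0// (le_trans sv)// ltW.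
Qed.

Lemma E_XPhi_X zeta s t : admissible zeta -> (0 <= s)%R -> (s <= t)%R ->
  Exp P (fun w => Xz N lam Phi s w * Xz N lam zeta t w) =
  Exp P (Xz N lam Phi s) * Exp P (Xz N lam zeta t) +
  mu%:E * I 0 s (fun v => (zeta (t - v)%R)%:E * Psi Phi (s - v)%R * (1 + I 0 v (Psi Phi))) +
  mu%:E * I 0 t (fun u => I 0 (Num.min s u) (fun v => (zeta (t - u)%R)%:E * Psi Phi (u - v)%R *
     Psi Phi (s - v)%R * (1 + I 0 v (fun w => Psi Phi (v - w)%R)))).
Proof.
move=> az s0 st; rewrite (E_XzXz_Rop admissible_Phi az s0 st); last by move=> v; exact: Rop_shift_ge.
have -> : Rop Phi (shift Phi s) = fun v => psi (s - v)%R.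
  by apply/funext => v; exact: (Rop_phi mPhi Phi0).
have mps : measurable_fun setT (fun v : R => psi (s - v)%R).
  by apply: measurableT_comp => //; exact: measurable_funB.
have ps0 v : 0 <= psi (s - v)%R by [].
have psz v : (s <= v)%R -> psi (s - v)%R = 0 by move=> sv; rewrite psi_neg// subr_le0.
apply: eq_adde; last congr (_ * _); last first.
  apply/esym/(second_cov_term mPhi Phi0 az.1 az.2 mps ps0 psz (@ext_neg zeta)).
  move=> u v /andP[u0 ut] /andP[v0]; rewrite lt_min => /andP[vs vu].
  rewrite ext_pos ?subr_gt0// !psi_pos ?subr_gt0// (psi_mass_rev mPhi Phi0).
  by rewrite muleA.
apply: eq_adde => //; congr (_ * _).
apply/esym/(first_cov_term mPhi Phi0 az.1 az.2 mps ps0 psz).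
move=> v /andP[v0 vs].
by rewrite ext_pos ?subr_gt0 ?(lt_le_trans vs)// psi_pos ?subr_gt0// (psi_massE mPhi Phi0) muleA.
Qed.

Lemma E_Xone_X zeta s t : admissible zeta -> (0 <= s)%R -> (s <= t)%R ->
  Exp P (fun w => Xz N lam (fun=> 1%R) s w * Xz N lam zeta t w) =
  Exp P (Xz N lam (fun=> 1%R) s) * Exp P (Xz N lam zeta t) +
  mu%:E * I 0 s (fun u => (zeta (t - u)%R)%:E * (1 + I u s (fun y => Psi Phi (y - u)%R)) *
     (1 + I 0 u (Psi Phi))) +
  mu%:E * I 0 t (fun u => I 0 (Num.min s u) (fun v => (zeta (t - u)%R)%:E * Psi Phi (u - v)%R *
     (1 + I 0 v (Psi Phi)) * (1 + I v s (fun y => Psi Phi (y - v)%R)))).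
Proof.
move=> az s0 st; rewrite (E_XzXz_Rop admissible_one az s0 st); last by move=> v; exact: Rop_shift_ge.
set F := Rop Phi _.
have m1 := mshift s admissible_one.
have p1 r := shift0 s r admissible_one.
have mF : measurable_fun setT F by exact: mR.
have F0 v : 0 <= F v by exact: (Rop_ge0 mPhi Phi0).
have Fz v : (s <= v)%R -> F v = 0 by exact: Rop_shift_ge.
apply: eq_adde; last congr (_ * _); last first.
  apply/esym/(second_cov_term mPhi Phi0 az.1 az.2 mF F0 Fz (@ext_neg zeta)).
  move=> u v /andP[u0 ut] /andP[v0]; rewrite lt_min => /andP[vs vu].
  rewrite ext_pos ?subr_gt0// !psi_pos ?subr_gt0// (psi_massE mPhi Phi0).
  by rewrite /F Rop_one_lt// -muleA [(1 + psi_mass _ _) * _]muleC.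
apply: eq_adde => //; congr (_ * _).
apply/esym/(first_cov_term mPhi Phi0 az.1 az.2 mF F0 Fz).
move=> v /andP[v0 vs].
by rewrite ext_pos ?subr_gt0 ?(lt_le_trans vs)// /F Rop_one_lt// (psi_massE mPhi Phi0) muleA.
Qed.

End with_simple.
End hawkes.

Theorem theorem5p4 (R : realType) (d : measure_display) (Omega : measurableType d)
  (P : probability Omega R)
  (N : Omega -> {measure set (R * R)%type -> \bar R})
  (mu : R) (Phi : R -> R) (lam : Omega -> R -> R) (zeta : R -> R) :
  0 < mu ->
  measurable_fun (`[0%R, +oo[%classic : set R) Phi ->
  (forall x, 0 <= x -> 0 <= Phi x) ->
  (\int[leb]_(x in (`[0%R, +oo[%classic : set R)) (Phi x)%:E < 1)%E ->
  is_PRM P N ->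
  measurable_fun ([set: Omega] `*` (`[0%R, +oo[%classic : set R))
    (fun p : Omega * R => lam p.1 p.2) ->
  {ae P, forall w, forall t, 0 <= t ->
     (lam w t)%:E = (mu%:E + Xz N lam Phi t w)%E} ->
  (zeta = Phi \/ zeta = (fun _ : R => 1%R)) ->
  (* (i) *)
  (zeta = (fun _ : R => 1%R) -> forall s : R, 0 <= s ->
     Exp P (Xz N lam zeta s) =
       ((mu * s)%:E + mu%:E * I 0 s (fun u => I 0 u (Psi Phi)))%E) /\
  (zeta = Phi -> forall s : R, 0 <= s ->
     Exp P (Xz N lam zeta s) = (mu%:E * I 0 s (Psi Phi))%E) /\
  (* (ii) *)
  (forall s t : R, 0 <= s -> s <= t ->
     Exp P (fun w => Xz N lam Phi s w * Xz N lam zeta t w)%E =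
       (Exp P (Xz N lam Phi s) * Exp P (Xz N lam zeta t)
        + mu%:E * I 0 s (fun v => (zeta (t - v))%:E * Psi Phi (s - v)
                                   * (1 + I 0 v (Psi Phi)))
        + mu%:E * I 0 t (fun u => I 0 (Num.min s u) (fun v =>
              (zeta (t - u))%:E * Psi Phi (u - v) * Psi Phi (s - v)
              * (1 + I 0 v (fun w => Psi Phi (v - w))))))%E) /\
  (forall s t : R, 0 <= s -> s <= t ->
     Exp P (fun w => Xz N lam (fun _ : R => 1%R) s w * Xz N lam zeta t w)%E =
       (Exp P (Xz N lam (fun _ : R => 1%R) s) * Exp P (Xz N lam zeta t)
        + mu%:E * I 0 s (fun u => (zeta (t - u))%:E
                                   * (1 + I u s (fun y => Psi Phi (y - u)))
                                   * (1 + I 0 u (Psi Phi)))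
        + mu%:E * I 0 t (fun u => I 0 (Num.min s u) (fun v =>
              (zeta (t - u))%:E * Psi Phi (u - v)
              * (1 + I 0 v (Psi Phi))
              * (1 + I v s (fun y => Psi Phi (y - v))))))%E).
Proof.
move=> mu0 mPhi Phi0 Phi1 PN mlam sol zetaE.
have [N' SN NN] := exists_simple_prm PN.
have az : admissible zeta.
  by case: zetaE => ->; [exact: (admissible_Phi mPhi Phi0)|exact: admissible_one].
split; [|split; [|split]].
- move=> -> s s0; exact: (E_X_one mPhi Phi0 Phi1 mu0 mlam sol SN NN).
- move=> -> s s0; exact: (E_X_Phi mPhi Phi0 Phi1 mu0 mlam sol SN NN).
- move=> s t s0 st; exact: (E_XPhi_X mPhi Phi0 Phi1 mu0 mlam sol SN NN az).
- move=> s t s0 st; exact: (E_Xone_X mPhi Phi0 Phi1 mu0 mlam sol SN NN az).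
Qed.
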